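(* Let $1\le k\le L$, $a,x\ge0$ and $y\ge0$. The joint distribution of $M_0(\mathcal Y_k)$ and $Z(\mathcal Y_k)$ given the initial level $a$ and the initial phase is $$\mathcal P^{\boldsymbol\delta,\boldsymbol q}(a,x,y,k)=\boldsymbol q(a,y,k)-\boldsymbol{\mathcal Q}(a,x,y,k),$$ where $\boldsymbol{\mathcal Q}(a,x,y,k)$ is characterized as follows. (a) If $0=a\le x$, then $$\boldsymbol{\mathcal Q}_+(0,x,y,k)=\big(I-\Psi^{(0)}_x\Upsilon^{(0)}\big)^{-1}\Bigg(\sum_{n=0}^{k-1}\Lambda^{(n)}_x\boldsymbol q_+(x,y,k-n)+\sum_{\substack{m,n\ge0\\ 1\le m+n\le k-1}}\Psi^{(n)}_x\Upsilon^{(m)}\boldsymbol{\mathcal Q}_+(0,x,y,k-m-n)\Bigg),$$ $$\boldsymbol{\mathcal Q}_-(0,x,y,k)=\sum_{n=0}^{k-1}\Upsilon^{(n)}\boldsymbol{\mathcal Q}_+(0,x,y,k-n).$$ (b) Let $a>0$. (i) If $x\ge a$, then $$\boldsymbol{\mathcal Q}_+(a,x,y,k)=\big(I-\Psi^{(0)}_{x-a}\hat\Psi^{(0)}_a\big)^{-1}\Bigg(\sum_{n=0}^{k-1}\Lambda^{(n)}_{x-a}\boldsymbol q_+(x,y,k-n)+\sum_{\substack{m,n\ge0\\ 1\le m+n\le k-1}}\Psi^{(m)}_{x-a}\mathcal L(n,k-m)\Bigg),$$ $$\boldsymbol{\mathcal Q}_-(a,x,y,k)=\sum_{n=0}^{k-1}\mathcal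 L(n,k),$$ where $$\mathcal L(n,k)=\hat\Psi^{(n)}_a\boldsymbol{\mathcal Q}_+(a,x,y,k-n)+\hat\Lambda^{(n)}_a\boldsymbol{\mathcal Q}_-(0,x,y,k-n).$$ (ii) If $x<a$, then $\boldsymbol{\mathcal Q}_+(a,x,y,k)=\boldsymbol q_+(a,y,k)$ and $\boldsymbol{\mathcal Q}_-(a,x,y,k)=\boldsymbol q_-(a,y,k)$.
   Context: Random walk: $\{\varphi(t)\}_{t\ge0}$ is a continuous-time Markov chain on a finite set $\mathcal S$ (phases) with infinitesimal generator $A$; each phase $i$ has a rate $c_i\in\mathbb R\setminus\{0\}$; $\mathcal S_+=\{i:c_i>0\}$, $\mathcal S_-=\{i:c_i<0\}$. The unrestricted level is $X(t)=X(0)+\int_0^t c_{\varphi(s)}\,ds$. Fluid queue: the level $Z(t)\ge0$ starts from $Z(0)=a\ge0$ and varies at rate $c_{\varphi(t)}$ like the random walk, except that during the intervals of time when $Z(t)=0$ and the rate at time $t$ is negative, the level remains equal to zero. For $X(0)=Z(0)=0$ this is $Z(t)=X(t)-\inf_{0\le v\le t}X(v)$. Erlang clock: $\nu>0$ and an integer $L\ge1$ are fixed; $Y_1,Y_2,\dots$ are i.i.d. exponential random variables with parameter $\nu$, independent of $\varphi$ and $X$; $\mathcal Y_k=\sum_{n=1}^kY_n$ ($\mathcal Y_0=0$), and $T=\mathcal Y_L$ has an Erlang distribution. For $t<T$ the stage $\phi(t)$ is the number of completed exponential stages: $\phi(t)=n$ if $\mathcal Y_n\le t<\mathcal Y_{n+1}$,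 $0\le n\le L-1$. Put $\Phi(t)=(\varphi(t),\phi(t))$. $\mathbb P_i^a[\cdot]$ is the conditional probability given initial level $a$, $\varphi(0)=i$ and initial stage $0$. First-passage matrices: with $\tau_+(x)=\inf\{t>0:X(t)>x\}$ and $\tau_-(x)=\inf\{t>0:X(t)<x\}$, for a level $x$ and $0\le k\le L-1$: $(\Lambda^{(k)}_x)_{ij}=\mathbb P_i^0[\tau_+(x)<\tau_-(0),\ \tau_+(x)<T,\ \Phi(\tau_+(x))=(j,k)]$ for $i,j\in\mathcal S_+$, the probability, starting from level $0$ in phase $i$, of reaching level $x$ in phase $j$ during stage $k$ under taboo of level zero; $(\Psi^{(k)}_x)_{iu}=\mathbb P_i^0[\tau_-(0)<\tau_+(x),\ \tau_-(0)<T,\ \Phi(\tau_-(0))=(u,k)]$ for $i\in\mathcal S_+$, $u\in\mathcal S_-$, the probability, starting from level $0$ in phase $i$, of returning to level $0$ in phase $u$ during stage $k$ without having reached level $x$; $(\hat\Lambda^{(k)}_x)_{ij}=\mathbb P_i^x[\tau_-(0)<\tau_+(x),\ \tau_-(0)<T,\ \Phi(\tau_-(0))=(j,k)]$ for $i,j\in\mathcal S_-$; $(\hat\Psi^{(k)}_x)_{iu}=\mathbb P_i^x[\tau_+(x)<\tau_-(0),\ \tau_+(x)<T,\ \Phi(\tau_+(x))=(u,k)]$ for $i\in\mathcal S_-$, $u\in\mathcal S_+$. With $\beta=\inf\{t>0:\varphi(t)\in\mathcal S_+\}$, $\Upsilon^{(n)}_{ij}$, for $i\in\mathcal S_-$,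 $j\in\mathcal S_+$, $0\le n\le L-1$, is the probability that $\phi(\beta)=n$ and $\varphi(\beta)=j$ given initial level $0$, initial phase $i$ and initial stage $0$, that is, the probability that the fluid queue started at level $0$ in phase $i$ leaves level $0$ in phase $j$ during stage $n$. $M_0(t)=\max\{Z(v):0\le v\le t\}$. For $i\in\mathcal S$: $q_i(a,y,k)=\mathbb P_i^a[Z(\mathcal Y_k)\le y]$, $\mathcal P^{\boldsymbol\delta,\boldsymbol q}_i(a,x,y,k)=\mathbb P_i^a[M_0(\mathcal Y_k)\le x,\ Z(\mathcal Y_k)\le y]$ and $\mathcal Q_i(a,x,y,k)=\mathbb P_i^a[M_0(\mathcal Y_k)>x,\ Z(\mathcal Y_k)\le y]$; the corresponding vectors have subvectors with subscripts $\pm$ indexed by $\mathcal S_\pm$. $I$ is the identity matrix. Empty sums are zero.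
   Formalization: In (b)(i) the bracket in the formula for Q_+(a,x,y,k) needs the additional term Ψ^{(0)}_{x-a} Λ̂^{(0)}_a Q_-(0,x,y,k), the part of the m=n=0 term that the inverse does not absorb; without it the formula is false, and the corrected formula is what is proved. *)

(* Defs.v *)
From HB Require Import structures.
From mathcomp Require Export all_boot all_order all_algebra.
From mathcomp Require Export all_classical all_reals all_analysis.
Export numFieldNormedType.Exports.
Export Order.TTheory GRing.Theory Num.Theory.

Set Implicit Arguments.
Unset Strict Implicit.
Unset Printing Implicit Defensive.

Local Open Scope classical_set_scope.
Local Open Scope ring_scope.

Section markov_chain.
Context {R : realType} {S : finType}.
Variable A : S -> S -> R.

Definition is_generator : Prop :=
  (forall i j, i != j -> 0 <= A i j) /\ (forall i, \sum_j A i j = 0).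

Definition generator_mx : 'M[R]_#|S| :=
  \matrix_(i, j) A (enum_val i) (enum_val j).

(* exp(t A)_ij *)
Definition transition (t : R) (i j : S) : R :=
  limn (series (fun n : nat => t ^+ n / n`!%:R *
    (generator_mx ^+ n) (enum_rank i) (enum_rank j))).

Definition cadlag_path (f : R -> S) : Prop :=
  (forall t, 0 <= t -> \forall u \near t^'+, f u = f t) /\
  (forall t, 0 < t -> exists j, \forall u \near t^'-, f u = j).

Context {d : measure_display} {Omega : measurableType d}.
Variables (P : S -> probability Omega R) (phi : Omega -> R -> S).

(* sigma-algebra of phi up to time s *)
Definition past (s : R) : set (set Omega) :=
  <<s [set E | exists u j, [/\ 0 <= u, u <= s & E = [set w | phi w u = j]]] >>.

Definition whole : set (set Omega) :=
  <<s [set E | exists u j, 0 <= u /\ E = [set w | phi w u = j]] >>.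

(* P i is the law given the initial phase i; negative times are irrelevant *)
Definition is_ctmc : Prop :=
  [/\ is_generator,
      forall w, cadlag_path (phi w),
      forall t j, 0 <= t -> measurable [set w | phi w t = j],
      forall i, P i [set w | phi w 0 = i] = 1%E &
      forall i s t E j l, 0 <= s -> 0 <= t -> past s E ->
        P i (E `&` [set w | phi w s = j] `&` [set w | phi w (s + t) = l]) =
        (P i (E `&` [set w | phi w s = j]) * (transition t j l)%:E)%E].

Variable Y : nat -> {mfun Omega >-> R}.

(* Y n stands for Y_(n+1) *)
Definition is_exponential_clock (nu : R) : Prop :=
  (forall i n B, measurable B -> P i (Y n @^-1` B) = exponential_prob nu B) /\
  (forall i E m (B : nat -> set R), whole E -> (forall n, measurable (B n)) ->
     P i (E `&` \bigcap_(n in [set n | (n < m)%N]) (Y n @^-1` B n)) =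
     (P i E * \prod_(n < m) P i (Y n @^-1` B n))%E).

End markov_chain.

Section paths.
Context {R : realType} {S : finType}.
Variables (c : S -> R) (f : R -> S).

Definition S_plus : {set S} := [set i | 0 < c i]%SET.
Definition S_minus : {set S} := [set i | c i < 0]%SET.

(* random walk X(t) with X(0) = a *)
Definition level (a t : R) : R :=
  a + \int[lebesgue_measure]_(s in `[0, t]) c (f s).

(* fluid queue started at a; for t < 0 the integral is over the empty set, so
   that z t = a *)
Definition is_fluid_queue (a : R) (z : R -> R) : Prop :=
  [/\ continuous z,
      forall t, 0 <= z t &
      forall t, z t = a + \int[lebesgue_measure]_(s in `[0, t])
        (if (z s == 0) && (c (f s) < 0) then 0 else c (f s))].

Definition running_max (z : R -> R) (t : R) : R := sup [set z v | v in `[0, t]].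

Definition tau_up (a x : R) : \bar R :=
  ereal_inf [set t%:E | t in [set t | 0 < t /\ x < level a t]].

Definition tau_down (a x : R) : \bar R :=
  ereal_inf [set t%:E | t in [set t | 0 < t /\ level a t < x]].

Definition beta : \bar R :=
  ereal_inf [set t%:E | t in [set t | 0 < t /\ f t \in S_plus]].

(* the clock with exponential stages y 0, y 1, ...: end of the k-th stage *)
Definition clock (y : nat -> R) (k : nat) : R := \sum_(n < k) y n.

Definition in_stage (y : nat -> R) (k : nat) (t : R) : Prop :=
  clock y k <= t < clock y k.+1.

(* t < T = clock y L and (phase, stage)(t) = (j, k) *)
Definition alive_at (y : nat -> R) (L : nat) (t : \bar R) (j : S) (k : nat)
  : Prop :=
  [/\ (t < (clock y L)%:E)%E, f (fine t) = j & in_stage y k (fine t)].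

End paths.

Section probabilities.
Context {R : realType} {S : finType} {d : measure_display}
  {Omega : measurableType d}.

Definition vec (B : {set S}) (g : S -> R) : 'cV[R]_#|B| :=
  \col_i g (enum_val i).

Definition mat (B C : {set S}) (g : S -> S -> R) : 'M[R]_(#|B|, #|C|) :=
  \matrix_(i, j) g (enum_val i) (enum_val j).

Variables (P : S -> probability Omega R) (c : S -> R) (phi : Omega -> R -> S).
Variables (Y : nat -> {mfun Omega >-> R}) (L : nat).

(* from level a: x is upcrossed before 0 is downcrossed, in phase j, stage k *)
Definition up_prob (a x : R) (k : nat) (i j : S) : R :=
  fine (P i [set w |
    (tau_up c (phi w) a x < tau_down c (phi w) a 0)%E /\
    alive_at (phi w) (Y ^~ w) L (tau_up c (phi w) a x) j k]).

(* from level a: 0 is downcrossed before x is upcrossed, in phase j, stage k *)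
Definition down_prob (a x : R) (k : nat) (i j : S) : R :=
  fine (P i [set w |
    (tau_down c (phi w) a 0 < tau_up c (phi w) a x)%E /\
    alive_at (phi w) (Y ^~ w) L (tau_down c (phi w) a 0) j k]).

Definition Lambda (x : R) (k : nat) := mat (S_plus c) (S_plus c) (up_prob 0 x k).
Definition Psi (x : R) (k : nat) := mat (S_plus c) (S_minus c) (down_prob 0 x k).
Definition hLambda (x : R) (k : nat) :=
  mat (S_minus c) (S_minus c) (down_prob x x k).
Definition hPsi (x : R) (k : nat) := mat (S_minus c) (S_plus c) (up_prob x x k).

Definition Upsilon (n : nat) :=
  mat (S_minus c) (S_plus c) (fun i j => fine (P i [set w |
    alive_at (phi w) (Y ^~ w) L (beta c (phi w)) j n])).

Variable Z : R -> Omega -> R -> R.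

Definition q_prob (a y : R) (k : nat) (i : S) : R :=
  fine (P i [set w | Z a w (clock (Y ^~ w) k) <= y]).

Definition joint_prob (a x y : R) (k : nat) (i : S) : R :=
  fine (P i [set w | running_max (Z a w) (clock (Y ^~ w) k) <= x /\
                     Z a w (clock (Y ^~ w) k) <= y]).

Definition Q_prob (a x y : R) (k : nat) (i : S) : R :=
  fine (P i [set w | x < running_max (Z a w) (clock (Y ^~ w) k) /\
                     Z a w (clock (Y ^~ w) k) <= y]).

End probabilities.

(* Main.v *)
From HB Require Import structures.
Require Import Defs.
From mathcomp Require Import measurable_realfun ring lra.

Set Implicit Arguments.
Unset Strict Implicit.
Unset Printing Implicit Defensive.

Local Open Scope classical_set_scope.
Local Open Scope ring_scope.

(** Why the formulas hold.

    Every probability in the theorem is decomposed at a random time at which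
    the level and the sign of the rate are known, and the process restarts
    there with a new initial phase and a shorter Erlang clock.  The identities
    are the resulting renewal equations, solved for one unknown.

    Pathwise part.  The fluid level [z] is the reflected walk: between its last
    zero and [t] it moves like the walk [X], so that [z t <= u] amounts to
    [a + X t <= u] and [X t - X v <= u] for all [v] in [0, t] ([fluid_le]).
    This turns the events on [Z] and on its running maximum into events of the
    pair (phase path, clock), measurable since countably many rational times
    suffice ([measurable_exceeds]), and shows that after a time [s] the level
    is the reflected walk of the shifted path started at [z s]
    ([exceeds_restart]).  Inside a band [l, h] with [0 <= l] the level is the
    walk itself: it leaves the band at [h] in a phase of positive rate or at
    [l] in a phase of negative rate, or it stays below [h] for ever.  A queue
    that is empty in a phase of negative rate stays empty until [beta].

    Probabilistic part.  At a fixed time [s] during stage [n], the shifted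
    phase path and the residual clock are distributed as a fresh phase path and
    a fresh clock, by the Markov property and the lack of memory of exponential
    variables ([joint_markov]).  An optional time is approximated from above by
    multiples of [1 / n.+1]; the Markov property at these values passes to the
    limit, because paths are right-continuous, and extends from cylinders to
    all measurable sets of path-clock pairs.  This strong Markov property
    ([strong_markov]) yields the general renewal formula [renewal], hence the
    decompositions [band_renewal] and [beta_renewal].  The restart at level [x]
    in a phase of positive rate produces a [q] in place of a [Q], since the
    maximum exceeds [x] at once ([Q_prob_above]).

    Linear algebra.  Inserting the equation for the negative phases into the
    one for the positive phases gives a sum over all [m], [n] with [m + n < k],
    whose term [m = n = 0] contains the unknown [Q_p a k] itself
    ([big_triangle]).  It moves to the left-hand side as
    [1 - Psi^(0) * B^(0)], where [B] is [Upsilon] or the up-crossing matrix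
    [hPsi].  This matrix is invertible: a path that starts in a phase of
    positive rate needs a positive time to come down, the first stage may be
    over by then, and so the rows of [Psi^(0)] sum to less than one
    ([stopped_sum_lt1], [unitmx_substochastic]). *)

(** * Limits of events and approximation of times from above *)

Section eventually.
Context {R : realType} {d} {T : measurableType d}.
Variables (A_ : nat -> set T) (A : set T).
Hypothesis mA_ : forall n, measurable (A_ n).
Hypothesis A_A : forall w, \forall n \near \oo, A_ n w <-> A w.

Lemma eventually_measurable : measurable A.
Proof.
rewrite (_ : A = \bigcup_N \bigcap_(n in [set n | (N <= n)%N]) A_ n).
  apply: bigcupT_measurable => N; apply: bigcap_measurable => //.
  by exists N => /=.
apply/seteqP; split => w.
  move=> Aw; have [N _ NA] := A_A w; exists N => // n /= Nn.
  exact/(NA n Nn).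
move=> [N _ NA]; have [M _ MA] := A_A w.
apply/(MA (maxn N M)); rewrite /= ?leq_maxr//.
by apply: NA; rewrite /= leq_maxl.
Qed.

(** Events that stabilize at every point have converging indicators, so that
    dominated convergence applies: this is how probabilities at a random time
    are obtained from those at discretized times. *)
Lemma eventually_cvg_measure (mu : {finite_measure set T -> \bar R}) :
  mu (A_ n) @[n --> \oo] --> mu A.
Proof.
have mA := eventually_measurable.
have E B : measurable B -> mu B = (\int[mu]_x (\1_B x)%:E)%E.
  by move=> mB; rewrite integral_indic// setIT.
rewrite E//; under eq_fun do rewrite E//.
apply: (@dominated_cvg _ _ _ mu setT measurableT _ _ (cst 1%E)) => //.
- by move=> n; apply/measurable_EFinP; exact: measurable_indic.
- move=> w _; apply: cvg_near_cst.
  have := A_A w; apply: filterS => n AA; rewrite /= !indicE.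
  by congr (_%:R%:E); congr nat_of_bool; apply/idP/idP => /set_mem/AA/mem_set.
- by apply: finite_measure_integrable_cst.
- by move=> n x _; rewrite /= lee_fin ger0_norm indicE ?ler0n// lern1; case: (_ \in _).
Unshelve. all: by end_near. Qed.

End eventually.

Section grid.
Context {R : realType}.

(** The least multiple of [1 / n.+1] that is strictly above [s], for [0 <= s]:
    strictness is what makes right limits at [s] apply. *)
Definition grid (n : nat) (s : R) : R :=
  (Num.truncn (n.+1%:R * s)).+1%:R / n.+1%:R.

Lemma grid_gt n s : 0 <= s -> s < grid n s.
Proof.
move=> s0; rewrite /grid ltr_pdivlMr// mulrC.
by have /andP[] := truncn_itv (mulr_ge0 (ler0n R n.+1) s0).
Qed.

Lemma grid_le n s : 0 <= s -> grid n s <= s + n.+1%:R^-1.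
Proof.
move=> s0; have n0 : n.+1%:R != 0 :> R by [].
rewrite /grid ler_pdivrMr// mulrDl (mulVf n0) -[(Num.truncn _).+1%:R]natr1.
rewrite lerD2r [leRHS]mulrC.
by have /andP[] := truncn_itv (mulr_ge0 (ler0n R n.+1) s0).
Qed.

Lemma grid_near (s : R) (Q : R -> Prop) : 0 <= s ->
  (\forall u \near s^'+, Q u) -> \forall n \near \oo, Q (grid n s).
Proof.
move=> s0 [e /= e0 eQ].
have := near_infty_natSinv_lt (PosNum e0); apply: filterS => n /= ne.
apply: eQ; last exact: grid_gt.
rewrite /= ltr0_norm ?subr_lt0 ?grid_gt// opprB ltrBlDl.
by apply: le_lt_trans (grid_le n s0) _; rewrite ltrD2l.
Qed.

Lemma gridP n s m : 0 <= s ->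
  (grid n s = m.+1%:R / n.+1%:R) <-> (m%:R / n.+1%:R <= s < m.+1%:R / n.+1%:R).
Proof.
move=> s0; have n0 : 0 < n.+1%:R :> R by [].
rewrite ler_pdivrMr// ltr_pdivlMr// [s * _]mulrC /grid; split.
  move/(mulIf (invr_neq0 (lt0r_neq0 n0)))/eqP; rewrite eqr_nat eqSS => /eqP <-.
  by apply: truncn_itv; rewrite mulr_ge0.
by move/truncn_def ->.
Qed.

Lemma grid_ex n s : 0 <= s -> exists m, grid n s = m.+1%:R / n.+1%:R.
Proof. by move=> s0; exists (Num.truncn (n.+1%:R * s)). Qed.

End grid.

(** * Joint measurability of right-continuous paths *)

Section jointly.
Context {R : realType} {S : finType} {d} {T : measurableType d}.
Variables (f : T -> R -> S) (t0 : R).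
Hypothesis frc : forall w (t : R), 0 <= t -> \forall u \near t^'+, f w u = f w t.
Hypothesis mf : forall (u : R) j, 0 <= u -> u <= t0 -> measurable [set w | f w u = j].

(** Right-continuity makes the phase at [s] the limit of the phases at the grid
    points above [s], which take countably many values.  Cutting the grid at
    [t0] keeps the dependence within the phases up to [t0], so that [T] may
    carry the events of the past of [t0]. *)
Lemma path_jointly_measurable j :
  measurable [set p : T * R | 0 <= p.2 <= t0 /\ f p.1 p.2 = j].
Proof.
pose A_ n := [set p : T * R | 0 <= p.2 <= t0 /\
   f p.1 (Num.min t0 (grid n p.2)) = j].
have [t00|t00] := ltP t0 0.
  rewrite (_ : [set _ | _] = set0)//; apply/seteqP; split => // -[w s] /= [].
  by move=> /andP[s0 /(le_trans s0)]; rewrite leNgt t00.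
apply: (@eventually_measurable _ _ A_).
  move=> n.
  rewrite (_ : A_ n = \bigcup_m
      ([set w | f w (Num.min t0 (m.+1%:R / n.+1%:R)) = j] `*`
       (`[0, t0] `&` `[m%:R / n.+1%:R, m.+1%:R / n.+1%:R[)%classic)).
    apply: bigcupT_measurable => m; apply: measurableX.
      apply: mf; first by rewrite le_min t00 divr_ge0.
      by rewrite ge_min lexx.
    by apply: measurableI; exact: measurable_itv.
  apply/seteqP; split => -[w s] /=.
    move=> [/andP[s0 st0] fj]; have [m mE] := grid_ex n s0.
    exists m => //=; rewrite !in_itv/= s0 st0; split; first by rewrite -mE.
    by split => //; exact: (gridP n m s0).1 mE.
  move=> [m _] /= []; rewrite !in_itv/= => fj [/andP[s0 st0]] /(gridP n m s0) E.
  by rewrite /A_ /= E s0 st0.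
move=> [w s]; rewrite /A_ /=.
have [s0|s0] := ltP s 0.
  by apply: nearW => n /=; split => -[].
have [st0|st0] := leP s t0; last by apply: nearW => n /=; split => -[].
suff : \forall n \near \oo, f w (Num.min t0 (grid n s)) = f w s.
  by apply: filterS => n ->.
move: st0; rewrite le_eqVlt => /predU1P[<-|st0].
  by apply: nearW => n; rewrite min_l// ltW// grid_gt.
apply: (grid_near s0 (Q := fun u => f w (Num.min t0 u) = f w s)).
have fs := frc w s0; near=> u.
rewrite min_r; first by near: u.
by near: u; apply: nbhs_right_le.
Unshelve. all: by end_near. Qed.

End jointly.

(** * Integrals of bounded rates *)

Section bounded_rates.
Context {R : realType}.
Implicit Types (g h : R -> R) (s t : R).

Definition bounded_rate (g : R -> R) : Prop :=
  (forall t, measurable_fun `[0, t] g) /\ (exists K : R, forall s, `|g s| <= K).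

Definition integral_to (g : R -> R) (t : R) : R :=
  \int[lebesgue_measure]_(s in `[0, t]) g s.

Lemma bounded_rate_cst m : bounded_rate (cst m).
Proof. by split=> [t|]; [exact: measurable_cst|exists `|m|]. Qed.

Lemma bounded_rate_integrable g t : bounded_rate g ->
  lebesgue_measure.-integrable `[0, t] (EFin \o g).
Proof.
move=> [mg [K gK]].
apply: measurable_bounded_integrable => //.
  by rewrite /= lebesgue_measure_itv/=; case: ifP => // _; rewrite -EFinB ltry.
  exact: mg.
exists K; split; first exact: num_real.
by move=> M KM x _ /=; rewrite (le_trans (gK x))// ltW.
Qed.

Lemma integral_to_le0 g t : t <= 0 -> integral_to g t = 0.
Proof.
rewrite le_eqVlt => /predU1P[->|t0]; rewrite /integral_to.
  by rewrite set_itv1 Rintegral_set1.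
by rewrite set_itv_ge ?Rintegral_set0// bnd_simp -ltNge.
Qed.

Lemma integral_toB g s t : bounded_rate g -> 0 <= s -> s <= t ->
  integral_to g t - integral_to g s = \int[lebesgue_measure]_(u in `]s, t]) g u.
Proof.
move=> gb s0 st; rewrite /integral_to Rintegral_itvB//.
exact: bounded_rate_integrable.
Qed.

Lemma integral_to_cst m t : 0 <= t -> integral_to (cst m) t = m * t.
Proof.
move=> t0; rewrite /integral_to Rintegral_cst//= lebesgue_measure_itv/=.
rewrite lte_fin; case: ltP => [_|]; first by rewrite -EFinB subr0.
by move=> t0'; rewrite (@le_anti _ _ t 0) ?t0 ?t0'// mulr0.
Qed.

Lemma integral_to_le g h s t : bounded_rate g -> bounded_rate h ->
  0 <= s -> s <= t -> (forall u, s < u -> u <= t -> g u <= h u) ->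
  integral_to g t - integral_to g s <= integral_to h t - integral_to h s.
Proof.
move=> gb hb s0 st gh; rewrite !integral_toB//.
have sub : `]s, t] `<=` `[0, t].
  by move=> u /=; rewrite !in_itv/= => /andP[su ->]; rewrite andbT (le_trans s0)// ltW.
apply: le_Rintegral => //.
- by apply: integrableS (bounded_rate_integrable t gb).
- by apply: integrableS (bounded_rate_integrable t hb).
- by move=> u /=; rewrite in_itv/= => /andP[]; exact: gh.
Qed.

Lemma integral_to_eq g h s t : bounded_rate g -> bounded_rate h ->
  0 <= s -> s <= t -> (forall u, s < u -> u <= t -> g u = h u) ->
  integral_to g t - integral_to g s = integral_to h t - integral_to h s.
Proof.
move=> gb hb s0 st gh; apply/eqP; rewrite eq_le.
by rewrite !integral_to_le// => u su ut; rewrite gh.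
Qed.

(** Translation invariance of Lebesgue measure. *)
Lemma integral_to_shift g s t : bounded_rate g ->
  bounded_rate (fun u => g (s + u)) -> 0 <= s -> 0 <= t ->
  integral_to (fun u => g (s + u)) t = integral_to g (s + t) - integral_to g s.
Proof.
move=> gb gsb s0 t0.
pose phi : measurableTypeR R -> measurableTypeR R := fun u => s + u.
have mphi : measurable_fun setT phi by exact: measurable_funD.
pose h : R -> R := g \_ `[s, s + t].
have E (u : R) : h (s + u) = ((fun u : R => g (s + u)) \_ `[0, t]) u.
  rewrite /h /patch; congr (if _ then _ else _).
  by apply/idP/idP; rewrite !inE/= !in_itv/= lerD2l lerDl.
have mg : measurable_fun setT (EFin \o h).
  apply/measurable_EFinP/(measurable_restrictT _ _).1 => //.
  apply: measurable_funS (gb.1 (s + t)) => //.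
  by move=> u /=; rewrite !in_itv/= => /andP[su ->]; rewrite andbT (le_trans s0).
rewrite integral_toB//; last by rewrite lerDl.
rewrite Rintegral_itv_obnd_cbnd; last first.
  apply: integrableS (bounded_rate_integrable (s + t) gb) => //.
  by move=> u /=; rewrite !in_itv/= => /andP[/ltW su ->]; rewrite andbT (le_trans s0).
rewrite /integral_to [LHS]Rintegral_mkcond [RHS]Rintegral_mkcond /Rintegral.
congr fine.
transitivity (\int[pushforward lebesgue_measure phi]_x
   (EFin \o h) x)%E.
  rewrite integral_pushforward//.
    by apply: eq_integral => u _; rewrite /= E.
  rewrite preimage_setT.
  rewrite (_ : _ \o _ = (EFin \o ((fun u : R => g (s + u)) \_ `[0, t]))); last first.
    by apply/funext => u /=; rewrite E.
  rewrite -restrict_EFin; apply/(integrable_mkcond _ _).1 => //.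
  exact: bounded_rate_integrable.
apply: eq_measure_integral => A mA _; apply/esym/lebesgue_measure_unique => //.
move=> _ [[a b] _ <-].
transitivity (lebesgue_measure (phi @^-1` `]a, b]%classic)); last by [].
rewrite (_ : _ @^-1` _ = `]a - s, b - s]%classic); last first.
  by apply/seteqP; split => u /=; rewrite !in_itv/= ltrBlDl lerBrDl.
rewrite !lebesgue_measure_itv/= !lte_fin ltrD2r -!EFinB.
by rewrite opprB addrA subrK.
Qed.

End bounded_rates.

(** * The walk and the reflected walk of one path *)

Definition right_continuous_path {R : realType} {S : Type} (f : R -> S) :=
  forall t : R, 0 <= t -> \forall u \near t^'+, f u = f t.

Section level_theory.
Context {R : realType} {S : finType} (c : S -> R) (f : R -> S).
Hypothesis frc : right_continuous_path f.
Implicit Types (s t : R).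

Definition max_rate : R := \sum_j `|c j|.

Lemma max_rateP j : `|c j| <= max_rate.
Proof. by rewrite /max_rate (bigD1 j)//= lerDl sumr_ge0. Qed.

Lemma max_rate_ge0 : 0 <= max_rate. Proof. exact: sumr_ge0. Qed.

(** One path is a family of paths indexed by a one-point space. *)
Lemma path_measurable t j : measurable [set s | 0 <= s <= t /\ f s = j].
Proof.
have m1 (A : set unit) : measurable A by [].
have mJ := @path_jointly_measurable R S _ unit (fun _ => f) t (fun _ => @frc)
  (fun u j _ _ => m1 _) j.
have := measurable_xsection tt mJ.
congr measurable; apply/seteqP.
by split=> s /=; rewrite /xsection/= inE.
Qed.

Lemma bounded_rate_path : bounded_rate (c \o f).
Proof.
split=> [t|]; last by exists max_rate => s; exact: max_rateP.
move=> _ B mB.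
rewrite (_ : _ `&` _ = \bigcup_(j in [set j | B (c j)])
                         [set s | 0 <= s <= t /\ f s = j]).
  by apply: fin_bigcup_measurable => // j _; exact: path_measurable.
apply/seteqP; split => s /=; rewrite in_itv/=.
  by move=> [st Bs]; exists (f s).
by move=> [j /= Bj [st fj]]; rewrite st fj.
Qed.

End level_theory.

Section walk.
Context {R : realType} {S : finType}.
Implicit Types (c : S -> R) (f : R -> S) (s t u v b m : R).

Definition walk c f t := integral_to (c \o f) t.

Lemma levelE c f b t : level c f b t = b + walk c f t.
Proof. by []. Qed.

Definition theta s f : R -> S := fun t => f (s + t).

Lemma theta_right_continuous s f : 0 <= s ->
  right_continuous_path f -> right_continuous_path (theta s f).
Proof.
move=> s0 frc t t0; have [e /= e0 ef] := frc (s + t) (addr_ge0 s0 t0).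
exists e => //= u /= ut tu; apply: ef; last by rewrite ltrD2l.
by rewrite /= opprD addrACA subrr add0r.
Qed.

Variables (c : S -> R) (f : R -> S).
Hypothesis frc : right_continuous_path f.

Let rate_path := bounded_rate_path c frc.

Lemma walk_le0 t : t <= 0 -> walk c f t = 0.
Proof. exact: integral_to_le0. Qed.

Lemma walk_diff_le m s t : 0 <= s -> s <= t ->
  (forall u, s < u -> u <= t -> c (f u) <= m) ->
  walk c f t - walk c f s <= m * (t - s).
Proof.
move=> s0 st cm; rewrite mulrBr -!integral_to_cst//; last exact: le_trans st.
by apply: integral_to_le => //; exact: bounded_rate_cst.
Qed.

Lemma walk_diff_ge m s t : 0 <= s -> s <= t ->
  (forall u, s < u -> u <= t -> m <= c (f u)) ->
  m * (t - s) <= walk c f t - walk c f s.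
Proof.
move=> s0 st cm; rewrite mulrBr -!integral_to_cst//; last exact: le_trans st.
by apply: integral_to_le => //; exact: bounded_rate_cst.
Qed.

Lemma walk_lipschitz s t :
  `|walk c f t - walk c f s| <= max_rate c * `|t - s|.
Proof.
wlog st : s t / s <= t.
  move=> h; have [/h//|/ltW/h] := leP s t.
  by rewrite distrC [`|s - t|]distrC.
rewrite [`|t - s|]ger0_norm ?subr_ge0//.
have K0 := max_rate_ge0 c.
have cK j : - max_rate c <= c j <= max_rate c by rewrite -ler_norml max_rateP.
have [t0|t0] := leP t 0.
  by rewrite !walk_le0 ?(le_trans st)// subrr normr0 mulr_ge0// subr_ge0.
have [s0|s0] := leP 0 s.
  rewrite ler_norml -mulNr walk_diff_ge ?walk_diff_le//.
    by move=> u _ _; have /andP[] := cK (f u).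
  by move=> u _ _; have /andP[] := cK (f u).
have w0 : walk c f 0 = 0 by rewrite walk_le0.
rewrite (walk_le0 (ltW s0)) -w0; apply: (@le_trans _ _ (max_rate c * (t - 0))).
  have t0' := ltW t0.
  rewrite ler_norml -mulNr walk_diff_ge ?walk_diff_le//.
    by move=> u _ _; have /andP[] := cK (f u).
  by move=> u _ _; have /andP[] := cK (f u).
by rewrite ler_wpM2l// lerB// ltW.
Qed.

Lemma walk_theta s t : 0 <= s -> 0 <= t ->
  walk c (theta s f) t = walk c f (s + t) - walk c f s.
Proof.
move=> s0 t0; apply: integral_to_shift => //.
by have /(bounded_rate_path c) := theta_right_continuous s0 frc.
Qed.

Lemma walk_near s e : 0 < e ->
  exists2 r, 0 < r & forall t, `|t - s| < r -> `|walk c f t - walk c f s| < e.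
Proof.
move=> e0; have K0 := max_rate_ge0 c.
exists (e / (max_rate c + 1)); first by rewrite divr_gt0// ltr_wpDl.
move=> t ts; apply: le_lt_trans (walk_lipschitz s t) _.
apply: (@le_lt_trans _ _ ((max_rate c + 1) * `|t - s|)).
  by rewrite ler_wpM2r// lerDl.
by rewrite mulrC -ltr_pdivlMr// ltr_wpDl.
Qed.

(** The phase is constant on a right neighbourhood, so that the walk is linear
    there. *)
Lemma walk_right_linear s : 0 <= s -> exists2 r, 0 < r &
  forall t, s <= t -> t < s + r -> walk c f t - walk c f s = c (f s) * (t - s).
Proof.
move=> s0; have [r /= r0 rf] := frc s0; exists r => // t st tsr.
have cf u : s < u -> u <= t -> c (f u) = c (f s).
  move=> su ut; rewrite (rf u)//= ltr0_norm ?subr_lt0// opprB ltrBlDl.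
  exact: le_lt_trans tsr.
apply/eqP; rewrite eq_le walk_diff_le ?walk_diff_ge//.
  by move=> u su ut; rewrite cf.
by move=> u su ut; rewrite cf.
Qed.

(** The walk started at [b] and reflected at zero is
    [max (b + X t) (sup_(v <= t) (X t - X v))]; this is the property that it is
    at most [u] at time [t], stated without suprema. *)
Definition reflected_le c f b t u :=
  b + walk c f t <= u /\
  forall v, 0 <= v -> v <= t -> walk c f t - walk c f v <= u.

Section fluid.
Variables (a : R) (z : R -> R).
Hypothesis zf : is_fluid_queue c f a z.

Let zc : continuous z. Proof. by case: zf. Qed.
Let z0 t : 0 <= z t. Proof. by case: zf. Qed.

Definition fluid_rate s := if (z s == 0) && (c (f s) < 0) then 0 else c (f s).

Let zE t : z t = a + integral_to fluid_rate t.
Proof. by case: zf => _ _; exact. Qed.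

Lemma bounded_rate_fluid : bounded_rate fluid_rate.
Proof.
split=> [t|]; last first.
  exists (max_rate c) => s; rewrite /fluid_rate; case: ifP => _.
    by rewrite normr0 max_rate_ge0.
  exact: max_rateP.
have mc := rate_path.1 t.
apply: measurable_fun_if => //.
- apply: measurable_and.
    apply: measurable_fun_eqr; last exact: measurable_cst.
    by apply: measurable_funTS; exact: continuous_measurable_fun.
  by apply: measurable_fun_ltr => //; exact: measurable_cst.
- exact: measurable_funS mc.
Qed.

Lemma fluid_neg t : t <= 0 -> z t = a.
Proof. by move=> t0; rewrite zE integral_to_le0// addr0. Qed.

(** Emptiness only replaces a negative rate by zero, so that the fluid level
    increases at least as much as the walk. *)
Lemma fluid_diff_ge s t : 0 <= s -> s <= t ->
  walk c f t - walk c f s <= z t - z s.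
Proof.
move=> s0 st; rewrite !zE opprD addrACA subrr add0r.
apply: integral_to_le => //; first exact: bounded_rate_fluid.
by move=> u su ut; rewrite /fluid_rate /=; case: ifP => // /andP[_ /ltW].
Qed.

Lemma fluid_diff_eq s t : 0 <= s -> s <= t ->
  (forall u, s < u -> u <= t -> z u != 0) ->
  z t - z s = walk c f t - walk c f s.
Proof.
move=> s0 st zu; rewrite !zE opprD addrACA subrr add0r.
apply: integral_to_eq => //; first exact: bounded_rate_fluid.
by move=> u su ut; rewrite /fluid_rate /= (negbTE (zu u su ut)).
Qed.

(** The reflection formula.  The bound from below holds from every earlier time
    by [fluid_diff_ge], and it is attained at the last zero before [t], after
    which the fluid level moves like the walk, or at time [0] if there is no
    zero. *)
Lemma fluid_le t u : z t <= u <-> reflected_le c f a t u.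
Proof.
have w0 : walk c f 0 = 0 by rewrite walk_le0.
have za : z 0 = a by rewrite fluid_neg.
have [t0|t0] := ltP t 0.
  rewrite /reflected_le (walk_le0 (ltW t0)) addr0 (fluid_neg (ltW t0)).
  by split=> [au|[]//]; split=> // v v0 /(le_trans v0); rewrite leNgt t0.
split=> [zu|[au vu]].
  split=> [|v v0 vt].
    by have := fluid_diff_ge (lexx 0) t0; rewrite za w0; lra.
  by have := fluid_diff_ge v0 vt; have := z0 v; lra.
have [[v0 [v0_ge0 v0t zv0]]|noz] :=
    pselect (exists v, [/\ 0 <= v, v <= t & z v = 0]); last first.
  have : z t - z 0 = walk c f t - walk c f 0.
    apply: fluid_diff_eq => // v v0 vt; apply/eqP => zv; apply: noz.
    by exists v; split => //; exact: ltW.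
  by rewrite za w0; lra.
pose E := [set v | 0 <= v <= t /\ z v = 0].
have E0 : E !=set0 by exists v0; rewrite /E/= v0_ge0 v0t.
have Eub : has_ubound E by exists t => v [/andP[]].
have cE : closed E.
  rewrite (_ : E = `[0, t] `&` z @^-1` [set 0]).
    apply: closedI; first exact: itv_closed.
    by apply: preimage_closed; [move=> v _; exact: zc|exact: closed_eq].
  by apply/seteqP; split => v /=; rewrite in_itv.
have [/andP[s0 st] zs] := cE _ (closure_sup E0 Eub).
have : z t - z (sup E) = walk c f t - walk c f (sup E).
  apply: fluid_diff_eq => // v sv vt; apply/eqP => zv.
  have : E v by split; rewrite // vt andbT ltW// (le_lt_trans s0).
  by move/(ub_le_sup Eub); rewrite leNgt sv.
by have := vu _ s0 st; lra.
Qed.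

Lemma fluid_gt t u : u < z t <-> ~ reflected_le c f a t u.
Proof.
split=> [uz /fluid_le|]; first by rewrite leNgt uz.
by rewrite ltNge => nr; apply/negP => /fluid_le.
Qed.

(** The level is bounded on [0, t] by continuity, so that the supremum in the
    running maximum is a genuine one. *)
Lemma running_max_gt x t : 0 <= x ->
  (x < running_max z t) <-> (exists v, [/\ 0 <= v, v <= t & x < z v]).
Proof.
move=> x0; rewrite /running_max; have [t0|t0] := ltP t 0.
  rewrite set_itv_ge ?bnd_simp -?ltNge// image_set0 sup0; split.
    by rewrite ltNge x0.
  by move=> [v [v0 /(le_trans v0)]]; rewrite leNgt t0.
have itvE v : v \in `[0, t]%R = (0 <= v <= t) by rewrite in_itv.
have [m mt mz] := EVT_max t0 (continuous_subspaceT zc).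
split=> [/sup_gt[]|[v [v0 vt xz]]].
- by exists (z 0), 0; rewrite //= itvE lexx.
- by move=> w [v /= + <- xz]; rewrite itvE => /andP[v0 vt]; exists v.
apply: lt_le_trans xz _; apply: ub_le_sup.
  by exists (z m) => _ [w /= wt <-]; exact: mz.
by exists v => //=; rewrite itvE v0.
Qed.

(** As long as the walk started at [a] has not become negative, the reflection
    term [X t - X v] stays below [a + X t]. *)
Lemma fluid_eq_level t : 0 <= t ->
  (forall v, 0 <= v -> v <= t -> 0 <= a + walk c f v) -> z t = a + walk c f t.
Proof.
move=> t0 w0; apply/eqP; rewrite eq_le; apply/andP; split.
  by apply/fluid_le; split=> // v v0 vt; have := w0 _ v0 vt; lra.
by have [] := (fluid_le t (z t)).1 (lexx _).
Qed.

(** The reflected walk forgets its past: its value at [s] is a sufficient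
    starting point for the path shifted by [s]. *)
Lemma fluid_restart s t u : 0 <= s -> 0 <= t ->
  z (s + t) <= u <-> reflected_le c (theta s f) (z s) t u.
Proof.
move=> s0 t0; have st : s <= s + t by rewrite lerDl.
have wT v : 0 <= v -> walk c (theta s f) v = walk c f (s + v) - walk c f s.
  by move=> v0; rewrite walk_theta.
split=> [/fluid_le[au vu]|[zu vu]].
  split.
    suff : z s <= u - (walk c f (s + t) - walk c f s) by rewrite wT//; lra.
    apply/fluid_le; split; first lra.
    by move=> v v0 vs; have := vu v v0 (le_trans vs st); lra.
  move=> v v0 vt; rewrite !wT//.
  by have := vu (s + v); rewrite addr_ge0// lerD2l => /(_ isT vt); lra.
rewrite wT// in zu.
have : z s <= u - (walk c f (s + t) - walk c f s) by lra.
move=> /fluid_le[a1 v1]; apply/fluid_le; split; first lra.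
move=> v v0 vst; have [vs|sv] := leP v s; first by have := v1 v v0 vs; lra.
have := vu (v - s); rewrite subr_ge0 (ltW sv) lerBlDl => /(_ isT vst).
by rewrite !wT ?subr_ge0 ?(ltW sv)// (addrC s (v - s)) subrK; lra.
Qed.

End fluid.
End walk.

(** * First passage times *)

Section first_times.
Context {R : realType}.
Implicit Types (D : set R) (s t : R).

Definition first_time D : \bar R := ereal_inf [set t%:E | t in D].

Lemma first_time_ltP D (e : \bar R) :
  (first_time D < e)%E <-> (exists2 t, D t & (t%:E < e)%E).
Proof.
split=> [/ereal_inf_ltP[_ [t Dt <-] te]|[t Dt te]]; first by exists t.
by apply/ereal_inf_ltP; exists t%:E => //; exists t.
Qed.

Lemma first_time_le D t : D t -> (first_time D <= t%:E)%E.
Proof. by move=> Dt; apply: ereal_inf_lbound; exists t. Qed.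

Lemma first_time_ge0 D : (forall t, D t -> 0 < t) -> (0 <= first_time D)%E.
Proof.
move=> D0; rewrite leNgt; apply/negP => /first_time_ltP[t Dt].
by rewrite lte_fin ltNge ltW// D0.
Qed.

Lemma first_time_fin D s : first_time D = s%:E ->
  (forall v, D v -> s <= v) /\ (forall e, s < e -> exists t, [/\ D t, s <= t & t < e]).
Proof.
move=> Ds; have lb v : D v -> s <= v.
  by move=> Dv; rewrite -lee_fin -Ds; exact: first_time_le.
split=> // e se; have /first_time_ltP[t Dt te] : (first_time D < e%:E)%E.
  by rewrite Ds lte_fin.
by exists t; split=> //; exact: lb.
Qed.

Lemma first_time_pinfty D t : first_time D = +oo%E -> ~ D t.
Proof. by move=> Doo /first_time_le; rewrite Doo. Qed.

Lemma ratr_between s t : s < t -> exists q : rat, s < ratr q < t.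
Proof. by move=> /rat_in_itvoo[q]; rewrite in_itv/=; exists q. Qed.

End first_times.

Section exits.
Context {R : realType} {S : finType}.
Implicit Types (c : S -> R) (f : R -> S) (s t u v a x y : R).

Lemma walkN c f t : right_continuous_path f ->
  walk (fun i => - c i) f t = - walk c f t.
Proof.
move=> frc; have i1 := bounded_rate_integrable t (bounded_rate_path c frc).
rewrite /walk /integral_to -[RHS]mulN1r -RintegralZl//.
by apply: eq_Rintegral => s _ /=; rewrite mulN1r.
Qed.

(** Changing the sign of all rates exchanges up- and downcrossings, which
    transfers each statement on [tau_up] to [tau_down]. *)
Lemma tau_downN c f a x : right_continuous_path f ->
  tau_down c f a x = tau_up (fun i => - c i) f (- a) (- x).
Proof.
move=> frc; congr (ereal_inf (_ @` _)); apply/seteqP.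
by split=> t /=; rewrite !levelE walkN// -opprD ltrN2.
Qed.

Lemma S_plusN c : S_plus (fun i => - c i) = S_minus c.
Proof. by apply/setP => i; rewrite !inE oppr_gt0. Qed.

Lemma tau_up_translate c f a x b :
  tau_up c f (a + b) (x + b) = tau_up c f a x.
Proof.
congr (ereal_inf (_ @` _)); apply/seteqP.
by split=> t /=; rewrite !levelE addrAC ltrD2r.
Qed.

Lemma tau_down_translate c f a x b :
  tau_down c f (a + b) (x + b) = tau_down c f a x.
Proof.
congr (ereal_inf (_ @` _)); apply/seteqP.
by split=> t /=; rewrite !levelE addrAC ltrD2r.
Qed.

Lemma tau_up_ge0 c f a x : (0 <= tau_up c f a x)%E.
Proof. by apply: first_time_ge0 => t []. Qed.

Lemma tau_down_ge0 c f a x : (0 <= tau_down c f a x)%E.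
Proof. by apply: first_time_ge0 => t []. Qed.

Lemma beta_ge0 c f : (0 <= beta c f)%E.
Proof. by apply: first_time_ge0 => t []. Qed.

Lemma tau_up_pinfty c f a x t : a <= x -> tau_up c f a x = +oo%E ->
  0 <= t -> a + walk c f t <= x.
Proof.
move=> ax xoo; rewrite le_eqVlt => /predU1P[<-|t0].
  by rewrite walk_le0// addr0.
by rewrite leNgt; apply/negP => xt; exact: (first_time_pinfty (t := t) xoo).
Qed.

Lemma walk_gt_near c f a m s : right_continuous_path f ->
  m < a + walk c f s ->
  exists2 r, 0 < r & forall t, `|t - s| < r -> m < a + walk c f t.
Proof.
rewrite -subr_gt0 => frc ms; have [r r0 rw] := walk_near c frc s ms.
by exists r => // t /rw; rewrite ltr_norml => /andP[+ _]; lra.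
Qed.

Lemma walk_lt_near c f a m s : right_continuous_path f ->
  a + walk c f s < m ->
  exists2 r, 0 < r & forall t, `|t - s| < r -> a + walk c f t < m.
Proof.
rewrite -subr_gt0 => frc ms; have [r r0 rw] := walk_near c frc s ms.
by exists r => // t /rw; rewrite ltr_norml => /andP[_]; lra.
Qed.

(** When the walk first passes above [x] it sits at [x] by continuity, and in a
    phase of positive rate: with a negative rate it would stay below [x] for a
    while. *)
Lemma tau_up_fin c f a x s : right_continuous_path f -> (forall i, c i != 0) ->
  a <= x -> tau_up c f a x = s%:E ->
  [/\ 0 <= s, a + walk c f s = x, f s \in S_plus c,
      (forall v, 0 <= v -> v <= s -> a + walk c f v <= x) &
      (forall e, s < e -> exists t, [/\ s < t, t < e & x < a + walk c f t])].
Proof.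
move=> frc c0 ax xs.
have s0 : 0 <= s by rewrite -lee_fin -xs tau_up_ge0.
have w0 : walk c f 0 = 0 by rewrite walk_le0.
have [lb close] := first_time_fin xs.
have below v : 0 <= v -> v < s -> a + walk c f v <= x.
  rewrite le_eqVlt => /predU1P[<-|v0]; first by rewrite w0 addr0.
  move=> vs; rewrite leNgt; apply/negP => xv.
  by have := lb v (conj v0 xv); rewrite leNgt vs.
have ats : a + walk c f s <= x.
  rewrite leNgt; apply/negP => xs'.
  have [r r0 rw] := walk_gt_near frc xs'.
  have [ss0|s_gt0] := eqVneq s 0.
    by move: xs'; rewrite ss0 w0 addr0 ltNge ax.
  have {}s_gt0 : 0 < s by rewrite lt_neqAle eq_sym s_gt0.
  (* a positive time before s at which the walk would still be above x *)
pose v := Num.max (s / 2) (s - r / 2).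
  have vs : v < s by rewrite gt_max; apply/andP; split; lra.
  have v0 : 0 <= v by rewrite le_max; apply/orP; left; lra.
  have : `|v - s| < r.
    rewrite ltr0_norm ?subr_lt0// opprB ltrBlDl -ltrBlDr.
    by rewrite lt_max; apply/orP; right; lra.
  by move/rw; rewrite ltNge below.
have close' e : s < e -> exists t, [/\ s < t, t < e & x < a + walk c f t].
  move=> /close[t [[t0 xt] st te]]; exists t; split => //.
  rewrite lt_neqAle st andbT; apply/eqP => ts.
  by move: xt; rewrite levelE -ts ltNge ats.
have ge v : 0 <= v -> v <= s -> a + walk c f v <= x.
  by rewrite [v <= s]le_eqVlt => v0 /predU1P[->//|]; exact: below.
have eqx : a + walk c f s = x.
  apply/eqP; rewrite eq_le ats leNgt; apply/negP => sx.
  have [r r0 rw] := walk_lt_near frc sx.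
  have [t [st te xt]] := close' (s + r) (ltac:(lra)).
  have : `|t - s| < r by rewrite gtr0_norm; lra.
  by move/rw; rewrite ltNge ltW.
split => //.
rewrite inE; have [r r0 rw] := walk_right_linear c frc s0.
have [t [st te xt]] := close' (s + r) (ltac:(lra)).
have := rw t (ltW st) te; have := c0 (f s); rewrite neq_lt => /orP[cn|//].
have : c (f s) * (t - s) < 0 by rewrite nmulr_rlt0// subr_gt0.
lra.
Qed.

Lemma tau_down_fin c f a x s : right_continuous_path f -> (forall i, c i != 0) ->
  x <= a -> tau_down c f a x = s%:E ->
  [/\ 0 <= s, a + walk c f s = x, f s \in S_minus c &
      (forall v, 0 <= v -> v <= s -> x <= a + walk c f v)].
Proof.
move=> frc c0 xa; rewrite tau_downN// => h.
have c0' i : - c i != 0 by rewrite oppr_eq0.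
have xa' : - a <= - x by rewrite lerN2.
have [s0 + + + _] := tau_up_fin frc c0' xa' h.
rewrite walkN// S_plusN -opprD => /oppr_inj ? ? le; split => // v v0 vs.
by have := le v v0 vs; rewrite walkN// -opprD lerN2.
Qed.

Lemma tau_down_pinfty c f a x t : right_continuous_path f ->
  x <= a -> tau_down c f a x = +oo%E -> 0 <= t -> x <= a + walk c f t.
Proof.
move=> frc xa; rewrite tau_downN// => h t0.
have xa' : - a <= - x by rewrite lerN2.
by have := tau_up_pinfty xa' h t0; rewrite walkN// -opprD lerN2.
Qed.

(** The rate has the sign of the crossing, and cannot have both signs. *)
Lemma tau_up_down_neq c f a x y s : right_continuous_path f ->
  (forall i, c i != 0) -> a <= x -> y <= a ->
  tau_up c f a x = s%:E -> tau_down c f a y <> s%:E.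
Proof.
move=> frc c0 ax ya /(tau_up_fin frc c0 ax)[_ _ + _ _].
move=> + /(tau_down_fin frc c0 ya)[_ _ + _]; rewrite !inE => cp cn.
by have := lt_trans cp cn; rewrite ltxx.
Qed.

(** A path starting in a phase of positive rate first increases. *)
Lemma tau_down_gt0 c f : right_continuous_path f -> f 0 \in S_plus c ->
  (0 < tau_down c f 0 0)%E.
Proof.
rewrite inE => frc f0; have [r r0 rw] := walk_right_linear c frc (lexx 0).
apply: (@lt_le_trans _ _ r%:E); first by rewrite lte_fin.
rewrite leNgt; apply/negP => /first_time_ltP[t [t0]].
rewrite levelE add0r lte_fin => wt tr.
have := rw t (ltW t0); rewrite add0r tr subr0 => /(_ isT).
rewrite (@walk_le0 _ _ c f 0)// subr0 => wE.
by move: wt; rewrite wE ltNge mulr_ge0// ltW.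
Qed.

(** Being above [x] or below [y] is an open condition on the time, so that
    rational times detect an exit of the band [y, x] through the top; this makes
    the exit time an optional time. *)
Lemma exit_up_rat c f a x y t : right_continuous_path f ->
  (tau_up c f a x < tau_down c f a y)%E /\ (tau_up c f a x < t%:E)%E <->
  exists q : rat, [/\ 0 < (ratr q : R) < t, x < a + walk c f (ratr q) &
    forall r : rat, 0 < (ratr r : R) <= ratr q -> y <= a + walk c f (ratr r)].
Proof.
move=> frc; split=> [[ud ut]|[q [/andP[q0 qt] xq yr]]].
  have /first_time_ltP[t1 [t10]] :
      (tau_up c f a x < Order.min (tau_down c f a y) t%:E)%E.
    by rewrite lt_min ud ut.
  rewrite levelE lt_min lte_fin => xt1 /andP[t1d t1t].
  have [r r0 rw] := walk_gt_near frc xt1.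
  have [q /andP[qm qt1]] : exists q : rat, Num.max 0 (t1 - r) < ratr q < t1.
    by apply: ratr_between; rewrite gt_max t10/=; lra.
  move: qm; rewrite gt_max => /andP[q0 qr].
  exists q; split; first by rewrite q0 (lt_trans qt1).
    by apply: rw; rewrite ltr0_norm; lra.
  move=> r' /andP[r'0 r'q]; rewrite leNgt; apply/negP => yr'.
  have : (tau_down c f a y <= (ratr r')%:E)%E by exact: first_time_le.
  apply/negP; rewrite -ltNge (lt_trans _ t1d)// lte_fin.
  exact: le_lt_trans qt1.
have [r r0 rw] := walk_gt_near frc xq.
have [q' /andP[qm qt1]] : exists q' : rat, Num.max 0 (ratr q - r) < ratr q' < (ratr q : R).
  by apply: ratr_between; rewrite gt_max q0/=; lra.
move: qm; rewrite gt_max => /andP[q'0 q'r].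
have uq' : (tau_up c f a x <= (ratr q')%:E)%E.
  apply: first_time_le; split => //; rewrite levelE.
  by apply: rw; rewrite ltr0_norm; lra.
have uq : (tau_up c f a x < (ratr q)%:E)%E.
  by apply: le_lt_trans uq' _; rewrite lte_fin.
split; last by rewrite (lt_trans uq)// lte_fin.
apply: lt_le_trans uq _; rewrite leNgt; apply/negP => /first_time_ltP[t1 [t10]].
rewrite levelE lte_fin => yt1 t1q.
have [r2 r20 rw2] := walk_lt_near frc yt1.
have [q2 /andP[qm2 qt2]] : exists q' : rat, Num.max 0 (t1 - r2) < ratr q' < t1.
  by apply: ratr_between; rewrite gt_max t10/=; lra.
move: qm2; rewrite gt_max => /andP[q20 q2r].
have := yr q2; rewrite q20 (ltW (lt_trans qt2 t1q)) => /(_ isT).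
apply/negP; rewrite -ltNge; apply: rw2.
by rewrite ltr0_norm; lra.
Qed.

Lemma exit_down_rat c f a x y t : right_continuous_path f ->
  (tau_down c f a y < tau_up c f a x)%E /\ (tau_down c f a y < t%:E)%E <->
  exists q : rat, [/\ 0 < (ratr q : R) < t, a + walk c f (ratr q) < y &
    forall r : rat, 0 < (ratr r : R) <= ratr q -> a + walk c f (ratr r) <= x].
Proof.
move=> frc; have := exit_up_rat (fun i => - c i) (- a) (- y) (- x) t frc.
have E : tau_down (fun i => - c i) f (- a) (- x) = tau_up c f a x.
  rewrite tau_downN// !opprK; congr (tau_up _ f a x).
  by apply/funext => i; exact: opprK.
rewrite -tau_downN// E => ->; split=> -[q [qt yq xr]]; exists q; split => //.
- by move: yq; rewrite walkN// -opprD ltrN2.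
- by move=> r /xr; rewrite walkN// -opprD lerN2.
- by rewrite walkN// -opprD ltrN2.
- by move=> r /xr; rewrite walkN// -opprD lerN2.
Qed.

(** Phases are constant on right neighbourhoods, hence seen at rationals. *)
Lemma beta_rat c f t : right_continuous_path f ->
  (beta c f < t%:E)%E <->
  exists q : rat, 0 < (ratr q : R) < t /\ f (ratr q) \in S_plus c.
Proof.
move=> frc; split=> [/first_time_ltP[s [s0 fs]]|[q [/andP[q0 qt] fq]]].
  rewrite lte_fin => st; have [r /= r0 rf] := frc s (ltW s0).
  have [q /andP[sq]] : exists q : rat, s < ratr q < Num.min t (s + r).
    by apply: ratr_between; rewrite lt_min st ltrDl.
  rewrite lt_min => /andP[qt qr]; exists q; split.
    by rewrite (lt_trans s0).
  by rewrite rf// /= ltr0_norm; lra.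
by apply/first_time_ltP; exists (ratr q) => //; rewrite lte_fin.
Qed.

Lemma beta_fin c f s : right_continuous_path f -> (forall i, c i != 0) ->
  beta c f = s%:E ->
  [/\ 0 <= s, f s \in S_plus c &
      forall v, 0 < v -> v < s -> f v \in S_minus c].
Proof.
move=> frc c0 bs; have s0 : 0 <= s by rewrite -lee_fin -bs beta_ge0.
have [lb close] := first_time_fin bs; split => //.
  have [r /= r0 rf] := frc s s0.
  have [t [[t0 ft] st te]] := close (s + r) (ltac:(lra)).
  have [<-//|ts] := eqVneq t s; rewrite -(rf t)//=; last first.
    by rewrite lt_neqAle eq_sym ts.
  by rewrite ler0_norm; lra.
move=> v v0 vs; rewrite inE; have := c0 (f v); rewrite neq_lt => /orP[//|cp].
have : s <= v by apply: lb; split; rewrite // inE.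
by rewrite leNgt vs.
Qed.

Lemma beta_pinfty c f v : (forall i, c i != 0) -> beta c f = +oo%E ->
  0 < v -> f v \in S_minus c.
Proof.
move=> c0 boo v0; rewrite inE; have := c0 (f v); rewrite neq_lt => /orP[//|cp].
by exfalso; apply: (first_time_pinfty (t := v) boo); split; rewrite // inE.
Qed.

End exits.

(** * Measurability of path functionals *)

Section walk_measurable.
Context {R : realType} {S : finType} {d} {T : measurableType d}.
Variables (c : S -> R) (f : T -> R -> S) (t : R).
Hypothesis frc : forall w, right_continuous_path (f w).
Hypothesis mf : forall (u : R) j, 0 <= u -> u <= t ->
  measurable [set w | f w u = j].

(** Tonelli's theorem; the rates are shifted by [K] to be nonnegative. *)
Lemma measurable_walk : measurable_fun setT (fun w => walk c (f w) t).
Proof.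
have [t0|t0] := ltP t 0.
  under eq_fun do rewrite (walk_le0 _ _ (ltW t0)).
  exact: measurable_cst.
pose K := max_rate c.
pose B j := [set p : T * R | 0 <= p.2 <= t /\ f p.1 p.2 = j].
have mB j : measurable (B j) by exact: path_jointly_measurable.
pose g (p : T * R) : R := \sum_j (K + c j) * \1_(B j) p.
have g0 p : 0 <= g p.
  apply: sumr_ge0 => j _; rewrite mulr_ge0//.
  by have := max_rateP c j; rewrite ler_norml => /andP[+ _]; rewrite -/K; lra.
have gE w s : (g (w, s))%:E = ((EFin \o (fun s => K + c (f w s))) \_ `[0, t]) s.
  rewrite /patch mem_setE in_itv/=; case: ifPn => st.
    rewrite /g (bigD1 (f w s))//= big1 ?addr0 ?indicE.
      by rewrite mem_set ?mulr1.
    move=> j jf; rewrite indicE memNset ?mulr0// => -[_ /= fj].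
    by rewrite fj eqxx in jf.
  rewrite /g big1// => j _; rewrite indicE memNset ?mulr0// => -[/=].
  by rewrite (negbTE st).
have E w : walk c (f w) t =
    fine (\int[lebesgue_measure]_s (g (w, s))%:E)%E - K * t.
  under eq_integral do rewrite gE.
  rewrite -integral_mkcond -(integral_to_cst K t0).
  have i1 := bounded_rate_integrable t (bounded_rate_path c (frc w)).
  have i2 := bounded_rate_integrable t (bounded_rate_cst K).
  have H : integral_to (fun s => cst K s + (c \o f w) s) t =
      integral_to (cst K) t + walk c (f w) t by exact: RintegralD.
  by rewrite -[fine _]/(integral_to (fun s => cst K s + (c \o f w) s) t) H addrAC subrr add0r.
rewrite (_ : (fun w => _) = (fun w => fine (\int[lebesgue_measure]_s (g (w, s))%:E)%E - K * t)); last first.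
  by apply/funext => w; rewrite E.
apply: measurable_funB => //.
apply: (@measurableT_comp _ _ _ _ _ _ fine); first exact: fine_measurable.
have := @measurable_fun_fubini_tonelli_F _ _ T _ R lebesgue_measure (fun p => (g p)%:E).
apply.
  apply/measurable_EFinP; rewrite /g.
  apply: measurable_sum => j; apply: measurable_funM.
    exact: measurable_cst.
  by apply: measurable_indic; exact: mB.
by move=> p; rewrite lee_fin.
Qed.

End walk_measurable.

Section rational_scaling.
Context {R : realType} {S : finType}.
Variables (c : S -> R) (f : R -> S).
Hypothesis frc : right_continuous_path f.
Implicit Types (t v u b x : R).

(** Rational fractions of [t] are used in place of rational times so that the
    time [t] itself may be random. *)
Lemma rat_scale t v (Q : R -> Prop) : 0 <= v -> v <= t ->
  (exists2 r, 0 < r & forall s, `|s - v| < r -> Q s) ->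
  exists q : rat, 0 <= (ratr q : R) <= 1 /\ Q (ratr q * t).
Proof.
move=> v0 vt [r r0 rQ]; have [t0|t_gt0] := leP t 0.
  exists 0; rewrite rmorph0 lexx ler01 mul0r; split => //.
  by apply: rQ; rewrite (_ : 0 - v = 0) ?normr0//; lra.
have vt1 : v / t <= 1 by rewrite ler_pdivrMr// mul1r.
have vt0 : 0 <= v / t by rewrite divr_ge0// ltW.
have rt : 0 < r / t by rewrite divr_gt0.
have [q /andP[]] : exists q : rat,
    Num.max 0 (v / t - r / t) < (ratr q : R) < Num.min 1 (v / t + r / t).
  by apply: ratr_between; rewrite gt_max !lt_min; apply/andP; split; apply/andP; split; lra.
rewrite gt_max lt_min => /andP[q0 qr] /andP[q1 qr'].
exists q; split; first by rewrite !ltW.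
apply: rQ; rewrite (_ : _ - _ = (ratr q - v / t) * t); last first.
  by rewrite mulrBl divfK// gt_eqF.
rewrite normrM (gtr0_norm t_gt0) -ltr_pdivlMr// ltr_norml; lra.
Qed.

(** The walk is continuous, so that the supremum over [v] in [0, t] is one over
    rational fractions of [t]. *)
Lemma reflected_le_rat b t u : 0 <= u ->
  reflected_le c f b t u <-> b + walk c f t <= u /\
    forall q : rat, 0 <= (ratr q : R) <= 1 ->
      walk c f t - walk c f (ratr q * t) <= u.
Proof.
move=> u0; split=> -[bt tu]; split=> //.
  move=> q /andP[q0 q1]; have [t0|t0] := leP 0 t.
    apply: tu; first by rewrite mulr_ge0.
    by rewrite ler_piMl.
  by rewrite !walk_le0 ?subrr// ?mulr_ge0_le0// ltW.
move=> v v0 vt; rewrite leNgt; apply/negP; rewrite ltrBrDr -ltrBrDl => vu.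
have vu' : 0 + walk c f v < walk c f t - u by rewrite add0r.
have [q [q01]] := rat_scale v0 vt (walk_lt_near frc vu').
by have := tu q q01; lra.
Qed.

(** For [0 <= x] exceeding [x] is an open condition on the time: if it holds at
    [v] because of [x < X v - X s], then [s < v] and it still holds near [v]. *)
Lemma exceeds_rat b t x : 0 <= x ->
  (exists v, [/\ 0 <= v, v <= t & ~ reflected_le c f b v x]) <->
  0 <= t /\ exists2 q : rat, 0 <= (ratr q : R) <= 1 &
    ~ reflected_le c f b (ratr q * t) x.
Proof.
move=> x0; split=> [[v [v0 vt /not_andP nr]]|[t0 [q /andP[q0 q1] nr]]]; last first.
  by exists (ratr q * t); split => //; [exact: mulr_ge0|exact: ler_piMl].
split; first exact: le_trans vt.
suff [r r0 rQ] : exists2 r, 0 < r & forall s, `|s - v| < r -> ~ reflected_le c f b s x.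
  have [q [q01 nq]] := rat_scale v0 vt (ex_intro2 _ _ r r0 rQ).
  by exists q.
case: nr => [/negP|/existsNP[s /not_implyP[s0 /not_implyP[sv /negP]]]]; rewrite -ltNge.
  move=> /(walk_gt_near frc)[r r0 rw]; exists r => // s /rw xs [+ _].
  by rewrite leNgt xs.
move=> xs; have sv' : s < v.
  by rewrite lt_neqAle sv andbT; apply/eqP => svE; move: xs; rewrite svE subrr ltNge x0.
have xs' : x < - walk c f s + walk c f v by rewrite addrC.
have [r r0 rw] := walk_gt_near frc xs'.
exists (Num.min r (v - s)); first by rewrite lt_min r0 subr_gt0.
move=> u; rewrite lt_min => /andP[/rw xu uvs] [_ /(_ s s0)].
have -> : s <= u by move: uvs; rewrite ltr_norml => /andP[+ _]; lra.
by move=> /(_ isT); rewrite leNgt addrC xu.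
Qed.

End rational_scaling.

Section system_measurable.
Context {R : realType} {d} {T : measurableType d}.

Lemma measurable_fun_gtP (F : T -> R) :
  (forall x, measurable [set w | x < F w]) -> measurable_fun setT F.
Proof.
move=> mF; apply: (measurability _ (RGenOInfty.measurableE R)) => //.
move=> /= _ [_ [x ->] <-]; rewrite setTI.
by rewrite (_ : _ @^-1` _ = [set w | x < F w])//; apply/seteqP; split => w /=;
  rewrite in_itv/= andbT.
Qed.

(** Evaluation at a random time: a Lipschitz function exceeds [x] at [C w] as
    soon as it exceeds [x] by a margin at a rational time close to [C w]. *)
Lemma measurable_lipschitz_at (K : R) (F : T -> R -> R) (C : T -> R) :
  0 <= K -> (forall s, measurable_fun setT (F ^~ s)) ->
  (forall w s t, `|F w t - F w s| <= K * `|t - s|) ->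
  measurable_fun setT C -> measurable_fun setT (fun w => F w (C w)).
Proof.
move=> K0 mF FK mC; apply: measurable_fun_gtP => x.
rewrite (_ : [set w | _] = \bigcup_n \bigcup_(q : rat)
  ([set w | `|C w - ratr q| < n.+1%:R^-1] `&`
   [set w | x + K / n.+1%:R < F w (ratr q)])).
  apply: bigcupT_measurable => n; apply: bigcupT_measurable_rat => q.
  apply: measurableI; rewrite -[X in measurable X]setTI.
    apply: (measurable_fun_ltr (f := fun w => `|C w - ratr q|) (g := cst n.+1%:R^-1)) => //.
    by apply: measurableT_comp => //; exact: measurable_funB.
  exact: (measurable_fun_ltr (f := cst _) (g := F ^~ (ratr q))).
apply/seteqP; split=> w /=.
  move=> xF; have g0 : 0 < (F w (C w) - x) / (K + K + 1).
    by rewrite divr_gt0 ?subr_gt0// ltr_wpDl// addr_ge0.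
  have [n _ /(_ n (leqnn n)) /= nK] := near_infty_natSinv_lt (PosNum g0).
  have e0 : 0 < n.+1%:R^-1 :> R by rewrite invr_gt0.
  have [q] : exists q : rat, C w - n.+1%:R^-1 < ratr q < C w.
    by apply: ratr_between; rewrite ltrBlDr ltrDl.
  move=> Cq; exists n => //; exists q => //=.
  move: nK e0 Cq; move: (n.+1%:R^-1) => e nK e0 /andP[qC Cq].
  have qn : `|C w - ratr q| < e by rewrite gtr0_norm; lra.
  split => //; have := FK w (ratr q) (C w); rewrite ler_norml => /andP[_].
  have : K * `|C w - ratr q| <= K * e by rewrite ler_wpM2l// ltW.
  have K1 : 0 < K + K + 1 by rewrite ltr_wpDl// addr_ge0.
  by move: nK; rewrite ltr_pdivlMr//; lra.
move=> [n _ [q _ [Cq xq]]].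
have := FK w (ratr q) (C w); rewrite ler_norml => /andP[+ _].
have : K * `|C w - ratr q| <= K / n.+1%:R by rewrite ler_wpM2l// ltW.
by move: xq => /=; set e := K / _; lra.
Qed.

Lemma measurable_clock (ys : T -> nat -> R) k :
  (forall m, measurable_fun setT (ys ^~ m)) ->
  measurable_fun setT (fun w => clock (ys w) k).
Proof. by move=> mys; apply: measurable_sum => m; exact: mys. Qed.

Context {S : finType}.
Variables (c : S -> R) (f : T -> R -> S).
Hypothesis frc : forall w, right_continuous_path (f w).
Hypothesis mf : forall (u : R) j, 0 <= u -> measurable [set w | f w u = j].

Lemma measurable_walk_at (C : T -> R) : measurable_fun setT C ->
  measurable_fun setT (fun w => walk c (f w) (C w)).
Proof.
move=> mC; apply: (measurable_lipschitz_at (F := fun w => walk c (f w))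
  (max_rate_ge0 c)) => // [s|w s t].
  by apply: measurable_walk => // u j u0 _; exact: mf.
exact: walk_lipschitz.
Qed.

Lemma measurable_reflected_le (b : R) (C : T -> R) (u : R) : 0 <= u -> measurable_fun setT C ->
  measurable [set w | reflected_le c (f w) b (C w) u].
Proof.
move=> u0 mC; have mle (F : T -> R) :
    measurable_fun setT F -> measurable [set w | F w <= u].
  move=> mF; rewrite -[X in measurable X]setTI.
  exact: (measurable_fun_ler (f := F) (g := cst u)).
rewrite (_ : [set w | _] = [set w | b + walk c (f w) (C w) <= u] `&`
   ~` \bigcup_(q : rat) (if 0 <= (ratr q : R) <= 1 then
      ~` [set w | walk c (f w) (C w) - walk c (f w) (ratr q * C w) <= u] else set0)).
  apply: measurableI.
    by apply: mle; apply: measurable_funD => //; exact: measurable_walk_at.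
  apply: measurableC; apply: bigcupT_measurable_rat => q; case: ifP => // _.
  apply: measurableC; apply: mle; apply: measurable_funB.
    exact: measurable_walk_at.
  by apply: measurable_walk_at; exact: measurable_funM.
apply/seteqP; split=> w /=.
  move=> /(reflected_le_rat c (frc w) b (C w) u0)[? h]; split => //.
  by move=> [q _]; case: ifP => // /h /= ?.
move=> [? h]; apply/(reflected_le_rat c (frc w) b (C w) u0); split => // q q01.
by apply: contrapT => nq; apply: h; exists q => //; rewrite q01.
Qed.

Lemma measurable_exceeds (b : R) (C : T -> R) (x : R) : 0 <= x -> measurable_fun setT C ->
  measurable [set w | exists v, [/\ 0 <= v, v <= C w & ~ reflected_le c (f w) b v x]].
Proof.
move=> x0 mC.
rewrite (_ : [set w | _] = [set w | 0 <= C w] `&`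
   \bigcup_(q : rat) (if 0 <= (ratr q : R) <= 1 then
      ~` [set w | reflected_le c (f w) b (ratr q * C w) x] else set0)).
  apply: measurableI.
    rewrite -[X in measurable X]setTI.
    exact: (measurable_fun_ler (f := cst 0) (g := C)).
  apply: bigcupT_measurable_rat => q; case: ifP => // _; apply: measurableC.
  by apply: measurable_reflected_le => //; exact: measurable_funM.
apply/seteqP; split=> w /=.
  move=> /(exceeds_rat c (frc w) b (C w) x0)[? [q q01 nq]]; split => //.
  by exists q => //; rewrite q01.
move=> [C0 [q _]]; case: ifP => // q01 nq.
by apply/(exceeds_rat c (frc w) b (C w) x0); split => //; exists q.
Qed.

End system_measurable.

(** * Product formulas from generators *)

Section dynkin_product.
Context {R : realType} {d d'} {Omega : measurableType d} {T : measurableType d'}.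
Variables (P1 P2 : probability Omega R) (A : set Omega) (V W : Omega -> T).
Variable G : set (set T).

(** The law of [V] on [A] is [P1 A] times the law of [W] under [P2]: with
    [P1 = P2] and [V = W] this is independence from [A], with [W] the initial
    and [V] the restarted process it is the strong Markov property. *)
Definition factorizes (E : set T) : Prop :=
  [/\ measurable (A `&` V @^-1` E), measurable (W @^-1` E) &
      P1 (A `&` V @^-1` E) = (P1 A * P2 (W @^-1` E))%E].

(** The sets that factorize form a Dynkin system. *)
Lemma dynkin_product : measurable A -> @measurable _ T = <<s G >> ->
  setI_closed G -> (forall E, G E -> factorizes E) ->
  forall E, measurable E -> factorizes E.
Proof.
move=> mA mT GI GF E; rewrite mT.
apply: (dynkin_induction (P := factorizes) mT GI) => //.
- split; rewrite ?preimage_setT ?setIT//.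
  by rewrite probability_setT mule1.
- move=> B mB [mAB mWB AB].
  have E1 : A `&` ~` (V @^-1` B) = A `\` (A `&` V @^-1` B).
    by rewrite setDE setCI setIUr setICr set0U.
  have fA : P1 A \is a fin_num by exact: fin_num_measure.
  have fB : P2 (W @^-1` B) \is a fin_num by exact: fin_num_measure.
  split; first by rewrite preimage_setC E1; apply: measurableD.
    by rewrite preimage_setC; apply: measurableC.
  rewrite preimage_setC E1 preimage_setC measureD//; last by rewrite -ge0_fin_numE.
  rewrite [X in (_ - X)%E](_ : _ = P1 A * P2 (W @^-1` B))%E; last first.
    by rewrite setIA setIid; exact: AB.
  rewrite probability_setC// muleBr ?mule1//.
- move=> F mF tF FP; rewrite /factorizes !preimage_bigcup setI_bigcupr.
  have m1 k : measurable (A `&` V @^-1` F k) by have [] := FP k.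
  have m2 k : measurable (W @^-1` F k) by have [] := FP k.
  split; [exact: bigcupT_measurable|exact: bigcupT_measurable|].
  rewrite measure_semi_bigcup//; last 2 first.
  + move=> k l _ _ [w [[_ Fk] [_ Fl]]]; apply: tF => //.
    by exists (V w).
  + exact: bigcupT_measurable.
  rewrite measure_semi_bigcup//; last 2 first.
  + move=> k l _ _ [w [Fk Fl]]; apply: tF => //.
    by exists (W w).
  + exact: bigcupT_measurable.
  have fA : P1 A \is a fin_num by exact: fin_num_measure.
  rewrite -(fineK fA) -nneseriesZl//; apply: eq_eseriesr => k _.
  by rewrite fineK//; have [_ _] := FP k.
Qed.

End dynkin_product.

(** * The space of right-continuous paths with a clock *)

Section path_space.
Context {R : realType} {S : finType}.

(** Restricting to right-continuous paths makes the path functionals above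
    measurable for the sigma-algebra of cylinders.  The argument [i0] provides
    a base point. *)
Definition path_clock (i0 : S) : Type :=
  {p : (R -> S) * (nat -> R) | right_continuous_path p.1}.

Variable i0 : S.

HB.instance Definition _ := gen_eqMixin (path_clock i0).
HB.instance Definition _ := gen_choiceMixin (path_clock i0).

Fact right_continuous_path_cst : right_continuous_path (fun _ : R => i0).
Proof. by move=> t t0; exact: nearW. Qed.

HB.instance Definition _ := isPointed.Build (path_clock i0)
  (exist _ (fun=> i0, fun=> 0) right_continuous_path_cst).

(** The constraints on the clock are strict lower bounds, since the tail of an
    exponential variable is what the lack of memory is about. *)
Definition cylinder (l : seq (R * S)) (r : nat) (b : nat -> R)
    (p : (R -> S) * (nat -> R)) : Prop :=
  (forall q, q \in l -> p.1 q.1 = q.2) /\ (forall m, (m < r)%N -> b m < p.2 m).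

Definition cylinders : set (set (path_clock i0)) :=
  [set E | exists l r b, (forall q, q \in l -> 0 <= q.1) /\
                         E = [set p | cylinder l r b (sval p)]].

Lemma cylinders_setI : setI_closed cylinders.
Proof.
move=> _ _ [l1 [r1 [b1 [l10 ->]]]] [l2 [r2 [b2 [l20 ->]]]].
exists (l1 ++ l2), (maxn r1 r2), (fun m => if (m < r1)%N then
  if (m < r2)%N then Num.max (b1 m) (b2 m) else b1 m else b2 m).
split=> [q|]; first by rewrite mem_cat => /orP[/l10|/l20].
apply/seteqP; split=> p.
  move=> [[pl1 pb1] [pl2 pb2]]; split=> [q|m mr].
    by rewrite mem_cat => /orP[/pl1|/pl2].
  case: ifPn => [mr1|/negbTE mr1].
    by case: ifPn => [mr2|_]; rewrite ?gt_max ?pb1 ?pb2.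
  by apply: pb2; move: mr; rewrite leq_max mr1.
move=> [pl pb]; split; split=> [q ql|m mr].
- by apply: pl; rewrite mem_cat ql.
- have := pb m; rewrite leq_max mr => /(_ isT).
  by case: ifP => // _; rewrite gt_max => /andP[].
- by apply: pl; rewrite mem_cat ql orbT.
- have := pb m; rewrite leq_max mr orbT => /(_ isT).
  by case: ifP => // _; rewrite gt_max => /andP[].
Qed.

Definition path_clockT := g_sigma_algebraType cylinders.

Lemma measurable_path_eval (u : R) j : 0 <= u ->
  measurable [set p : path_clockT | (sval p).1 u = j].
Proof.
move=> u0; apply: sub_sigma_algebra; exists [:: (u, j)], 0%N, (fun=> 0); split.
  by move=> q; rewrite inE => /eqP ->.
apply/seteqP; split=> p /=; first by move=> pu; split=> // q; rewrite inE => /eqP ->.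
by move=> [/(_ (u, j)) + _]; apply; rewrite inE.
Qed.

(** A cylinder bounds an initial segment of the clock: the bounds [- N] on the
    stages before [m] become vacuous as [N] grows. *)
Lemma measurable_path_clock m :
  measurable_fun setT (fun p : path_clockT => (sval p).2 m).
Proof.
apply: measurable_fun_gtP => x.
rewrite (_ : [set w | _] = \bigcup_N [set p : path_clockT |
   cylinder [::] m.+1 (fun k => if k == m then x else - N%:R) (sval p)]).
  apply: bigcupT_measurable => N; apply: sub_sigma_algebra.
  by eexists _, _, _; split; last reflexivity.
apply/seteqP; split=> p /=; last first.
  by move=> [N _ [_ /(_ m (ltnSn _))]]; rewrite eqxx.
move=> xm; pose M := \sum_(k < m) `|(sval p).2 k|.
exists (Num.bound M) => //; split=> // k; rewrite ltnS leq_eqVlt; case: eqP => [->//|_ /= km].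
have M0 : 0 <= M by exact: sumr_ge0.
have : `|(sval p).2 k| <= M.
  by rewrite /M (bigD1 (Ordinal km))//= lerDl sumr_ge0.
have := archi_boundP M0 => MN kM; rewrite ltrNl; apply: le_lt_trans MN.
by apply: le_trans kM; rewrite -normrN ler_norm.
Qed.

End path_space.

(** * The exponential clock *)

Section exponential_tail.
Context {R : realType}.
Variables (nu : R).

Lemma exponential_prob_le0 : exponential_prob nu `]-oo, 0] = 0%E.
Proof.
rewrite /exponential_prob -integral_itv_bndo_bndc; last first.
  by apply/measurable_EFinP/measurable_funTS; exact: measurable_exponential_pdf.
apply: integral0_eq => x /=; rewrite in_itv/= => x0.
by rewrite lt0_exponential_pdf.
Qed.

Context {d} {Omega : measurableType d} (P : probability Omega R)
  (V : {mfun Omega >-> R}).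
Hypothesis PV : forall B, measurable B -> P (V @^-1` B) = exponential_prob nu B.

(** The maximum extends the formula to negative [b], where the tail is [1]. *)
Lemma exponential_tail b :
  P (V @^-1` `]b, +oo[) = (expR (- nu * Num.max b 0))%:E.
Proof.
have P0 : P (V @^-1` `]-oo, 0]) = 0%E by rewrite PV// exponential_prob_le0.
have mI (i : interval R) : measurable (V @^-1` [set` i]).
  by rewrite -[X in measurable X]setTI; exact: measurable_funPT.
have tailE : `]b, +oo[%classic = ~` `]-oo, b]%classic :> set R by rewrite setCitvl.
have -> : P (V @^-1` `]b, +oo[) = (1 - P (V @^-1` `]-oo, b]))%E.
  by rewrite tailE preimage_setC; apply: probability_setC; exact: mI.
have [b0|b0] := leP b 0.
  rewrite mulr0 expR0 (_ : P _ = 0%E) ?sube0//.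
  apply: (subset_measure0 (mI _) (mI _) _ P0).
  by move=> w /=; rewrite !in_itv/= => /le_trans; apply.
rewrite (_ : V @^-1` `]-oo, b] = V @^-1` `[0, b] `|` V @^-1` `]-oo, 0]); last first.
  rewrite -preimage_setU; congr (_ @^-1` _); apply/seteqP.
  split=> x /=; rewrite !in_itv/=.
    by move=> xb; case: (leP x 0) => x0; [right|left; rewrite xb andbT ltW].
  by case=> [/andP[]//|/le_trans]; apply; exact: ltW.
have mitv : measurable (`[0, b] : set R) by exact: measurable_itv.
have -> := etrans (measureU0 (mI _) (mI _) P0) (PV mitv).
by rewrite exponential_prob_itv0c// oppeB// addeA subee// add0e.
Qed.

End exponential_tail.

Section independence.
Context {R : realType} {S : finType} {d} {Omega : measurableType d}.
Variables (P : S -> probability Omega R) (phi : Omega -> R -> S).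
Variables (Y : nat -> {mfun Omega >-> R}) (nu : R).
Hypothesis mphi : forall (t : R) j, 0 <= t -> measurable [set w | phi w t = j].
Hypothesis clock_Y : is_exponential_clock P phi Y nu.

Lemma whole_measurable E : whole phi E -> measurable E.
Proof.
apply: smallest_sub; first exact: sigma_algebra_measurable.
by move=> _ [u [j [u0 ->]]]; exact: mphi.
Qed.

Lemma whole_setI E F : whole phi E -> whole phi F -> whole phi (E `&` F).
Proof.
move=> wE wF; pose T := g_sigma_algebraType
  [set E | exists u j, 0 <= u /\ E = [set w | phi w u = j]].
exact: (@measurableI _ T).
Qed.

Lemma wholeT : whole phi setT.
Proof.
pose T := g_sigma_algebraType
  [set E | exists u j, 0 <= u /\ E = [set w | phi w u = j]].
exact: (@measurableT _ T).
Qed.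

Lemma mY m B : measurable B -> measurable (Y m @^-1` B).
Proof. by move=> mB; rewrite -[X in measurable X]setTI; exact: measurable_funPT. Qed.

Definition box (M : nat) (B : nat -> set R) : set Omega :=
  \bigcap_(m in [set m | (m < M)%N]) (Y m @^-1` B m).

Lemma box_measurable M B : (forall m, measurable (B m)) -> measurable (box M B).
Proof.
by move=> mB; apply: bigcap_measurableType => m _; exact: mY.
Qed.

(** Stable under intersection when [C] is, and generating the events of [C]
    together with the clock values of index outside [N]: independence needs to
    be checked on it only. *)
Definition rects (C : set (set Omega)) (N : pred nat) : set (set Omega) :=
  [set H | exists E M B, [/\ C E, forall m, measurable (B m),
     forall m, N m -> B m = setT & H = E `&` box M B]].

Lemma rects_setI C N : setI_closed C -> setI_closed (rects C N).
Proof.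
move=> CI _ _ [E1 [M1 [B1 [CE1 mB1 B1N ->]]]] [E2 [M2 [B2 [CE2 mB2 B2N ->]]]].
exists (E1 `&` E2), (maxn M1 M2), (fun m =>
  (if (m < M1)%N then B1 m else setT) `&` (if (m < M2)%N then B2 m else setT)).
split; first exact: CI.
- by move=> m; apply: measurableI; case: ifP.
- by move=> m Nm; rewrite B1N// B2N// !if_same setIT.
rewrite setIACA; congr (_ `&` _); apply/seteqP; split=> w.
  by move=> [w1 w2] m _; split; case: ifPn => // mM; [exact: w1|exact: w2].
move=> wB; split=> m mM.
  have : (m < maxn M1 M2)%N by rewrite leq_max mM.
  by move=> /wB[]; rewrite mM.
have : (m < maxn M1 M2)%N by rewrite leq_max mM orbT.
by move=> /wB[_]; rewrite mM.
Qed.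

Lemma probability_box i E M B : whole phi E -> (forall m, measurable (B m)) ->
  P i (E `&` box M B) = (P i E * \prod_(m < M) P i (Y m @^-1` B m))%E.
Proof. by move=> wE mB; exact: (clock_Y.2). Qed.

(** On a box that does not constrain stage [n], a condition on [Y n] adds one
    factor to the product given by the hypothesis on the clock. *)
Lemma clock_independent i n B H : measurable B ->
  <<s rects (whole phi) (pred1 n) >> H ->
  measurable H /\ P i (H `&` Y n @^-1` B) = (P i H * P i (Y n @^-1` B))%E.
Proof.
move=> mB0 sH; pose G := rects (whole phi) (pred1 n).
pose T := g_sigma_algebraType G.
pose idT : Omega -> T := idfun.
have := @dynkin_product R _ _ Omega T (P i) (P i) (Y n @^-1` B) idT idT G.
move=> /(_ (mY n mB0) erefl (rects_setI whole_setI)).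
move=> h; have /h /(_ H sH) [_ mH PH] : forall E, G E -> factorizes (P i) (P i) (Y n @^-1` B) idT idT E.
  move=> _ [E [M [C [wE mC Cn ->]]]].
  have mEC : measurable (E `&` box M C).
    by apply: measurableI; [exact: whole_measurable|exact: box_measurable].
  split => //; first by apply: measurableI => //; exact: mY.
  rewrite !preimage_id.
  pose B' m := if m == n then B else if (m < M)%N then C m else setT.
  have mB' m : measurable (B' m) by rewrite /B'; do 2 case: ifP => // _.
  have E1 : Y n @^-1` B `&` (E `&` box M C) = E `&` box (maxn M n.+1) B'.
    rewrite setICA; congr (_ `&` _); apply/seteqP; split=> w.
      move=> [wB wC] m _; rewrite /B' /=; case: eqP => [->//|_].
      by case: ifP => // mM; exact: wC.
    move=> wB; split.
      by have := wB n; rewrite /B' /= eqxx; apply; rewrite leq_max ltnSn orbT.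
    move=> m /= mM; have := wB m; rewrite /B' /= leq_max mM => /(_ isT).
    by case: eqP => [->|//]; rewrite (Cn n (eqxx n)).
  have E2 : E `&` box M C = E `&` box (maxn M n.+1)
      (fun m => if (m < M)%N then C m else setT).
    congr (_ `&` _); apply/seteqP; split=> w wC m /=.
      by move=> _; case: ifP => // mM; exact: wC.
    by move=> mM; have := wC m; rewrite /= leq_max mM; apply.
  rewrite E1 E2 !probability_box//; last by move=> m; case: ifP.
  have nM : (n < maxn M n.+1)%N by rewrite leq_max ltnSn orbT.
  rewrite (bigD1 (Ordinal nM))//= [in RHS](bigD1 (Ordinal nM))//=.
  rewrite /B' eqxx (Cn n (eqxx n)) if_same preimage_setT probability_setT mul1e.
  rewrite muleCA; congr (_ * (_ * _))%E; apply: eq_bigr => m mn.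
  by rewrite ifN//; apply: contra mn => /eqP mn; apply/eqP/val_inj.
by split; [|rewrite setIC muleC].
Qed.

(** The case [C = {setT}], [N] empty of [rects] consists of the events of the
    clock alone. *)
Lemma phase_clock_independent i E H : whole phi E ->
  <<s rects [set setT] pred0 >> H ->
  measurable H /\ P i (E `&` H) = (P i E * P i H)%E.
Proof.
move=> wE sH; pose G := rects [set setT] pred0.
pose T := g_sigma_algebraType G.
pose idT : Omega -> T := idfun.
have GI : setI_closed G by apply: rects_setI => _ _ -> ->; rewrite /= setIT.
have := @dynkin_product R _ _ Omega T (P i) (P i) E idT idT G.
move=> /(_ (whole_measurable wE) erefl GI).
move=> h; have /h /(_ H sH) [_ mH PH] : forall F, G F -> factorizes (P i) (P i) E idT idT F.
  move=> _ [F [M [C [-> mC _ ->]]]].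
  have mC' : measurable (box M C) by exact: box_measurable.
  have PT : P i (box M C) = (\prod_(m < M) P i (Y m @^-1` C m))%E.
    by rewrite -[box M C]setTI probability_box ?probability_setT ?mul1e//; exact: wholeT.
  rewrite setTI; split=> //.
    by apply: measurableI => //; exact: whole_measurable.
  by rewrite preimage_id probability_box// PT.
by split.
Qed.

End independence.

Section scaling.
Context {R : realType} {d} {Omega : measurableType d}.
Variables (P : probability Omega R).

Lemma bigcup_scale (F G : nat -> set Omega) (k : R) :
  0 <= k -> (forall m, measurable (F m)) -> (forall m, measurable (G m)) ->
  trivIset setT F -> trivIset setT G ->
  (forall m, P (F m) = (P (G m) * k%:E)%E) ->
  P (\bigcup_m F m) = (P (\bigcup_m G m) * k%:E)%E.
Proof.
move=> k0 mF mG tF tG FG.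
rewrite !measure_semi_bigcup//; try exact: bigcupT_measurable.
rewrite muleC -nneseriesZl//; apply: eq_eseriesr => m _.
by rewrite muleC; exact: FG.
Qed.

Lemma grid_cells_trivIset (W : Omega -> R) n (A : nat -> set Omega) :
  (forall m w, A m w -> grid n (W w) = m.+1%:R / n.+1%:R) -> trivIset setT A.
Proof.
move=> AW m l _ _ [w [/AW E1 /AW]]; rewrite E1.
move/(mulIf (invr_neq0 _)) => /(_ (lt0r_neq0 (ltr0Sn _ _)))/eqP.
by rewrite eqr_nat eqSS => /eqP.
Qed.

(** The lack of memory of an exponential variable [V] at a random age [W]
    independent of it.  For an age rounded up to a grid, condition on its value
    and use [expR (- nu * (g + b)) = expR (- nu * g) * expR (- nu * b)]; the
    grids converge to the age from above, which is harmless for strict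
    inequalities. *)
Lemma memoryless (nu b : R) (H : set Omega) (W V : Omega -> R) :
  0 <= b -> measurable_fun setT V -> (forall w, H w -> 0 <= W w) ->
  (forall B, measurable B -> measurable (H `&` W @^-1` B)) ->
  (forall B x, measurable B -> 0 <= x ->
     P (H `&` W @^-1` B `&` [set w | x < V w]) =
     (P (H `&` W @^-1` B) * (expR (- nu * x)%R)%:E)%E) ->
  P (H `&` [set w | W w + b < V w]) =
  (P (H `&` [set w | (W w < V w)%R]) * (expR (- nu * b)%R)%:E)%E.
Proof.
move=> b0 mV W0 mHW HWV.
have mVx x : measurable [set w | x < V w].
  rewrite -[X in measurable X]setTI.
  exact: (measurable_fun_ltr (f := cst x) (g := V)).
pose cell n m := H `&` W @^-1` `[m%:R / n.+1%:R, m.+1%:R / n.+1%:R[.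
have mcell n m : measurable (cell n m) by apply: mHW; exact: measurable_itv.
pose A (b' : R) n m := cell n m `&` [set w | m.+1%:R / n.+1%:R + b' < V w].
have mA b' n m : measurable (A b' n m) by apply: measurableI.
have cellP n m w : H w -> cell n m w <-> grid n (W w) = m.+1%:R / n.+1%:R.
  move=> Hw; have := gridP n m (W0 w Hw); rewrite /cell /= in_itv/= => <-.
  by split=> [[]|].
have tA b' n : trivIset setT (A b' n).
  apply: (grid_cells_trivIset (W := W) (n := n)) => m w [Cw _].
  by apply/cellP => //; case: Cw.
have UA b' n : \bigcup_m A b' n m = H `&` [set w | grid n (W w) + b' < V w].
  apply/seteqP; split=> w.
    move=> [m _ [Cw /= mV']]; have Hw : H w by case: Cw.
    by split => //=; rewrite ((cellP n m w Hw).1 Cw).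
  move=> [Hw /= gV]; have [m gm] := grid_ex n (W0 w Hw).
  exists m => //; split; first exact/cellP.
  by rewrite /= -gm.
have cvg b' : 0 <= b' -> P (\bigcup_m A b' n m) @[n --> \oo] -->
                P (H `&` [set w | W w + b' < V w]).
  move=> b'0; apply: (eventually_cvg_measure (A_ := fun n => \bigcup_m A b' n m)).
    by move=> n; exact: bigcupT_measurable.
  move=> w; suff : \forall n \near \oo, (H `&` [set w | grid n (W w) + b' < V w]) w <->
      (H `&` [set w | W w + b' < V w]) w by apply: filterS => n; rewrite UA.
  have [Hw|nH] := pselect (H w); last by apply: nearW => n; split=> -[].
  have [WV|VW] := ltP (W w + b') (V w); last first.
    apply: nearW => n; split=> -[_] /=; rewrite ltNge.
      by rewrite (le_trans VW)// lerD2r ltW// grid_gt// W0.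
    by rewrite VW.
  apply: (grid_near (Q := fun g => (H `&` [set w | g + b' < V w]) w <->
     (H `&` [set w | W w + b' < V w]) w)); first exact: W0.
  have : \forall u \near (W w)^'+, u < V w - b'.
    by apply: nbhs_right_lt; rewrite ltrBrDr.
  by apply: filterS => u; rewrite ltrBrDr => uV; split.
have e0 : 0 <= expR (- nu * b) by exact: expR_ge0.
have scale n : P (\bigcup_m A b n m) = (P (\bigcup_m A 0%R n m) * (expR (- nu * b)%R)%:E)%E.
  apply: bigcup_scale => // m; have m0 : 0 <= m.+1%:R / n.+1%:R :> R by rewrite divr_ge0.
  rewrite /A !HWV ?addr_ge0//; try exact: measurable_itv.
  by rewrite addr0 -muleA -EFinM -expRD mulrDr.
have := cvg b b0; under eq_fun do rewrite scale.
have lim2 : (P (\bigcup_m A 0%R n m) * (expR (- nu * b)%R)%:E)%E @[n --> \oo] -->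
    (P (H `&` [set w | (W w < V w)%R]) * (expR (- nu * b)%R)%:E)%E.
  apply: cvgeZr => //; have := cvg 0 (lexx 0).
  by under [X in P (_ `&` [set w | X w]) ]eq_fun do rewrite addr0.
by move=> lim1; exact: (cvg_unique _ lim1 lim2).
Qed.

End scaling.

(** * The residual clock *)

(** The stages as seen from time [s] during stage [n]: stage [n] is replaced by
    what is left of it, and earlier stages are dropped. *)
Definition residual {R : realType} (y : nat -> R) (n : nat) (s : R) : nat -> R :=
  fun m => if m is 0%N then clock y n.+1 - s else y (n + m)%N.

Lemma clockS {R : realType} (y : nat -> R) n : clock y n.+1 = clock y n + y n.
Proof. by rewrite /clock big_ord_recr. Qed.

Lemma clock_residual {R : realType} (y : nat -> R) n s m : (0 < m)%N ->
  clock (residual y n s) m = clock y (n + m)%N - s.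
Proof.
case: m => // m _; elim: m => [|m IH].
  by rewrite addn1 {1}/clock big_ord1.
by rewrite clockS IH [in RHS]addnS clockS addrAC.
Qed.

Section residual_measurable.
Context {R : realType} {d} {T : measurableType d} (ys : T -> nat -> R) (N : nat).
Hypothesis mys : forall m, (m < N)%N -> measurable_fun setT (ys ^~ m).

Lemma measurable_clock_lt n : (n <= N)%N ->
  measurable_fun setT (fun w => clock (ys w) n).
Proof.
move=> nN; apply: measurable_sum => m; apply: mys.
exact: leq_trans (ltn_ord m) nN.
Qed.

Lemma measurable_in_stage n s : (n < N)%N ->
  measurable [set w | in_stage (ys w) n s].
Proof.
move=> nN; rewrite -[X in measurable X]setTI.
apply: (measurable_and (f := fun w => clock (ys w) n <= s)
                       (g := fun w => s < clock (ys w) n.+1)) => //.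
  by apply: measurable_fun_ler => //; apply: measurable_clock_lt; exact: ltnW.
by apply: measurable_fun_ltr => //; exact: measurable_clock_lt.
Qed.

Lemma measurable_residual_gt n s r b : (0 < r)%N -> (n + r <= N)%N ->
  measurable [set w | forall m, (m < r)%N -> b m < residual (ys w) n s m].
Proof.
move=> r0 nrN.
rewrite (_ : [set w | _] = \bigcap_(m in [set m | (m < r)%N])
   [set w | b m < residual (ys w) n s m]); last by [].
apply: bigcap_measurableType => m mr.
rewrite -[X in measurable X]setTI.
apply: (measurable_fun_ltr (f := cst (b m))
                           (g := fun w => residual (ys w) n s m)) => //.
case: m mr => [|m] mr /=.
  apply: measurable_funB => //; apply: measurable_clock_lt.
  by rewrite -addn1 (leq_trans _ nrN)// leq_add2l.
by apply: mys; apply: leq_trans nrN; rewrite ltn_add2l.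
Qed.

End residual_measurable.

Section residual_law.
Context {R : realType} {S : finType} {d} {Omega : measurableType d}.
Variables (P : S -> probability Omega R) (phi : Omega -> R -> S).
Variables (Y : nat -> {mfun Omega >-> R}) (nu : R).
Hypothesis mphi : forall (t : R) j, 0 <= t -> measurable [set w | phi w t = j].
Hypothesis clock_Y : is_exponential_clock P phi Y nu.

Let ys w : nat -> R := Y ^~ w.

Definition tail (b : R) : R := expR (- nu * Num.max b 0).

Lemma clock_tail i n b : P i [set w | b < Y n w] = (tail b)%:E.
Proof.
rewrite -(exponential_tail (clock_Y.1 i n)); congr (P i _).
by apply/seteqP; split => w /=; rewrite in_itv/= andbT.
Qed.

Let others n := rects Y (whole phi) (pred1 n).

Lemma others_clock n m : (m != n)%N ->
  measurable_fun setT (Y m : g_sigma_algebraType (others n) -> R).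
Proof.
move=> mn _ B mB; apply: sub_sigma_algebra.
exists setT, m.+1, (fun k => if k == m then B else setT); split.
- exact: wholeT.
- by move=> k; case: ifP.
- by move=> k /= /eqP ->; rewrite eq_sym (negbTE mn).
congr (_ `&` _); apply/seteqP; split=> w.
  by move=> Bw k _ /=; case: eqP => [->|].
by move=> /(_ m (ltnSn m)); rewrite /= eqxx.
Qed.

Lemma others_whole n F : whole phi F ->
  measurable (F : set (g_sigma_algebraType (others n))).
Proof.
move=> wF; apply: sub_sigma_algebra; exists F, 0%N, (fun=> setT); split => //.
by rewrite (_ : box Y _ _ = setT) ?setIT//; apply/seteqP.
Qed.

Lemma clock_independent_gt i n H x :
  measurable (H : set (g_sigma_algebraType (others n))) ->
  P i (H `&` [set w | x < Y n w]) = (P i H * (tail x)%:E)%E.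
Proof.
move=> mH; have := clock_independent mphi clock_Y i (measurable_itv `]x, +oo[) mH.
move=> [_]; rewrite (_ : Y n @^-1` _ = [set w | x < Y n w]).
  by rewrite clock_tail.
by apply/seteqP; split => w /=; rewrite in_itv/= andbT.
Qed.

Let mC n k : (k <= n)%N ->
  measurable_fun setT (fun w : g_sigma_algebraType (others n) => clock (ys w) k).
Proof.
apply: measurable_clock_lt => m mn; apply: others_clock.
by rewrite neq_ltn mn.
Qed.

(** On the event that stage [n] is running at time [s], the residual clock is
    a fresh exponential clock, independent of the phases.  By induction on the
    number [r] of stages looked at: the first one is the lack of memory of
    [Y n] at the age [s - clock n], which depends on the other stages only; each
    further one is a stage [n + r], independent of all that precedes. *)
Lemma residual_law i F n s r b : whole phi F ->
  P i (F `&` [set w | in_stage (ys w) n s] `&`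
       [set w | forall m, (m < r)%N -> b m < residual (ys w) n s m]) =
  (P i (F `&` [set w | in_stage (ys w) n s]) * (\prod_(m < r) tail (b m))%:E)%E.
Proof.
move=> wF; elim: r => [|r IH].
  rewrite big_ord0 mule1; congr (P i _).
  by apply/seteqP; split=> [w []//|w ?]; split.
rewrite big_ord_recr /= EFinM muleA.
have [->|r0] := posnP r.
  rewrite big_ord0 mule1.
  pose H : set (g_sigma_algebraType (others n)) :=
    F `&` [set w | clock (ys w) n <= s].
  (* the age of stage n at time s *)
  pose W w := s - clock (ys w) n.
  have mW : measurable_fun setT (W : g_sigma_algebraType (others n) -> R).
    by apply: measurable_funB => //; exact: mC.
  have mH : measurable H.
    apply: measurableI; first exact: others_whole.
    rewrite -[X in measurable X]setTI.
    apply: (measurable_fun_ler (f := fun w : g_sigma_algebraType (others n) => clock (ys w) n) (g := cst s)) => //.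
    exact: mC.
  have mHW B : measurable B -> measurable (H `&` W @^-1` B).
    move=> mB; apply: measurableI => //.
    by rewrite -[X in measurable X]setTI; exact: mW.
  have sub (E : set Omega) : measurable (E : set (g_sigma_algebraType (others n))) -> measurable E.
    by move=> mE; have [] := clock_independent mphi clock_Y i measurableT mE.
  have := @memoryless R _ _ (P i) nu (Num.max (b 0%N) 0) H W (Y n).
  have b0 : 0 <= Num.max (b 0%N) 0 by rewrite le_max lexx orbT.
  move=> /(_ b0 (measurable_funPT (Y n))).
  have W0 w : H w -> 0 <= W w by move=> [_ /=]; rewrite subr_ge0.
  move=> /(_ W0 (fun B mB => sub _ (mHW B mB))).
  have ind B x : measurable B -> 0 <= x ->
      P i (H `&` W @^-1` B `&` [set w | x < Y n w]) =
      (P i (H `&` W @^-1` B) * (expR (- nu * x)%R)%:E)%E.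
    move=> mB x0; rewrite clock_independent_gt; last exact: mHW.
    by rewrite /tail max_l.
  move=> /(_ ind); rewrite /tail => ml.
  rewrite (_ : F `&` [set w | in_stage (ys w) n s] = H `&` [set w | W w < Y n w]); last first.
    rewrite /H -setIA; congr (_ `&` _); apply/seteqP; split=> w /=; rewrite /in_stage clockS /W.
      by move=> /andP[-> ?]; split => //; rewrite ltrBlDl.
    by move=> [-> ?]; rewrite -ltrBlDl.
  rewrite -ml; congr (P i _); apply/seteqP; split=> w /=.
    move=> [[Hw Ww] /(_ 0%N (ltn0Sn _))]; rewrite /residual clockS => bw.
    split => //; rewrite -ltrBrDl gt_max; apply/andP; split.
      by move: bw; rewrite /W /ys /=; lra.
    by rewrite subr_gt0.
  rewrite -ltrBrDl gt_max => -[Hw /andP[bw W1]]; split; first by split => //; rewrite -subr_gt0.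
  by move=> [|]// _; rewrite /residual clockS; move: bw; rewrite /W /ys /=; lra.
rewrite -IH -(@clock_independent_gt i (n + r)%N); last first.
  have mys m : (m < n + r)%N ->
      measurable_fun setT (fun w : g_sigma_algebraType (others (n + r)%N) => ys w m).
    by move=> mn; apply: others_clock; rewrite neq_ltn mn.
  apply: measurableI; last exact: (measurable_residual_gt mys).
  apply: measurableI; first exact: others_whole.
  by apply: (measurable_in_stage mys); rewrite -[X in (X < _)%N]addn0 ltn_add2l.
congr (P i _); rewrite -[RHS]setIA; congr (_ `&` _); apply/seteqP; split=> w /=.
  move=> h; split=> [m mr|]; first by apply: h; rewrite ltnS ltnW.
  by have := h r (ltnSn r); case: r r0 {IH h}.
move=> [h br] m; rewrite ltnS leq_eqVlt => /predU1P[->|/h//].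
by case: r r0 br {IH h}.
Qed.

End residual_law.

Lemma probability_full_setI {R : realType} {d} {Omega : measurableType d}
    (P : probability Omega R) A B :
  measurable A -> measurable B -> P A = 1%E -> P (A `&` B) = P B.
Proof.
move=> mA mB PA.
have PC : P (~` A) = 0%E by rewrite probability_setC// PA subee.
have -> : P B = (P (B `\` A) + P (B `&` A))%E by exact: measureDI.
rewrite (_ : P (B `\` A) = 0%E) ?add0e 1?setIC//.
apply: (subset_measure0 (measurableD mB mA) (measurableC mA) _ PC).
by move=> w [].
Qed.

(** * The Markov property *)

Section markov.
Context {R : realType} {S : finType} {d} {Omega : measurableType d}.
Variables (P : S -> probability Omega R) (A : S -> S -> R) (phi : Omega -> R -> S).
Hypothesis ctmc_phi : is_ctmc A P phi.

Lemma ctmc_measurable (t : R) j : 0 <= t -> measurable [set w | phi w t = j].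
Proof. by case: ctmc_phi => _ _ + _ _; apply. Qed.

Lemma ctmc_right_continuous w : right_continuous_path (phi w).
Proof. by case: ctmc_phi => _ /(_ w)[h _] _ _ _; exact: h. Qed.

Lemma past_measurable s E : past phi s E -> measurable E.
Proof.
apply: smallest_sub; first exact: sigma_algebra_measurable.
by move=> _ [u [j [u0 _ ->]]]; exact: ctmc_measurable.
Qed.

Lemma past_mono s t E : s <= t -> past phi s E -> past phi t E.
Proof.
move=> st; apply: sub_sigma_algebra2 => _ [u [j [u0 us ->]]].
by exists u, j; split => //; exact: le_trans st.
Qed.

Lemma past_whole s E : past phi s E -> whole phi E.
Proof.
by apply: sub_sigma_algebra2 => _ [u [j [u0 us ->]]]; exists u, j.
Qed.

Lemma past_phase s u j : 0 <= u -> u <= s -> past phi s [set w | phi w u = j].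
Proof. by move=> u0 us; apply: sub_sigma_algebra; exists u, j. Qed.

Lemma whole_phase (u : R) j : 0 <= u -> whole phi [set w | phi w u = j].
Proof. by move=> u0; apply: sub_sigma_algebra; exists u, j. Qed.

Lemma pastI s E F : past phi s E -> past phi s F -> past phi s (E `&` F).
Proof.
move=> pE pF; pose T := g_sigma_algebraType
  [set E | exists u j, [/\ 0 <= u, u <= s & E = [set w | phi w u = j]]].
exact: (@measurableI _ T).
Qed.

Lemma pastT s : past phi s setT.
Proof.
pose T := g_sigma_algebraType
  [set E | exists u j, [/\ 0 <= u, u <= s & E = [set w | phi w u = j]]].
exact: (@measurableT _ T).
Qed.

Lemma pastD s E F : past phi s E -> past phi s F -> past phi s (E `\` F).
Proof.
move=> pE pF; pose T := g_sigma_algebraType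
  [set E | exists u j, [/\ 0 <= u, u <= s & E = [set w | phi w u = j]]].
exact: (@measurableD _ T).
Qed.

Definition visits (s : R) (l : seq (R * S)) : set Omega :=
  [set w | forall q, q \in l -> phi w (s + q.1) = q.2].

Lemma visits_nil s : visits s [::] = setT.
Proof. by apply/seteqP; split=> w. Qed.

Lemma visits_cons s q l :
  visits s (q :: l) = [set w | phi w (s + q.1) = q.2] `&` visits s l.
Proof.
apply/seteqP; split=> w.
  by move=> h; split=> [|p pl]; apply: h; rewrite inE ?eqxx// pl orbT.
by move=> [hq hl] p; rewrite inE => /predU1P[->//|]; exact: hl.
Qed.

Lemma whole_visits s l : (forall q, q \in l -> 0 <= s + q.1) ->
  whole phi (visits s l).
Proof.
elim: l => [_|q l IH h]; first by rewrite visits_nil; exact: wholeT.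
rewrite visits_cons; apply: whole_setI.
  by apply: whole_phase; apply: h; rewrite inE eqxx.
by apply: IH => p pl; apply: h; rewrite inE pl orbT.
Qed.

(** Product of the transition probabilities along a time-ordered list. *)
Fixpoint weight (u : R) (j : S) (l : seq (R * S)) : R :=
  if l is q :: l' then transition A (q.1 - u) j q.2 * weight q.1 q.2 l' else 1.

Let earlier (p q : R * S) := p.1 <= q.1.

(** One step of the Markov property for each prescribed time, the times already
    visited joining the past [E]. *)
Lemma markov_sorted i (s u0 : R) j0 E l : 0 <= s + u0 -> path earlier (u0, j0) l ->
  past phi (s + u0) E ->
  P i (E `&` [set w | phi w (s + u0) = j0] `&` visits s l) =
  (P i (E `&` [set w | phi w (s + u0) = j0]) * (weight u0 j0 l)%:E)%E.
Proof.
elim: l u0 j0 E => [|[u j] l IH] u0 j0 E su0 /=.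
  by rewrite visits_nil setIT mule1.
move=> /andP[u0u ul] pE; rewrite visits_cons /= setIA IH//; last 2 first.
- by apply: le_trans su0 _; rewrite lerD2l.
- apply: pastI; first by apply: past_mono pE; rewrite lerD2l.
  by apply: past_phase => //; rewrite lerD2l.
case: ctmc_phi => _ _ _ _ /(_ i (s + u0) (u - u0) E j0 j su0).
rewrite subr_ge0 => /(_ u0u pE).
by rewrite addrACA subrr addr0 => ->; rewrite -muleA EFinM.
Qed.

(** The Markov property for finite-dimensional distributions: both sides are
    the [weight] of the sorted list of prescriptions. *)
Lemma markov_visits i s E j l : 0 <= s -> past phi s E ->
  (forall q, q \in l -> 0 <= q.1) ->
  P i (E `&` [set w | phi w s = j] `&` visits s l) =
  (P i (E `&` [set w | phi w s = j]) * P j (visits 0 l))%E.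
Proof.
move=> s0 pE l0; pose l' := sort earlier l.
have vE t : visits t l = visits t l'.
  by apply/seteqP; split=> w h q ql; apply: h; move: ql; rewrite mem_sort.
have tot : total earlier by move=> p q; exact: le_total.
have sl : path earlier (0, j) l'.
  have : sorted earlier l' by exact: sort_sorted.
  have : forall q, q \in l' -> 0 <= q.1 by move=> q; rewrite mem_sort => /l0.
  by case: (l') => //= q l'' h ->; rewrite andbT /earlier /= h// inE eqxx.
rewrite (vE s); have := @markov_sorted i s 0 j E l'; rewrite addr0 => -> //.
congr (_ * _)%E.
have := @markov_sorted j 0 0 j setT l'; rewrite addr0 => /(_ (lexx _) sl (@pastT 0)).
have P1 : P j [set w | phi w 0 = j] = 1%E by case: ctmc_phi => _ _ _ + _; apply.
rewrite setTI P1 mul1e => <-.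
have mv : measurable (visits 0 l).
  apply: (whole_measurable ctmc_measurable); apply: whole_visits => q /l0.
  by rewrite add0r.
have m0 : measurable [set w | phi w 0 = j] by exact: ctmc_measurable.
by rewrite -vE (probability_full_setI m0 mv P1).
Qed.

End markov.

Lemma near_right_le {R : realType} (s C : R) :
  \forall u \near s^'+, (C <= u) = (C <= s).
Proof.
have [Cs|sC] := leP C s.
  by near=> u; apply: le_trans Cs _; apply: ltW; near: u; exact: nbhs_right_gt.
have := nbhs_right_lt sC; apply: filterS => u uC.
by rewrite leNgt uC.
Unshelve. all: by end_near. Qed.

(** * The strong Markov property *)

Section strong_markov.
Context {R : realType} {S : finType} {d} {Omega : measurableType d}.
Variables (P : S -> probability Omega R) (A : S -> S -> R) (phi : Omega -> R -> S).
Variables (Y : nat -> {mfun Omega >-> R}) (nu : R).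
Hypothesis ctmc_phi : is_ctmc A P phi.
Hypothesis clock_Y : is_exponential_clock P phi Y nu.
Variable i0 : S.

Let ys w : nat -> R := Y ^~ w.
Let mphi := ctmc_measurable ctmc_phi.
Let mys m : measurable_fun setT (ys ^~ m). Proof. exact: measurable_funPT. Qed.

Definition restart (s : R) (n : nat) (w : Omega) : (R -> S) * (nat -> R) :=
  (theta s (phi w), residual (ys w) n s).

Lemma cylinder_restart l r b s n :
  [set w | cylinder l r b (restart s n w)] =
  visits phi s l `&`
  [set w | forall m, (m < r)%N -> b m < residual (ys w) n s m].
Proof. by []. Qed.

Lemma cylinder_start l r b :
  [set w | cylinder l r b (phi w, ys w)] =
  visits phi 0 l `&` [set w | forall m, (m < r)%N -> b m < ys w m].
Proof.
apply/seteqP; split=> w [h1 h2]; split => // q ql; have := h1 q ql;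
  by rewrite /visits /= add0r.
Qed.

Lemma start_clock_law i F r b : whole phi F ->
  P i (F `&` [set w | forall m, (m < r)%N -> b m < ys w m]) =
  (P i F * (\prod_(m < r) tail nu (b m))%:E)%E.
Proof.
move=> wF; pose B m := `]b m, +oo[%classic : set R.
have -> : [set w | forall m, (m < r)%N -> b m < ys w m] = box Y r B.
  by apply/seteqP; split=> w h m /h; rewrite /B /= in_itv/= andbT.
rewrite (probability_box clock_Y)//; last by move=> m; exact: measurable_itv.
congr (_ * _)%E; rewrite (big_morph _ EFinM (erefl (EFin 1))).
by apply: eq_bigr => m _; rewrite (exponential_tail (clock_Y.1 i m)).
Qed.

(** The Markov property of phase and clock together at a fixed time: phases and
    clock are independent, the phases satisfy [markov_visits] and the clock
    [residual_law]. *)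
Lemma joint_markov i s E j n l r b : 0 <= s -> past phi s E ->
  (forall q, q \in l -> 0 <= q.1) ->
  P i (E `&` [set w | phi w s = j] `&` [set w | in_stage (ys w) n s] `&`
       [set w | cylinder l r b (restart s n w)]) =
  (P i (E `&` [set w | phi w s = j] `&` [set w | in_stage (ys w) n s]) *
   P j [set w | cylinder l r b (phi w, ys w)])%E.
Proof.
move=> s0 pE l0; rewrite cylinder_restart cylinder_start.
have wE : whole phi (E `&` [set w | phi w s = j]).
  by apply: whole_setI; [exact: past_whole pE|exact: whole_phase].
have wv : whole phi (visits phi s l).
  by apply: whole_visits => q /l0 q0; exact: addr_ge0.
have wv0 : whole phi (visits phi 0 l).
  by apply: whole_visits => q /l0; rewrite add0r.
have indep F : whole phi F ->
    P i (F `&` [set w | in_stage (ys w) n s]) = (P i F * P i [set w | in_stage (ys w) n s])%E.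
  move=> wF; have [//|_ ->//] := @phase_clock_independent _ _ _ _ P phi Y nu mphi clock_Y i F [set w | in_stage (ys w) n s] wF.
  pose T := g_sigma_algebraType (rects Y [set setT] pred0).
  have mT m : measurable_fun setT (fun w : T => ys w m).
    move=> _ B mB; apply: sub_sigma_algebra.
    exists setT, m.+1, (fun k => if k == m then B else setT); split => //.
      by move=> k; case: ifP.
    congr (_ `&` _); apply/seteqP; split=> w.
      by move=> Bw k _ /=; case: eqP => [->|].
    by move=> /(_ m (ltnSn m)); rewrite /= eqxx.
  exact: (@measurable_in_stage _ _ T (fun w => ys w) n.+1).
rewrite start_clock_law// muleA.
rewrite (_ : _ `&` (_ `&` _) = E `&` [set w | phi w s = j] `&` visits phi s l `&`
   [set w | in_stage (ys w) n s] `&`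
   [set w | forall m, (m < r)%N -> b m < residual (ys w) n s m]); last first.
  by rewrite setIA; congr (_ `&` _); rewrite setIAC.
have wEv := whole_setI wE wv.
rewrite (residual_law mphi clock_Y)//; congr (_ * _)%E.
by rewrite indep// indep// (markov_visits ctmc_phi)// muleAC.
Qed.

Variable sigma : Omega -> \bar R.
Hypothesis sigma_ge0 : forall w, (0 <= sigma w)%E.
Hypothesis sigma_past : forall t : R, 0 <= t ->
  past phi t [set w | (sigma w < t%:E)%E].

Let s w := fine (sigma w).
Let s0 w : 0 <= s w. Proof. exact: fine_ge0. Qed.

Definition stopped j n : set Omega :=
  [set w | [/\ (sigma w < +oo)%E, phi w (s w) = j & in_stage (ys w) n (s w)]].

(** The instant [u w] at which phase, stage and future are read is a parameter:
    it will be the optional time or one of its discretizations. *)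
Definition stopped_cylinder j n l r b (u : Omega -> R) : set Omega :=
  [set w | [/\ (sigma w < +oo)%E, phi w (u w) = j, in_stage (ys w) n (u w) &
               cylinder l r b (restart (u w) n w)]].

Let sN N w := grid N (s w).

Let cell N m := [set w | (sigma w < (m.+1%:R / N.+1%:R)%:E)%E] `\`
                [set w | (sigma w < (m%:R / N.+1%:R)%:E)%E].

Let cellP N m w : cell N m w <->
  (sigma w < +oo)%E /\ sN N w = m.+1%:R / N.+1%:R.
Proof.
rewrite /cell /sN; split.
  move=> [/= lt /negP]; rewrite -leNgt => ge.
  have fs : sigma w \is a fin_num.
    by rewrite ge0_fin_numE//; apply: lt_trans lt _; rewrite ltry.
  split; first by rewrite -ge0_fin_numE.
  by apply/gridP => //; rewrite -!lee_fin -lte_fin fineK// lt ge.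
move=> [soo /(gridP N m (s0 w))].
have fs : sigma w \is a fin_num by rewrite ge0_fin_numE.
rewrite -lee_fin -lte_fin /s fineK// => /andP[ge lt].
by split => //=; apply/negP; rewrite -leNgt.
Qed.

Let cell_past N m : past phi (m.+1%:R / N.+1%:R) (cell N m).
Proof.
apply: pastD; first by apply: sigma_past; rewrite divr_ge0.
apply: (past_mono (s := m%:R / N.+1%:R)); last by apply: sigma_past; rewrite divr_ge0.
by rewrite ler_wpM2r ?invr_ge0// ler_nat.
Qed.

(** The part of the discretized event on which the optional time lies in the
    [m]-th cell of the grid, all quantities being read at the right end of the
    cell.  There the time is deterministic and [joint_markov] applies. *)
Let approx j n l r b N m : set Omega :=
  cell N m `&` [set w | phi w (m.+1%:R / N.+1%:R) = j] `&`
  [set w | in_stage (ys w) n (m.+1%:R / N.+1%:R)] `&`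
  [set w | cylinder l r b (restart (m.+1%:R / N.+1%:R) n w)].

Let measurable_cylinder l r b u n : 0 <= u -> (forall q, q \in l -> 0 <= q.1) ->
  measurable [set w | cylinder l r b (restart u n w)].
Proof.
move=> u0 l0; rewrite cylinder_restart; apply: measurableI.
  apply: (whole_measurable mphi); apply: whole_visits => q /l0 q0.
  exact: addr_ge0.
have [->|r0] := posnP r.
  by rewrite (_ : [set w | _] = setT)//; apply/seteqP.
exact: (@measurable_residual_gt _ _ _ ys (n + r)).
Qed.

Let approx_measurable j n l r b N m : (forall q, q \in l -> 0 <= q.1) ->
  measurable (approx j n l r b N m).
Proof.
have t0 : 0 <= m.+1%:R / N.+1%:R :> R by rewrite divr_ge0.
move=> l0; apply: measurableI; last exact: measurable_cylinder.
apply: measurableI; last by apply: (@measurable_in_stage _ _ _ ys n.+1).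
by apply: measurableI; [exact: (past_measurable ctmc_phi (@cell_past N m))|exact: mphi].
Qed.

Let approx_bigcup j n l r b N :
  \bigcup_m approx j n l r b N m = stopped_cylinder j n l r b (sN N).
Proof.
apply/seteqP; split=> w.
  by move=> [m _ [[[/cellP[soo sE] pj] st] cyl]]; split => //; rewrite sE.
move=> [soo pj st cyl]; have [m mE] := grid_ex N (s0 w).
exists m => //; rewrite /approx -mE; do 3 split => //.
exact/cellP.
Qed.

Let approx_trivIset j n l r b N : trivIset setT (approx j n l r b N).
Proof.
apply: (grid_cells_trivIset (W := s) (n := N)).
by move=> m w [[[/cellP[]]]].
Qed.

(** Phases are right-continuous, and the conditions on the clock are of the form
    [u < C] or [C <= u], which persist to the right. *)
Let restart_near j n l r b w : (forall q, q \in l -> 0 <= q.1) ->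
  \forall u \near (s w)^'+,
    (phi w u = j /\ in_stage (ys w) n u /\ cylinder l r b (restart u n w)) <->
    (phi w (s w) = j /\ in_stage (ys w) n (s w) /\
     cylinder l r b (restart (s w) n w)).
Proof.
move=> l0.
have n1 : \forall u \near (s w)^'+, phi w u = phi w (s w).
  exact: ctmc_right_continuous ctmc_phi _ _ _.
have n2 : \forall u \near (s w)^'+,
    forall q, q \in l -> phi w (u + q.1) = phi w (s w + q.1).
  elim: l l0 => [|q l IH] l0; first by apply: nearW => u q; rewrite in_nil.
  have q0 : 0 <= q.1 by apply: l0; rewrite inE eqxx.
  have lq p : p \in l -> 0 <= p.1 by move=> pl; apply: l0; rewrite inE pl orbT.
  have [e /= e0 eq] := ctmc_right_continuous ctmc_phi w (addr_ge0 (s0 w) q0).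
  have n3 : \forall u \near (s w)^'+, phi w (u + q.1) = phi w (s w + q.1).
    exists e => //= u /= ue su; apply: eq; last by rewrite ltrD2r.
    by rewrite /= opprD addrACA subrr addr0.
  have := IH lq; move: n3; apply: filterS2 => u uq ul p.
  by rewrite inE => /predU1P[->//|]; exact: ul.
have n3 := near_right_le (s w) (clock (ys w) n).
have n4 := near_right_le (s w) (clock (ys w) n.+1).
have n5 := near_right_le (s w) (clock (ys w) n.+1 - b 0%N).
near=> u.
have e1 : phi w u = phi w (s w) by near: u.
have e2 : forall q, q \in l -> phi w (u + q.1) = phi w (s w + q.1) by near: u.
have e3 : (clock (ys w) n <= u) = (clock (ys w) n <= s w) by near: u.
have e4 : (clock (ys w) n.+1 <= u) = (clock (ys w) n.+1 <= s w) by near: u.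
have e5 : (clock (ys w) n.+1 - b 0%N <= u) = (clock (ys w) n.+1 - b 0%N <= s w).
  by near: u.
have e6 m : (b m < residual (ys w) n u m) = (b m < residual (ys w) n (s w) m).
  case: m => [|m]//=.
  by rewrite !(ltrBrDr, ltrBrDl) -!ltrBrDl -!(opprB _ (clock _ _)) !ltNge; move: e5; lra.
rewrite e1 /in_stage e3 !ltNge e4.
suff -> : cylinder l r b (restart u n w) <-> cylinder l r b (restart (s w) n w) by [].
split=> -[h1 h2]; split=> [q ql|m mr].
- by rewrite /= /theta -e2//; exact: h1.
- by rewrite /= -e6; exact: h2.
- by rewrite /= /theta e2//; exact: h1.
- by rewrite /= e6; exact: h2.
Unshelve. all: by end_near. Qed.

Let stopped_cvg j n l r b : (forall q, q \in l -> 0 <= q.1) ->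
  forall w, \forall N \near \oo,
    (\bigcup_m approx j n l r b N m) w <-> stopped_cylinder j n l r b s w.
Proof.
move=> l0 w.
suff : \forall N \near \oo, stopped_cylinder j n l r b (sN N) w <->
    stopped_cylinder j n l r b s w by apply: filterS => N; rewrite approx_bigcup.
have := grid_near (s0 w) (restart_near j n r b w l0).
apply: filterS => N [h1 h2]; split=> -[soo pj st cyl].
  by have [? [? ?]] := h1 (conj pj (conj st cyl)).
by have [? [? ?]] := h2 (conj pj (conj st cyl)).
Qed.

Let stopped_cylinder0 j n b : stopped_cylinder j n [::] 0 b s = stopped j n.
Proof. by apply/seteqP; split=> w -[]. Qed.

Lemma stopped_measurable j n : measurable (stopped j n).
Proof.
rewrite -(stopped_cylinder0 j n (fun=> 0)).
apply: (eventually_measurable _ (@stopped_cvg j n [::] 0%N (fun=> 0) _)) => // N.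
by apply: bigcupT_measurable => m; exact: approx_measurable.
Qed.

Let measurable_cylinder_start l r b : (forall q, q \in l -> 0 <= q.1) ->
  measurable [set w | cylinder l r b (phi w, ys w)].
Proof.
move=> l0; rewrite cylinder_start; apply: measurableI.
  by apply: (whole_measurable mphi); apply: whole_visits => q /l0; rewrite add0r.
rewrite (_ : [set w | _] = \bigcap_(m in [set m | (m < r)%N]) [set w | b m < ys w m]); last by [].
apply: bigcap_measurableType => m _; rewrite -[X in measurable X]setTI.
exact: (measurable_fun_ltr (f := cst (b m)) (g := ys ^~ m)).
Qed.

(** Summing [joint_markov] over the cells gives the identity for the discretized
    time, with the same factor [P j _] at each grid; both sides converge. *)
Lemma strong_markov_cylinder i j n l r b : (forall q, q \in l -> 0 <= q.1) ->
  measurable (stopped_cylinder j n l r b s) /\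
  P i (stopped_cylinder j n l r b s) =
  (P i (stopped j n) * P j [set w | cylinder l r b (phi w, ys w)])%E.
Proof.
move=> l0; have mU l' r' N : (forall q, q \in l' -> 0 <= q.1) ->
    measurable (\bigcup_m approx j n l' r' b N m).
  by move=> l'0; apply: bigcupT_measurable => m; exact: approx_measurable.
have c1 := @eventually_cvg_measure _ _ _ _ _ (fun N => mU l r N l0) (stopped_cvg j n r b l0) (P i).
have n0 (q : R * S) : q \in [::] -> 0 <= q.1 by [].
have c2 := @eventually_cvg_measure _ _ _ _ _ (fun N => mU [::] 0%N N n0) (stopped_cvg j n 0%N b n0) (P i).
split; first exact: (eventually_measurable (fun N => mU l r N l0) (stopped_cvg j n r b l0)).
set Q := P j _; have mC := measurable_cylinder_start r b l0.
have fQ : Q \is a fin_num by exact: fin_num_measure.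
have scale N : P i (\bigcup_m approx j n l r b N m) =
    (P i (\bigcup_m approx j n [::] 0 b N m) * Q)%E.
  rewrite -(fineK fQ); have Q0 : 0 <= fine Q by rewrite fine_ge0// /Q.
  apply: bigcup_scale => //.
  - by move=> m; exact: approx_measurable.
  - by move=> m; exact: approx_measurable.
  move=> m; have t0 : 0 <= m.+1%:R / N.+1%:R :> R by rewrite divr_ge0.
  rewrite fineK// /approx (joint_markov i j n r b t0 (@cell_past N m) l0).
  congr (P i _ * _)%E; apply/seteqP; split=> w; first by move=> ?; split => //.
  by move=> [].
have F : (fun N => P i (\bigcup_m approx j n l r b N m)) =
    (fun N => P i (\bigcup_m approx j n [::] 0 b N m) * Q)%E.
  by apply/funext => N; exact: scale.
move: c1; rewrite [X in X @ _ --> _]F.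
rewrite -(stopped_cylinder0 j n b) => c1.
exact: (cvg_unique _ c1 (cvgeZr fQ c2)).
Qed.

Definition start_path (w : Omega) : path_clockT i0 :=
  exist _ (phi w, ys w) (ctmc_right_continuous ctmc_phi w).

Definition restart_path n (w : Omega) : path_clockT i0 :=
  exist _ (restart (s w) n w)
    (theta_right_continuous (s0 w) (ctmc_right_continuous ctmc_phi w)).

(** Given the phase [j] and the stage [n] at an optional time, phase and clock
    start afresh from [j]. *)
Lemma strong_markov i j n G : measurable G ->
  factorizes (P i) (P j) (stopped j n) (restart_path n) start_path G.
Proof.
move=> mG; have DP := (@dynkin_product R _ _ Omega (path_clockT i0) (P i) (P j) (stopped j n)
  (restart_path n) start_path (@cylinders R S i0)).
apply: DP => //.
- exact: stopped_measurable.
- exact: cylinders_setI.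
move=> _ [l [r [b [l0 ->]]]].
have [m1 e1] := strong_markov_cylinder i j n r b l0.
have E : stopped j n `&` restart_path n @^-1` [set p | cylinder l r b (sval p)] =
    stopped_cylinder j n l r b s.
  by apply/seteqP; split=> w; [move=> [[]]|move=> []].
by split; [rewrite E|exact: measurable_cylinder_start|rewrite E].
Qed.

End strong_markov.

Lemma measure_bigcup_fin {R : realType} {d} {T : measurableType d}
    (mu : {measure set T -> \bar R}) (I : finType) (F : I -> set T) :
  (forall i, measurable (F i)) -> trivIset setT F ->
  mu (\bigcup_i F i) = (\sum_i mu (F i))%E.
Proof.
move=> mF tF; have -> : \bigcup_i F i = \bigcup_(i in [set` index_enum I]) F i.
  apply/seteqP; split=> w [i _ Fi]; exists i => //.
  by rewrite /= mem_index_enum.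
rewrite bigcup_seq.
elim: (index_enum I) (index_enum_uniq I) => [|i s IH] /=.
  by rewrite !big_nil measure0.
move=> /andP[si us]; rewrite !big_cons -(IH us); apply: measureU => //.
- exact: bigsetU_measurable.
- rewrite -bigcup_seq; apply/seteqP; split=> // w [Fi [j /= js Fj]].
  have ij : i = j by apply: tF => //; exists w.
  by rewrite ij js in si.
Qed.

(** * Renewal at an optional time *)

Section renewal.
Context {R : realType} {S : finType} {d} {Omega : measurableType d}.
Variables (P : S -> probability Omega R) (A : S -> S -> R) (phi : Omega -> R -> S).
Variables (Y : nat -> {mfun Omega >-> R}) (nu : R) (L : nat).
Hypothesis ctmc_phi : is_ctmc A P phi.
Hypothesis clock_Y : is_exponential_clock P phi Y nu.

Let ys w : nat -> R := Y ^~ w.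
Let mphi := ctmc_measurable ctmc_phi.
Let mys m : measurable_fun setT (ys ^~ m). Proof. exact: measurable_funPT. Qed.

(** An event of probability one under [P i], on which the stages up to [L]
    partition [0, clock L[ so that the pathwise arguments go through. *)
Definition regular (i : S) : set Omega :=
  [set w | phi w 0 = i] `&` [set w | forall m, (m < L)%N -> 0 < ys w m].

Lemma regular_measurable i : measurable (regular i).
Proof.
apply: measurableI; first exact: mphi.
rewrite (_ : [set w | _] = \bigcap_(m in [set m | (m < L)%N]) [set w | 0 < ys w m]); last by [].
apply: bigcap_measurableType => m _; rewrite -[X in measurable X]setTI.
exact: (measurable_fun_ltr (f := cst 0) (g := ys ^~ m)).
Qed.

Lemma regular_prob i : P i (regular i) = 1%E.
Proof.
rewrite (start_clock_law clock_Y i L (fun=> 0)); last exact: whole_phase.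
rewrite big1 ?mule1.
  by case: ctmc_phi => _ _ _ + _; apply.
by move=> m _; rewrite /tail maxxx mulr0 expR0.
Qed.

Lemma regular_eq i H H' : measurable H -> measurable H' ->
  (forall w, regular i w -> H w <-> H' w) -> P i H = P i H'.
Proof.
move=> mH mH' HH'.
have mR := regular_measurable i; have R1 := regular_prob i.
rewrite -(probability_full_setI mR mH R1) -(probability_full_setI mR mH' R1).
by congr (P i _); apply/seteqP; split=> w [rw Hw]; split => //; apply/(HH' w rw).
Qed.

Lemma regular_clock_mono i w m n : regular i w -> (m <= n)%N -> (n <= L)%N ->
  clock (ys w) m <= clock (ys w) n.
Proof.
move=> [_ pos]; elim: n => [|n IH]; first by rewrite leqn0 => /eqP ->.
rewrite leq_eqVlt => /predU1P[->//|]; rewrite ltnS => mn nL.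
apply: le_trans (IH mn (ltnW nL)) _.
by rewrite clockS lerDl ltW//; exact: pos.
Qed.

Lemma regular_stage_inj i w m n s : regular i w -> (m < L)%N -> (n < L)%N ->
  in_stage (ys w) m s -> in_stage (ys w) n s -> m = n.
Proof.
have h m' n' : regular i w -> (n' < L)%N ->
    in_stage (ys w) m' s -> in_stage (ys w) n' s -> (n' <= m')%N.
  move=> rw nL /andP[_ lt] /andP[ge _]; rewrite leqNgt; apply/negP => mn.
  have := regular_clock_mono rw mn (ltnW nL).
  by rewrite leNgt (le_lt_trans ge lt).
move=> rw mL nL hm hn; apply/eqP; rewrite eqn_leq.
by rewrite (h n m)// (h m n).
Qed.

Lemma regular_stage_ex i w k s : regular i w -> (k <= L)%N -> 0 <= s ->
  s < clock (ys w) k -> exists2 n, (n < k)%N & in_stage (ys w) n s.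
Proof.
move=> rw; elim: k => [|k IH] kL s0.
  by rewrite /clock big_ord0 => /(le_lt_trans s0); rewrite ltxx.
have [sk|ks] := ltP s (clock (ys w) k).
  by move=> _; have [n nk st] := IH (ltnW kL) s0 sk; exists n => //; exact: ltnW.
by move=> sk; exists k => //; rewrite /in_stage ks.
Qed.

Lemma regular_stage_lt i w n k s : regular i w -> (n < k)%N -> (k <= L)%N ->
  in_stage (ys w) n s -> s < clock (ys w) k.
Proof.
move=> rw nk kL /andP[_ lt]; apply: lt_le_trans lt _.
exact: regular_clock_mono rw nk kL.
Qed.

Variables (i0 : S) (sigma : Omega -> \bar R).
Hypothesis sigma_ge0 : forall w, (0 <= sigma w)%E.
Hypothesis sigma_past : forall t : R, 0 <= t ->
  past phi t [set w | (sigma w < t%:E)%E].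

Let s w := fine (sigma w).

Let mstop j n : measurable (stopped phi Y sigma j n).
Proof. exact: (stopped_measurable Y ctmc_phi sigma_ge0 sigma_past). Qed.

(** On [regular i] the events indexed by the stage [n] and the phase [j] at the
    optional time are disjoint, and each factorizes by the strong Markov
    property. *)
Lemma renewal i H (J : {set S}) k (G : nat -> (R -> S) * (nat -> R) -> Prop) :
  (k <= L)%N -> measurable H ->
  (forall n, measurable [set p : path_clockT i0 | G n (sval p)]) ->
  (forall w, regular i w -> H w <-> exists n j, [/\ (n < k)%N, j \in J,
     stopped phi Y sigma j n w & G n (restart phi Y (s w) n w)]) ->
  fine (P i H) = \sum_(n < k) \sum_(j in J)
    fine (P i (stopped phi Y sigma j n)) *
    fine (P j [set w | G n (phi w, ys w)]).
Proof.
move=> kL mH mG HG.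
have SM n j := strong_markov ctmc_phi clock_Y sigma_ge0 sigma_past i j n (mG n).
pose D n j := stopped phi Y sigma j n `&`
  restart_path Y ctmc_phi i0 sigma_ge0 n @^-1` [set p : path_clockT i0 | G n (sval p)].
have mD n j : measurable (D n j) by have [] := SM n j.
have PD n j : P i (D n j) = (P i (stopped phi Y sigma j n) * P j [set w | G n (phi w, ys w)])%E.
  by have [] := SM n j.
have mR := regular_measurable i; have R1 := regular_prob i.
pose F (q : 'I_k * S) := if q.2 \in J then regular i `&` D q.1 q.2 else set0.
have mF q : measurable (F q) by rewrite /F; case: ifP => // _; exact: measurableI.
have tF : trivIset setT F.
  move=> [m j] [n l] _ _ [w]; rewrite /F /=.
  case: ifP => [_|_ []//]; case: ifP => [_|_ [_ []]].
  move=> [[rw [[_ pj st] _]] [_ [[_ pl st'] _]]].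
  have mn : m = n :> nat.
    by apply: regular_stage_inj rw _ _ st st'; exact: leq_trans kL.
  by rewrite -pj -pl; congr (_, _); exact: val_inj.
have -> : P i H = P i (\bigcup_q F q).
  rewrite -(probability_full_setI mR mH R1); congr (P i _).
  apply/seteqP; split=> w.
    move=> [rw /(HG w rw)[n [j [nk jJ st Gw]]]]; exists (Ordinal nk, j) => //.
    by rewrite /F /= jJ.
  move=> [[n j] _]; rewrite /F /=; case: ifP => // jJ [rw [st Gw]].
  by split => //; apply/(HG w rw); exists n, j.
rewrite measure_bigcup_fin//.
rewrite (eq_bigr (fun q : 'I_k * S => (if q.2 \in J then
    fine (P i (stopped phi Y sigma q.2 q.1)) *
    fine (P q.2 [set w | G q.1 (phi w, ys w)]) else 0)%:E)); last first.
  move=> [n j] _; rewrite /F /=; case: ifP => jJ; last by rewrite measure0.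
  rewrite (probability_full_setI mR (mD n j) R1) PD EFinM !fineK//.
    by apply: fin_num_measure; have [_] := SM n j.
  by apply: fin_num_measure; exact: mstop.
rewrite sumEFin /= -(pair_bigA _ (fun (n : 'I_k) j => if j \in J then
    fine (P i (stopped phi Y sigma j n)) *
    fine (P j [set w | G n (phi w, ys w)]) else 0))/=.
by apply: eq_bigr => n _; rewrite [RHS]big_mkcond.
Qed.

End renewal.

(** * Exits from a band and empty periods *)

Section band.
Context {R : realType} {S : finType}.
Variables (c : S -> R) (f : R -> S).
Hypothesis c_neq0 : forall i, c i != 0.
Hypothesis frc : right_continuous_path f.
Implicit Types (a h l s v : R).

(** Made infinite off the event that the walk leaves the band [l, h] through its
    top, so that this event is the finiteness of one optional time. *)
Definition exit_up a h l : \bar R :=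
  if (tau_up c f a h < tau_down c f a l)%E then tau_up c f a h else +oo%E.

Definition exit_down a h l : \bar R :=
  if (tau_down c f a l < tau_up c f a h)%E then tau_down c f a l else +oo%E.

Lemma exit_up_ge0 a h l : (0 <= exit_up a h l)%E.
Proof. by rewrite /exit_up; case: ifP => _; rewrite ?tau_up_ge0// leey. Qed.

Lemma exit_down_ge0 a h l : (0 <= exit_down a h l)%E.
Proof. by rewrite /exit_down; case: ifP => _; rewrite ?tau_down_ge0// leey. Qed.

Lemma exit_up_lt a h l (t : \bar R) : (exit_up a h l < t)%E <->
  (tau_up c f a h < tau_down c f a l)%E /\ (tau_up c f a h < t)%E.
Proof.
rewrite /exit_up; case: ifP => ud; split=> [|[]]//.
by rewrite ltNge leey.
Qed.

Lemma exit_down_lt a h l (t : \bar R) : (exit_down a h l < t)%E <->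
  (tau_down c f a l < tau_up c f a h)%E /\ (tau_down c f a l < t)%E.
Proof.
rewrite /exit_down; case: ifP => ud; split=> [|[]]//.
by rewrite ltNge leey.
Qed.

Lemma exit_up_fin a h l : (exit_up a h l < +oo)%E ->
  (tau_up c f a h < tau_down c f a l)%E /\
  tau_up c f a h = (fine (exit_up a h l))%:E.
Proof.
move=> e; have [ud uoo] := (exit_up_lt a h l +oo).1 e; split => //.
rewrite fineK; first by rewrite /exit_up ud.
by rewrite ge0_fin_numE// exit_up_ge0.
Qed.

Lemma exit_down_fin a h l : (exit_down a h l < +oo)%E ->
  (tau_down c f a l < tau_up c f a h)%E /\
  tau_down c f a l = (fine (exit_down a h l))%:E.
Proof.
move=> e; have [ud uoo] := (exit_down_lt a h l +oo).1 e; split => //.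
rewrite fineK; first by rewrite /exit_down ud.
by rewrite ge0_fin_numE// exit_down_ge0.
Qed.

Variables (a h l : R) (z : R -> R).
Hypothesis zf : is_fluid_queue c f a z.
Hypotheses (l0 : 0 <= l) (la : l <= a) (ah : a <= h).

Let w0 : walk c f 0 = 0. Proof. by rewrite walk_le0. Qed.

Let z_band s v : 0 <= v -> v <= s ->
  (forall v, 0 <= v -> v <= s -> l <= a + walk c f v) -> z v = a + walk c f v.
Proof.
move=> v0 vs lw; apply: (fluid_eq_level frc zf v0) => u u0 uv.
by apply: le_trans (lw u u0 (le_trans uv vs)).
Qed.

(** The walk is nonnegative up to the exit since [0 <= l], so that the fluid
    level is the walk until then and the statements on [tau_up] transfer. *)
Lemma band_up : let s := fine (exit_up a h l) in
  (exit_up a h l < +oo)%E ->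
  [/\ 0 <= s, f s \in S_plus c, z s = h,
      (forall v, 0 <= v -> v <= s -> z v <= h) &
      (forall e, s < e -> exists t, [/\ s < t, t < e & h < z t])].
Proof.
move=> s /exit_up_fin[ud us].
have [s0 ws fs wle close] := tau_up_fin frc c_neq0 ah us.
have lw v : 0 <= v -> v <= s -> l <= a + walk c f v.
  rewrite le_eqVlt => /predU1P[<- _|v0 vs]; first by rewrite w0 addr0.
  rewrite leNgt; apply/negP => vl.
  have : (tau_down c f a l <= v%:E)%E by exact: first_time_le.
  by rewrite leNgt (le_lt_trans _ ud)// us lee_fin.
split => //.
- by rewrite (z_band s0 (lexx s) lw).
- by move=> v v0 vs; rewrite (z_band v0 vs lw) wle.
move=> e /close[t [st te ht]]; exists t; split => //.
apply: lt_le_trans ht _.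
by have [] := (fluid_le frc zf t (z t)).1 (lexx _).
Qed.

Lemma band_down : let s := fine (exit_down a h l) in
  (exit_down a h l < +oo)%E ->
  [/\ 0 <= s, f s \in S_minus c, z s = l &
      (forall v, 0 <= v -> v <= s -> z v <= h)].
Proof.
move=> s /exit_down_fin[du ds].
have [s0 ws fs lw] := tau_down_fin frc c_neq0 la ds.
have wh v : 0 <= v -> v <= s -> a + walk c f v <= h.
  rewrite le_eqVlt => /predU1P[<- _|v0 vs]; first by rewrite w0 addr0.
  rewrite leNgt; apply/negP => vl.
  have : (tau_up c f a h <= v%:E)%E by exact: first_time_le.
  by rewrite leNgt (le_lt_trans _ du)// ds lee_fin.
split => //; first by rewrite (z_band s0 (lexx s) lw).
by move=> v v0 vs; rewrite (z_band v0 vs lw) wh.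
Qed.

(** A crossing time of [h] that is neither before nor after the crossing time
    of [l] is infinite, by [tau_up_down_neq]. *)
Lemma band_never v : ~ (exit_up a h l < +oo)%E -> ~ (exit_down a h l < +oo)%E ->
  0 <= v -> z v <= h.
Proof.
move=> nu nd v0.
have [ud|ud|ud] := ltgtP (tau_up c f a h) (tau_down c f a l).
- by exfalso; apply: nu; apply/exit_up_lt; split => //; apply: lt_le_trans ud (leey _).
- by exfalso; apply: nd; apply/exit_down_lt; split => //; apply: lt_le_trans ud (leey _).
have uoo : tau_up c f a h = +oo%E.
  have := tau_up_ge0 c f a h; case E : (tau_up c f a h) => [s| |]// _.
  by exfalso; apply: (tau_up_down_neq frc c_neq0 ah la E); rewrite -ud.
have lw u : 0 <= u -> l <= a + walk c f u.
  by move=> u0; apply: (tau_down_pinfty frc la _ u0); rewrite -ud.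
rewrite (fluid_eq_level frc zf v0); first exact: (tau_up_pinfty ah uoo v0).
by move=> u u0 _; apply: le_trans (lw u u0).
Qed.

End band.

Section empty_period.
Context {R : realType} {S : finType}.
Variables (c : S -> R) (f : R -> S) (z : R -> R).
Hypothesis c_neq0 : forall i, c i != 0.
Hypothesis frc : right_continuous_path f.
Hypothesis zf : is_fluid_queue c f 0 z.
Hypothesis f0 : f 0 \in S_minus c.

Let empty s : (forall v, 0 < v -> v < s -> f v \in S_minus c) ->
  forall v, 0 <= v -> v <= s -> z v <= 0.
Proof.
move=> fs v v0 vs.
have w0 : walk c f 0 = 0 by rewrite walk_le0.
have mono t u : 0 <= t -> t <= u -> u < s -> walk c f u <= walk c f t.
  move=> t0 tu us; rewrite -subr_le0.
  have := @walk_diff_le _ _ c f frc 0 t u t0 tu; rewrite mul0r; apply.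
  move=> r tr ru; have := fs r (le_lt_trans t0 tr) (le_lt_trans ru us).
  by rewrite inE => /ltW.
have mono' t u : 0 <= t -> t <= u -> u <= s -> walk c f u <= walk c f t.
  move=> t0 tu; rewrite le_eqVlt => /predU1P[us|]; last exact: mono.
  move: tu; rewrite le_eqVlt => /predU1P[->//|tu].
  rewrite leNgt; apply/negP => lt.
  have lt' : walk c f t < 0 + walk c f u by rewrite add0r.
  have [r r0 rw] := walk_gt_near frc lt'.
  pose m := Num.max t (u - r / 2).
  have mu : m < u by rewrite gt_max tu/=; lra.
  have tm : t <= m by rewrite le_max lexx.
  have : `|m - u| < r.
    rewrite ltr0_norm ?subr_lt0// opprB ltrBlDl -ltrBlDr.
    by rewrite lt_max; apply/orP; right; lra.
  by move/rw; rewrite add0r ltNge mono// -us.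
apply/(fluid_le frc zf); split.
  by rewrite add0r -w0 mono'.
by move=> u u0 uv; rewrite subr_le0 mono'.
Qed.

(** The walk decreases before [beta], so that no term [X t - X v] of the
    reflection formula is positive. *)
Lemma empty_until_beta : let s := fine (beta c f) in (beta c f < +oo)%E ->
  [/\ 0 <= s, f s \in S_plus c, z s = 0 &
      (forall v, 0 <= v -> v <= s -> z v <= 0)].
Proof.
move=> s boo.
have bs : beta c f = s%:E by rewrite fineK// ge0_fin_numE// beta_ge0.
have [s0 fs neg] := beta_fin frc c_neq0 bs.
have e := empty neg; split => //.
by apply/eqP; rewrite eq_le e//=; case: zf.
Qed.

Lemma empty_forever v : ~ (beta c f < +oo)%E -> 0 <= v -> z v <= 0.
Proof.
move=> nb v0; have boo : beta c f = +oo%E.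
  by apply/eqP; rewrite -leye_eq leNgt; apply/negP.
apply: (@empty v) => // u u0 _; exact: beta_pinfty boo u0.
Qed.

End empty_period.

(** * The level and its maximum as functions of path and clock *)

Section events.
Context {R : realType} {S : finType} (c : S -> R).
Implicit Types (p : (R -> S) * (nat -> R)) (b x y : R) (k : nat).

(** Stated by the reflection formula, these events depend on the path and the
    clock only and not on a family of fluid levels; they can thus be applied to
    the restarted pair. *)
Definition ends_below b y k p : Prop := reflected_le c p.1 b (clock p.2 k) y.

Definition exceeds b x y k p : Prop :=
  (exists v, [/\ 0 <= v, v <= clock p.2 k & ~ reflected_le c p.1 b v x]) /\
  ends_below b y k p.

Let path_right_continuous (i0 : S) (p : @path_clockT R S i0) :
  right_continuous_path (sval p).1.
Proof. by case: p. Qed.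

Let measurable_stage_end (i0 : S) k :
  measurable_fun setT (fun p : @path_clockT R S i0 => clock (sval p).2 k).
Proof.
by apply: (@measurable_clock _ _ (@path_clockT R S i0)); exact: measurable_path_clock.
Qed.

Lemma measurable_ends_below (i0 : S) b y k : 0 <= y ->
  measurable [set p : @path_clockT R S i0 | ends_below b y k (sval p)].
Proof.
move=> y0; exact: (@measurable_reflected_le _ _ (@path_clockT R S i0) _ c _
  (@path_right_continuous i0) (@measurable_path_eval R S i0) b _ y y0
  (@measurable_stage_end i0 k)).
Qed.

Lemma measurable_exceeds_ends (i0 : S) b x y k : 0 <= x -> 0 <= y ->
  measurable [set p : @path_clockT R S i0 | exceeds b x y k (sval p)].
Proof.
move=> x0 y0; apply: measurableI; last exact: measurable_ends_below.
exact: (@measurable_exceeds _ _ (@path_clockT R S i0) _ c _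
  (@path_right_continuous i0) (@measurable_path_eval R S i0) b _ x x0
  (@measurable_stage_end i0 k)).
Qed.

Variables (f : R -> S) (ys : nat -> R) (a : R) (z : R -> R).
Hypothesis frc : right_continuous_path f.
Hypothesis zf : is_fluid_queue c f a z.

Lemma ends_below_fluid y k : z (clock ys k) <= y <-> ends_below a y k (f, ys).
Proof. exact: fluid_le. Qed.

Lemma exceeds_fluid x y k : 0 <= x ->
  (x < running_max z (clock ys k) /\ z (clock ys k) <= y) <->
  exceeds a x y k (f, ys).
Proof.
move=> x0; split=> [[/(running_max_gt zf _ x0)[v [v0 vk xz]] /ends_below_fluid zy]|].
  by split => //; exists v; split => //; apply/(fluid_gt frc zf).
move=> [[v [v0 vk /(fluid_gt frc zf) xz]] /ends_below_fluid zy]; split => //.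
by apply/(running_max_gt zf _ x0); exists v.
Qed.

Variables (s : R) (n k : nat).
Hypotheses (s0 : 0 <= s) (sk : s < clock ys k) (nk : (n < k)%N).

Lemma ends_below_restart y : z (clock ys k) <= y <->
  ends_below (z s) y (k - n) (theta s f, residual ys n s).
Proof.
have -> : clock ys k = s + (clock ys k - s) by rewrite addrC subrK.
rewrite (fluid_restart frc zf y s0) ?subr_ge0 ?ltW//.
by rewrite /ends_below /= clock_residual ?subn_gt0// subnKC// ltnW.
Qed.

(** If the level has not exceeded [x] by the time [s], the first excess happens
    after [s], hence for the restarted path. *)
Lemma exceeds_restart x y : 0 <= x ->
  (forall v, 0 <= v -> v <= s -> z v <= x) ->
  (x < running_max z (clock ys k) /\ z (clock ys k) <= y) <->
  exceeds (z s) x y (k - n) (theta s f, residual ys n s).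
Proof.
move=> x0 zx; rewrite /exceeds /= clock_residual ?subn_gt0// subnKC 1?ltnW//.
split=> -[].
  move=> /(running_max_gt zf _ x0)[v [v0 vk xz]] /ends_below_restart zy.
  split => //; exists (v - s).
  have sv : s <= v.
    by rewrite leNgt; apply/negP => /ltW/(zx v v0); rewrite leNgt xz.
  split; rewrite ?subr_ge0 ?lerB//.
  move=> /(fluid_restart frc zf x s0); rewrite subr_ge0 => /(_ sv).
  by rewrite addrC subrK leNgt xz.
move=> [v [v0 vk nr]] /ends_below_restart zy; split => //.
apply/(running_max_gt zf _ x0); exists (s + v); split.
- exact: addr_ge0.
- by rewrite -lerBrDl.
by rewrite ltNge; apply/negP => /(fluid_restart frc zf x s0 v0).
Qed.

End events.

(** * Exit times are optional times *)

Section optional_times.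
Context {R : realType} {S : finType} {d} {Omega : measurableType d}.
Variables (P : S -> probability Omega R) (A : S -> S -> R) (phi : Omega -> R -> S).
Variables (Y : nat -> {mfun Omega >-> R}) (nu : R) (L : nat) (c : S -> R).
Hypothesis ctmc_phi : is_ctmc A P phi.
Hypothesis clock_Y : is_exponential_clock P phi Y nu.

Let frc := ctmc_right_continuous ctmc_phi.

Section past_events.
Variable t : R.
Let G := [set E | exists u j, [/\ 0 <= u, u <= t & E = [set w | phi w u = j]]].
Let T := g_sigma_algebraType G.

Let past_walk u : u <= t -> measurable_fun setT (fun w : T => walk c (phi w) u).
Proof.
move=> ut; apply: (@measurable_walk _ _ _ T) => // v j v0 vu.
by apply: sub_sigma_algebra; exists v, j; split => //; exact: le_trans ut.
Qed.

Let past_walk_gt a m u : u <= t ->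
  measurable [set w : T | m < a + walk c (phi w) u].
Proof.
move=> ut; rewrite -[X in measurable X]setTI.
apply: (measurable_fun_ltr (f := cst m) (g := fun w : T => a + walk c (phi w) u)) => //.
by apply: measurable_funD => //; exact: past_walk.
Qed.

Let past_walk_lt a m u : u <= t ->
  measurable [set w : T | a + walk c (phi w) u < m].
Proof.
move=> ut; rewrite -[X in measurable X]setTI.
apply: (measurable_fun_ltr (g := cst m) (f := fun w : T => a + walk c (phi w) u)) => //.
by apply: measurable_funD => //; exact: past_walk.
Qed.

(** [exit_up_rat] involves the walk at rational times before [t] only, and the
    walk up to [t] is a function of the phases up to [t]. *)
Lemma exit_up_past a h l :
  past phi t [set w | (exit_up c (phi w) a h l < t%:E)%E].
Proof.
change (measurable ([set w | (exit_up c (phi w) a h l < t%:E)%E] : set T)).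
rewrite (_ : [set w | _] = \bigcup_(q : rat) (if 0 < (ratr q : R) < t then
  [set w | h < a + walk c (phi w) (ratr q)] `&`
  ~` \bigcup_(r : rat) (if 0 < (ratr r : R) <= ratr q then
    [set w | a + walk c (phi w) (ratr r) < l] else set0) else set0)).
  apply: bigcupT_measurable_rat => q; case: ifP => // /andP[q0 qt].
  apply: measurableI; first exact: past_walk_gt (ltW qt).
  apply: measurableC; apply: bigcupT_measurable_rat => r; case: ifP => // /andP[r0 rq].
  by apply: past_walk_lt; apply: le_trans rq (ltW qt).
apply/seteqP; split=> w /=.
  move=> /exit_up_lt/(exit_up_rat _ _ _ _ _ (@frc w))[q [qt hq lr]].
  exists q => //; rewrite qt; split => // -[r _].
  by case: ifP => // /lr; rewrite leNgt => /negP.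
move=> [q _]; case: ifP => // qt [hq nr].
apply/exit_up_lt/(exit_up_rat _ _ _ _ _ (@frc w)); exists q; split => // r rq.
by rewrite leNgt; apply/negP => rl; apply: nr; exists r => //; rewrite rq.
Qed.

Lemma exit_down_past a h l :
  past phi t [set w | (exit_down c (phi w) a h l < t%:E)%E].
Proof.
change (measurable ([set w | (exit_down c (phi w) a h l < t%:E)%E] : set T)).
rewrite (_ : [set w | _] = \bigcup_(q : rat) (if 0 < (ratr q : R) < t then
  [set w | a + walk c (phi w) (ratr q) < l] `&`
  ~` \bigcup_(r : rat) (if 0 < (ratr r : R) <= ratr q then
    [set w | h < a + walk c (phi w) (ratr r)] else set0) else set0)).
  apply: bigcupT_measurable_rat => q; case: ifP => // /andP[q0 qt].
  apply: measurableI; first exact: past_walk_lt (ltW qt).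
  apply: measurableC; apply: bigcupT_measurable_rat => r; case: ifP => // /andP[r0 rq].
  by apply: past_walk_gt; apply: le_trans rq (ltW qt).
apply/seteqP; split=> w /=.
  move=> /exit_down_lt/(exit_down_rat _ _ _ _ _ (@frc w))[q [qt hq lr]].
  exists q => //; rewrite qt; split => // -[r _].
  by case: ifP => // /lr; rewrite leNgt => /negP.
move=> [q _]; case: ifP => // qt [hq nr].
apply/exit_down_lt/(exit_down_rat _ _ _ _ _ (@frc w)); exists q; split => // r rq.
by rewrite leNgt; apply/negP => rl; apply: nr; exists r => //; rewrite rq.
Qed.

Lemma beta_past : past phi t [set w | (beta c (phi w) < t%:E)%E].
Proof.
change (measurable ([set w | (beta c (phi w) < t%:E)%E] : set T)).
rewrite (_ : [set w | _] = \bigcup_(q : rat) (if 0 < (ratr q : R) < t then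
  \bigcup_(j in [set j | j \in S_plus c]) [set w | phi w (ratr q) = j] else set0)).
  apply: bigcupT_measurable_rat => q; case: ifP => // /andP[q0 qt].
  apply: fin_bigcup_measurable => // j _; apply: sub_sigma_algebra.
  by exists (ratr q), j; split => //; exact: ltW.
apply/seteqP; split=> w /=.
  move=> /(beta_rat _ _ (@frc w))[q [qt fq]].
  by exists q => //; rewrite qt; exists (phi w (ratr q)).
move=> [q _]; case: ifP => // qt [j jp pj].
by apply/(beta_rat _ _ (@frc w)); exists q; rewrite qt pj.
Qed.

End past_events.

Section alive.
Variable sigma : Omega -> \bar R.
Hypothesis sigma_ge0 : forall w, (0 <= sigma w)%E.
Hypothesis sigma_past : forall t : R, 0 <= t ->
  past phi t [set w | (sigma w < t%:E)%E].

Lemma optional_lt_measurable t : measurable [set w | (sigma w < t%:E)%E].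
Proof.
have [t0|t0] := leP 0 t; first exact: (past_measurable ctmc_phi (@sigma_past t t0)).
rewrite (_ : [set w | _] = set0)//; apply/seteqP; split=> w //=.
by rewrite ltNge (le_trans _ (sigma_ge0 w))// lee_fin ltW.
Qed.

Lemma optional_finite_measurable : measurable [set w | (sigma w < +oo)%E].
Proof.
rewrite (_ : [set w | _] = \bigcup_(n : nat) [set w | (sigma w < n%:R%:E)%E]).
  by apply: bigcupT_measurable => n; exact: optional_lt_measurable.
apply/seteqP; split=> w /=; last by move=> [n _ /= h]; apply: lt_trans h (ltry _).
move=> soo; have fs : sigma w \is a fin_num by rewrite ge0_fin_numE.
exists (Num.bound (fine (sigma w))) => //=; rewrite -(fineK fs) lte_fin /=.
by apply: archi_boundP; rewrite fine_ge0.
Qed.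

(** Stages are almost surely positive, so that stage [n] ends no later than
    the whole clock when [n < L]. *)
Lemma alive_stopped i j n : (n < L)%N ->
  P i [set w | alive_at (phi w) (Y ^~ w) L (sigma w) j n] =
  P i (stopped phi Y sigma j n).
Proof.
move=> nL.
have mC : measurable_fun setT (fun w => clock (Y ^~ w) L).
  by apply: measurable_clock => m; exact: measurable_funPT.
have mS := stopped_measurable Y ctmc_phi sigma_ge0 sigma_past j n.
apply: (regular_eq ctmc_phi clock_Y (L := L) (i := i)) => //.
  rewrite (_ : [set w | _] = stopped phi Y sigma j n `&`
      \bigcup_(q : rat) ([set w | (sigma w < (ratr q)%:E)%E] `&`
                         [set w | ratr q < clock (Y ^~ w) L])).
    apply: measurableI => //; apply: bigcupT_measurable_rat => q.
    apply: measurableI; first exact: optional_lt_measurable.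
    rewrite -[X in measurable X]setTI.
    exact: (measurable_fun_ltr (f := cst (ratr q))).
  apply/seteqP; split=> w /=.
    move=> [sL pj st]; have soo : (sigma w < +oo)%E by apply: lt_trans sL (ltry _).
    split => //.
    have fs : sigma w \is a fin_num by rewrite ge0_fin_numE.
    move: sL; rewrite -(fineK fs) lte_fin => /ratr_between[q /andP[sq qL]].
    by exists q => //; split => //=; rewrite -(fineK fs) lte_fin.
  move=> [[soo pj st] [q _ [/= sq qL]]]; split => //.
  by apply: lt_trans sq _; rewrite lte_fin.
move=> w rw; split=> [[sL pj st]|[soo pj st]]; split => //.
  by apply: lt_trans sL (ltry _).
have fs : sigma w \is a fin_num by rewrite ge0_fin_numE.
by rewrite -(fineK fs) lte_fin; exact: regular_stage_lt rw nL (leqnn L) st.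
Qed.

End alive.

(** Translating the levels by [b] gives exits from a band with bottom [b], with
    probabilities that depend on the differences of levels only. *)
Lemma up_prob_stopped a h b n i j : (n < L)%N ->
  up_prob P c phi Y L a h n i j =
  fine (P i (stopped phi Y (fun w => exit_up c (phi w) (a + b) (h + b) b) j n)).
Proof.
move=> nL; rewrite /up_prob -alive_stopped//.
have E w : tau_down c (phi w) (a + b) b = tau_down c (phi w) a 0.
  by rewrite -{2}[b]add0r tau_down_translate.
- congr fine; congr (P i _); apply/seteqP; split=> w /=;
    rewrite /exit_up tau_up_translate E.
    by move=> [-> ?].
  by case: ifP => ud al; split => //; case: al.
- by move=> w; exact: exit_up_ge0.
by move=> t _; exact: exit_up_past.
Qed.

Lemma down_prob_stopped a h b n i j : (n < L)%N ->
  down_prob P c phi Y L a h n i j =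
  fine (P i (stopped phi Y (fun w => exit_down c (phi w) (a + b) (h + b) b) j n)).
Proof.
move=> nL; rewrite /down_prob -alive_stopped//.
have E w : tau_down c (phi w) (a + b) b = tau_down c (phi w) a 0.
  by rewrite -{2}[b]add0r tau_down_translate.
- congr fine; congr (P i _); apply/seteqP; split=> w /=;
    rewrite /exit_down tau_up_translate E.
    by move=> [-> ?].
  by case: ifP => ud al; split => //; case: al.
- by move=> w; exact: exit_down_ge0.
by move=> t _; exact: exit_down_past.
Qed.

End optional_times.

(** * Renewal equations for the maximum and the level *)

Section fluid_renewal.
Context {R : realType} {S : finType} {d} {Omega : measurableType d}.
Variables (P : S -> probability Omega R) (A : S -> S -> R) (phi : Omega -> R -> S).
Variables (Y : nat -> {mfun Omega >-> R}) (nu : R) (L : nat) (c : S -> R).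
Variable Z : R -> Omega -> R -> R.
Hypothesis c_neq0 : forall i, c i != 0.
Hypothesis ctmc_phi : is_ctmc A P phi.
Hypothesis clock_Y : is_exponential_clock P phi Y nu.
Hypothesis fluid_Z :
  forall a, 0 <= a -> forall w, is_fluid_queue c (phi w) a (Z a w).

Let ys w : nat -> R := Y ^~ w.
Let frc := ctmc_right_continuous ctmc_phi.
Let mys m : measurable_fun setT (ys ^~ m). Proof. exact: measurable_funPT. Qed.
Let mC k : measurable_fun setT (fun w => clock (ys w) k).
Proof. exact: measurable_clock. Qed.

Definition level_event a y k : set Omega :=
  [set w | Z a w (clock (ys w) k) <= y].

Definition max_level_event a x y k : set Omega :=
  [set w | x < running_max (Z a w) (clock (ys w) k) /\ Z a w (clock (ys w) k) <= y].

Lemma level_eventE a y k : 0 <= a ->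
  level_event a y k = [set w | ends_below c a y k (phi w, ys w)].
Proof.
by move=> a0; apply/seteqP; split=> w /(ends_below_fluid (ys w) (@frc w) (fluid_Z a0 w)).
Qed.

Lemma max_level_eventE a x y k : 0 <= a -> 0 <= x ->
  max_level_event a x y k = [set w | exceeds c a x y k (phi w, ys w)].
Proof.
by move=> a0 x0; apply/seteqP; split=> w
  /(exceeds_fluid (ys w) (@frc w) (fluid_Z a0 w) y k x0).
Qed.

Lemma level_event_measurable a y k : 0 <= a -> 0 <= y ->
  measurable (level_event a y k).
Proof.
move=> a0 y0; rewrite level_eventE//.
exact: (measurable_reflected_le c frc (ctmc_measurable ctmc_phi) a y0 (mC k)).
Qed.

Lemma max_level_event_measurable a x y k : 0 <= a -> 0 <= x -> 0 <= y ->
  measurable (max_level_event a x y k).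
Proof.
move=> a0 x0 y0; rewrite max_level_eventE//; apply: measurableI.
  exact: (measurable_exceeds c frc (ctmc_measurable ctmc_phi) a x0 (mC k)).
by have := level_event_measurable k a0 y0; rewrite level_eventE.
Qed.

Let q := q_prob P Y Z.
Let Q := Q_prob P Y Z.

Lemma probability_split i (H U : set Omega) : measurable H -> measurable U ->
  fine (P i H) = fine (P i (H `&` U)) + fine (P i (H `&` ~` U)).
Proof.
move=> mH mU; have -> : P i H = (P i (H `\` U) + P i (H `&` U))%E by exact: measureDI.
by rewrite addeC setDE fineD//; apply: fin_num_measure; apply: measurableI => //; exact: measurableC.
Qed.

Section band.
Variables (a h l x y : R) (k : nat).
Hypotheses (l0 : 0 <= l) (la : l <= a) (ah : a <= h) (hx : h <= x) (y0 : 0 <= y).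
Hypothesis kL : (k <= L)%N.

Let a0 : 0 <= a. Proof. exact: le_trans l0 la. Qed.
Let h0 : 0 <= h. Proof. exact: le_trans a0 ah. Qed.
Let x0 : 0 <= x. Proof. exact: le_trans h0 hx. Qed.

Let up w := exit_up c (phi w) a h l.
Let down w := exit_down c (phi w) a h l.
Let up_ge0 w : (0 <= up w)%E. Proof. exact: exit_up_ge0. Qed.
Let down_ge0 w : (0 <= down w)%E. Proof. exact: exit_down_ge0. Qed.
Let up_past t : 0 <= t -> past phi t [set w | (up w < t%:E)%E].
Proof. by move=> _; apply: exit_up_past; exact: ctmc_phi. Qed.
Let down_past t : 0 <= t -> past phi t [set w | (down w < t%:E)%E].
Proof. by move=> _; apply: exit_down_past; exact: ctmc_phi. Qed.

Let H := max_level_event a x y k.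
Let U := [set w | (up w < +oo)%E].
Let D := [set w | (down w < +oo)%E].

Let mH : measurable H. Proof. exact: max_level_event_measurable. Qed.
Let mU : measurable U.
Proof. exact: (optional_finite_measurable ctmc_phi up_ge0 up_past). Qed.
Let mD : measurable D.
Proof. exact: (optional_finite_measurable ctmc_phi down_ge0 down_past). Qed.

(** The maximum exceeds [x] before the end of stage [k], and not before [s]:
    hence [s] falls in one of the stages before [k]. *)
Let exceeds_after i w s : regular phi Y L i w -> 0 <= s ->
  (forall v, 0 <= v -> v <= s -> Z a w v <= x) -> H w ->
  exists2 n, (n < k)%N & in_stage (ys w) n s.
Proof.
move=> rw s0 zx [xM _]; apply: (regular_stage_ex rw kL s0).
have [v [v0 vk xz]] := (running_max_gt (fluid_Z a0 w) _ x0).1 xM.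
apply: lt_le_trans vk; rewrite ltNge; apply/negP => /(zx v v0).
by rewrite leNgt xz.
Qed.

Lemma band_renewal_up i : fine (P i (H `&` U)) =
  \sum_(n < k) \sum_(j in S_plus c)
    fine (P i (stopped phi Y up j n)) * Q h x y (k - n)%N j.
Proof.
under eq_bigr do under eq_bigr do
  rewrite /Q /Q_prob -/(max_level_event _ _ _ _) max_level_eventE//.
apply: (renewal ctmc_phi clock_Y up_ge0 up_past
  (G := fun n p => exceeds c h x y (k - n)%N p) (L := L) (i0 := i)) => //.
- exact: measurableI.
- by move=> n; exact: measurable_exceeds_ends.
move=> w rw; split=> [[Hw Uw]|[n [j [nk jp [soo pj st] Gw]]]].
  have [s0 fs zs zle _] := band_up c_neq0 (@frc w) (fluid_Z a0 w) l0 la ah Uw.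
  have zx v v0 vs := le_trans (zle v v0 vs) hx.
  have [n nk st] := exceeds_after rw s0 zx Hw.
  exists n, (phi w (fine (up w))); split => //.
  have sk := regular_stage_lt rw nk kL st.
  have := (exceeds_restart (@frc w) (fluid_Z a0 w) s0 sk nk y x0 zx).1 Hw.
  by rewrite zs.
have [s0 fs zs zle _] := band_up c_neq0 (@frc w) (fluid_Z a0 w) l0 la ah soo.
have zx v v0 vs := le_trans (zle v v0 vs) hx.
have sk := regular_stage_lt rw nk kL st.
split => //; apply/(exceeds_restart (@frc w) (fluid_Z a0 w) s0 sk nk y x0 zx).
by rewrite zs.
Qed.

Lemma band_renewal_down i : fine (P i (H `&` D)) =
  \sum_(n < k) \sum_(j in S_minus c)
    fine (P i (stopped phi Y down j n)) * Q l x y (k - n)%N j.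
Proof.
under eq_bigr do under eq_bigr do
  rewrite /Q /Q_prob -/(max_level_event _ _ _ _) max_level_eventE//.
apply: (renewal ctmc_phi clock_Y down_ge0 down_past
  (G := fun n p => exceeds c l x y (k - n)%N p) (L := L) (i0 := i)) => //.
- exact: measurableI.
- by move=> n; exact: measurable_exceeds_ends.
move=> w rw; split=> [[Hw Uw]|[n [j [nk jp [soo pj st] Gw]]]].
  have [s0 fs zs zle] := band_down c_neq0 (@frc w) (fluid_Z a0 w) l0 la ah Uw.
  have zx v v0 vs := le_trans (zle v v0 vs) hx.
  have [n nk st] := exceeds_after rw s0 zx Hw.
  exists n, (phi w (fine (down w))); split => //.
  have sk := regular_stage_lt rw nk kL st.
  have := (exceeds_restart (@frc w) (fluid_Z a0 w) s0 sk nk y x0 zx).1 Hw.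
  by rewrite zs.
have [s0 fs zs zle] := band_down c_neq0 (@frc w) (fluid_Z a0 w) l0 la ah soo.
have zx v v0 vs := le_trans (zle v v0 vs) hx.
have sk := regular_stage_lt rw nk kL st.
split => //; apply/(exceeds_restart (@frc w) (fluid_Z a0 w) s0 sk nk y x0 zx).
by rewrite zs.
Qed.

(** Decomposition at the exit of a band [l, h] below [x]: the level restarts
    from [h] in a phase of positive rate or from [l] in a phase of negative
    rate, and the maximum does not exceed [x] if the band is never left. *)
Lemma band_renewal i : Q a x y k i =
  \sum_(n < k) \sum_(j in S_plus c)
    up_prob P c phi Y L (a - l) (h - l) n i j * Q h x y (k - n)%N j +
  \sum_(n < k) \sum_(j in S_minus c)
    down_prob P c phi Y L (a - l) (h - l) n i j * Q l x y (k - n)%N j.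
Proof.
rewrite /Q /Q_prob -/(max_level_event a x y k) (probability_split i mH mU).
congr (_ + _).
  rewrite band_renewal_up; apply: eq_bigr => n _; apply: eq_bigr => j _.
  rewrite (up_prob_stopped c ctmc_phi clock_Y _ _ l); last exact: leq_trans kL.
  by rewrite !subrK.
transitivity (fine (P i (H `&` D))).
  congr fine; apply: (regular_eq ctmc_phi clock_Y (L := L)).
  - by apply: measurableI => //; exact: measurableC.
  - exact: measurableI.
  move=> w rw; split=> [[Hw nU]|[Hw Dw]]; split => //.
    apply: contrapT => nD; case: Hw => /(running_max_gt (fluid_Z a0 w) _ x0)[v [v0 vk]].
    by rewrite ltNge (le_trans _ hx)// (band_never c_neq0 (@frc w) (fluid_Z a0 w) l0 la ah nU nD).
  move=> Uw; have [ud _] := exit_up_fin Uw; have [du _] := exit_down_fin Dw.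
  by have := lt_trans ud du; rewrite ltxx.
rewrite band_renewal_down; apply: eq_bigr => n _; apply: eq_bigr => j _.
rewrite (down_prob_stopped c ctmc_phi clock_Y _ _ l); last exact: leq_trans kL.
by rewrite !subrK.
Qed.

End band.

(** Decomposition at the end of the initial empty period, during which the
    maximum is zero. *)
Lemma beta_renewal x y k i : 0 <= x -> 0 <= y -> (k <= L)%N ->
  i \in S_minus c -> Q 0 x y k i =
  \sum_(n < k) \sum_(j in S_plus c)
    fine (P i [set w | alive_at (phi w) (ys w) L (beta c (phi w)) j n]) *
    Q 0 x y (k - n)%N j.
Proof.
move=> x0 y0 kL im; have z00 : (0 : R) <= 0 by [].
have b0 w : (0 <= beta c (phi w))%E by exact: beta_ge0.
have bp t : 0 <= t -> past phi t [set w | (beta c (phi w) < t%:E)%E].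
  by move=> _; apply: beta_past; exact: ctmc_phi.
transitivity (\sum_(n < k) \sum_(j in S_plus c)
   fine (P i (stopped phi Y (fun w => beta c (phi w)) j n)) *
   fine (P j [set w | exceeds c 0 x y (k - n)%N (phi w, ys w)])); last first.
  apply: eq_bigr => n _; apply: eq_bigr => j _.
  rewrite (alive_stopped ctmc_phi clock_Y b0 bp); last exact: leq_trans kL.
  by rewrite /Q /Q_prob -/(max_level_event _ _ _ _) max_level_eventE.
apply: (renewal ctmc_phi clock_Y b0 bp
  (G := fun n p => exceeds c 0 x y (k - n)%N p) (L := L) (i0 := i)) => //.
- exact: max_level_event_measurable.
- by move=> n; exact: measurable_exceeds_ends.
move=> w rw; have f0 : phi w 0 \in S_minus c by case: rw => ->.
split=> [Hw|[n [j [nk jp [soo pj st] Gw]]]].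
  have soo : (beta c (phi w) < +oo)%E.
    apply: contrapT => nb; case: Hw => /(running_max_gt (fluid_Z z00 w) _ x0)[v [v0 vk]].
    by rewrite ltNge (le_trans _ x0)// (empty_forever c_neq0 (@frc w) (fluid_Z z00 w) nb v0).
  have [s0 fs zs zle] := empty_until_beta c_neq0 (@frc w) (fluid_Z z00 w) soo.
  have zx v v0 vs := le_trans (zle v v0 vs) x0.
  have [n nk st] : exists2 n, (n < k)%N & in_stage (ys w) n (fine (beta c (phi w))).
    apply: (regular_stage_ex rw kL s0); case: Hw => xM _.
    have [v [v0 vk xz]] := (running_max_gt (fluid_Z z00 w) _ x0).1 xM.
    apply: lt_le_trans vk; rewrite ltNge; apply/negP => /(zx v v0).
    by rewrite leNgt xz.
  exists n, (phi w (fine (beta c (phi w)))); split => //.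
  have sk := regular_stage_lt rw nk kL st.
  have := (exceeds_restart (@frc w) (fluid_Z z00 w) s0 sk nk y x0 zx).1 Hw.
  by rewrite zs.
have [s0 fs zs zle] := empty_until_beta c_neq0 (@frc w) (fluid_Z z00 w) soo.
have zx v v0 vs := le_trans (zle v v0 vs) x0.
have sk := regular_stage_lt rw nk kL st.
apply/(exceeds_restart (@frc w) (fluid_Z z00 w) s0 sk nk y x0 zx).
by rewrite zs.
Qed.

(** Started above [x], or at [x] in a phase of positive rate, the level exceeds
    [x] at once, before the first stage is over. *)
Lemma Q_prob_above a x y k i : 0 <= x -> 0 <= y -> (0 < k)%N -> (k <= L)%N ->
  x < a \/ x = a /\ i \in S_plus c -> Q a x y k i = q a y k i.
Proof.
move=> x0 y0 k0 kL xa; have a0 : 0 <= a by case: xa => [/ltW|[<-]//]; exact: le_trans.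
congr fine; apply: (regular_eq ctmc_phi clock_Y (L := L)).
- exact: max_level_event_measurable.
- exact: level_event_measurable.
move=> w rw; split=> [[]//|zy]; split => //.
apply/(running_max_gt (fluid_Z a0 w) _ x0).
have z0 : Z a w 0 = a by rewrite (fluid_neg (fluid_Z a0 w)).
have Ck : 0 < clock (ys w) k.
  have := regular_clock_mono rw k0 kL; apply: lt_le_trans.
  by rewrite /clock big_ord1; case: rw => _; apply; exact: leq_trans kL.
case: xa => [xa|[xa ip]]; first by exists 0; split; rewrite ?z0//; exact: ltW.
have [r r0 rw'] := walk_right_linear c (@frc w) (lexx 0).
pose v := Num.min (clock (ys w) k) (r / 2).
have v0 : 0 < v by rewrite lt_min Ck/=; lra.
have vr : v < 0 + r by rewrite gt_min; apply/orP; right; lra.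
have wv := rw' v (ltW v0) vr; rewrite subr0 (@walk_le0 _ _ c _ 0)// subr0 in wv.
exists v; split; [exact: ltW|by rewrite ge_min lexx|].
have [+ _] := (fluid_le (@frc w) (fluid_Z a0 w) v (Z a w v)).1 (lexx _).
apply: lt_le_trans; rewrite xa wv ltrDl mulr_gt0//.
by case: rw => -> _; move: ip; rewrite inE.
Qed.

End fluid_renewal.

(** * Substochastic matrices and triangular sums *)

Section substochastic.
Context {R : realType}.

(** The coordinate of largest modulus of a fixed vector of [M] would be strictly
    smaller than itself. *)
Lemma unitmx_substochastic n (M : 'M[R]_n) : (forall i j, 0 <= M i j) ->
  (forall i, \sum_j M i j < 1) -> 1%:M - M \in unitmx.
Proof.
move=> M0 M1; rewrite unitmxE unitfE -det_tr; apply/negP => /det0P[v v0 vM].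
have vE i : v 0 i = \sum_j M i j * v 0 j.
  have /rowP/(_ i) := vM; rewrite linearB/= trmx1 mulmxBr mulmx1 !mxE => /eqP.
  rewrite subr_eq0 => /eqP ->; apply: eq_bigr => j _; first by rewrite mxE mulrC.
case: n => [|n] in M M0 M1 v v0 vM vE *.
  by move: v0; rewrite [v]thinmx0 eqxx.
pose m := [arg max_(i > (ord0 : 'I_n.+1)) `|v 0 i|]%O.
have mP i : `|v 0 i| <= `|v 0 m| by rewrite /m; case: arg_maxP => // i' _; apply.
have vm : 0 < `|v 0 m|.
  rewrite lt_neqAle normr_ge0 andbT eq_sym; apply: contra v0 => /eqP vm0.
  by apply/eqP/rowP => i; rewrite mxE; apply/eqP; rewrite -normr_le0 -vm0.
have : `|v 0 m| <= (\sum_j M m j) * `|v 0 m|.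
  rewrite {1}vE mulr_suml; apply: le_trans (ler_norm_sum _ _ _) _.
  by apply: ler_sum => j _; rewrite normrM ger0_norm// ler_wpM2l.
by apply/negP; rewrite -ltNge -[ltRHS]mul1r ltr_pM2r.
Qed.

Lemma sum_mulmx_lt1 m n (M : 'M[R]_(m, n)) (N : 'M[R]_(n, m)) :
  (forall i j, 0 <= M i j) -> (forall i j, 0 <= N i j) ->
  (forall i, \sum_j M i j < 1) -> (forall i, \sum_j N i j <= 1) ->
  1%:M - M *m N \in unitmx.
Proof.
move=> M0 N0 M1 N1; apply: unitmx_substochastic => [i j|i].
  by rewrite mxE; apply: sumr_ge0 => l _; exact: mulr_ge0.
apply: le_lt_trans (M1 i).
under eq_bigr do rewrite mxE; rewrite exchange_big /=; apply: ler_sum => l _.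
by rewrite -mulr_sumr ler_piMr.
Qed.

End substochastic.

Section triangular.
Variables (V : zmodType).

(** The corner [m = n = 0] is the term that will contain the unknown. *)
Lemma big_triangle (k : nat) (W : nat -> nat -> V) : (0 < k)%N ->
  \sum_(m < k) \sum_(n < k - m) W m n =
  W 0%N 0%N + \sum_(m < k) \sum_(n < k | (1 <= m + n <= k - 1)%N) W m n.
Proof.
case: k => // k _.
have E (m : 'I_k.+1) : \sum_(n < k.+1 - m) W m n =
    \sum_(n < k.+1 | (m + n < k.+1)%N) W m n.
  rewrite (big_ord_widen_cond k.+1 predT (W m)) ?leq_subr//=.
  by apply: eq_bigl => n; rewrite ltn_subRL.
rewrite (eq_bigr _ (fun m _ => E m)) !pair_big_dep /= (bigD1 (ord0, ord0))//=.
congr (_ + _); apply: eq_bigl => -[m n] /=.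
rewrite subn1 /= ltnS andbC; congr (_ && _).
by rewrite xpair_eqE -!val_eqE /=; case: (nat_of_ord m) (nat_of_ord n) => [|?] [|?].
Qed.

End triangular.

Section vectors.
Context {R : realType} {S : finType}.

Lemma mulmx_mat_vec (B C : {set S}) (g : S -> S -> R) (h : S -> R) :
  mat B C g *m vec C h = vec B (fun i => \sum_(j in C) g i j * h j).
Proof.
apply/colP => i; rewrite !mxE [RHS]big_enum_val.
by apply: eq_bigr => j _; rewrite !mxE.
Qed.

Lemma vec_sum (B : {set S}) k (F : 'I_k -> S -> R) :
  vec B (fun i => \sum_(n < k) F n i) = \sum_(n < k) vec B (F n).
Proof.
by apply/colP => i; rewrite mxE summxE; apply: eq_bigr => n _; rewrite mxE.
Qed.

Lemma vecD (B : {set S}) (F G : S -> R) :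
  vec B (fun i => F i + G i) = vec B F + vec B G.
Proof. by apply/colP => i; rewrite !mxE. Qed.

Lemma eq_vec (B : {set S}) (F G : S -> R) :
  {in B, F =1 G} -> vec B F = vec B G.
Proof. by move=> FG; apply/colP => i; rewrite !mxE FG// enum_valP. Qed.

Lemma mat_row_sum (B C : {set S}) (g : S -> S -> R) i :
  \sum_j mat B C g i j = \sum_(j in C) g (enum_val i) j.
Proof. by rewrite [RHS]big_enum_val; apply: eq_bigr => j _; rewrite mxE. Qed.

End vectors.

(** * Mass of the phases at an optional time *)

Section stopped_mass.
Context {R : realType} {S : finType} {d} {Omega : measurableType d}.
Variables (P : S -> probability Omega R) (A : S -> S -> R) (phi : Omega -> R -> S).
Variables (Y : nat -> {mfun Omega >-> R}) (nu : R) (L : nat).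
Hypothesis nu_gt0 : 0 < nu.
Hypothesis ctmc_phi : is_ctmc A P phi.
Hypothesis clock_Y : is_exponential_clock P phi Y nu.
Variable sigma : Omega -> \bar R.
Hypothesis sigma_ge0 : forall w, (0 <= sigma w)%E.
Hypothesis sigma_past : forall t : R, 0 <= t ->
  past phi t [set w | (sigma w < t%:E)%E].

Let mstop j n : measurable (stopped phi Y sigma j n).
Proof. exact: (stopped_measurable Y ctmc_phi sigma_ge0 sigma_past). Qed.

Let mass (C : {set S}) n :=
  \bigcup_j (if j \in C then stopped phi Y sigma j n else set0).

Let m_mass C n : measurable (mass C n).
Proof. by apply: fin_bigcup_measurable => // j _; case: ifP. Qed.

Let mass_sum i (C : {set S}) n :
  \sum_(j in C) fine (P i (stopped phi Y sigma j n)) = fine (P i (mass C n)).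
Proof.
rewrite /mass (measure_bigcup_fin (P i)); first last.
- move=> j l _ _ [w]; case: ifP => [_|_ []//]; case: ifP => [_|_ [_ []]].
  by move=> [[_ <- _] [_ <- _]].
- by move=> j; case: ifP.
rewrite (eq_bigr (fun j => (if j \in C then fine (P i (stopped phi Y sigma j n)) else 0)%:E)).
  by rewrite sumEFin -big_mkcond.
move=> j _; case: ifP => _; last by rewrite measure0.
by rewrite fineK//; exact: fin_num_measure.
Qed.

Lemma stopped_sum_le1 i (C : {set S}) n :
  \sum_(j in C) fine (P i (stopped phi Y sigma j n)) <= 1.
Proof.
rewrite mass_sum -lee_fin fineK; first exact: probability_le1.
exact: fin_num_measure.
Qed.

(** An almost surely positive optional time is at least [1 / n.+1] with positive
    probability for some [n].  This event concerns the phases only; it is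
    independent of the first stage, which is at most [1 / n.+1] with
    positive probability, and then stage [0] is missed. *)
Lemma stopped_sum_lt1 i (C : {set S}) :
  (forall w, regular phi Y L i w -> (0 < sigma w)%E) ->
  \sum_(j in C) fine (P i (stopped phi Y sigma j 0)) < 1.
Proof.
move=> pos; rewrite mass_sum.
pose late n := ~` [set w | (sigma w < (n.+1%:R^-1)%:E)%E].
have n0 n : 0 <= n.+1%:R^-1 :> R by rewrite invr_ge0.
have m_late n : measurable (late n).
  by apply: measurableC; exact: (past_measurable ctmc_phi (@sigma_past _ (n0 n))).
have w_late n : whole phi (late n).
  pose T := g_sigma_algebraType [set E | exists u j, 0 <= u /\ E = [set w | phi w u = j]].
  by apply: (@measurableC _ T); exact: (past_whole (@sigma_past _ (n0 n))).
have [n late_n] : exists n, (0 < P i (late n))%E.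
  apply: contrapT => /forallNP none.
  have late0 n : P i (late n) = 0%E.
    by apply/eqP; rewrite eq_le measure_ge0 andbT leNgt; apply/negP.
  have mU : measurable (\bigcup_n late n) by exact: bigcupT_measurable.
  have U0 : P i (\bigcup_n late n) = 0%E.
    apply/eqP; rewrite eq_le measure_ge0 andbT.
    apply: le_trans (generalized_Boole_inequality _ m_late mU) _.
    by rewrite eseries0// => k _ _; exact: late0.
  have R1 := regular_prob L ctmc_phi clock_Y i.
  have : (P i (regular phi Y L i) <= P i (\bigcup_n late n))%E.
    apply: le_measure; rewrite ?inE//.
      exact: regular_measurable ctmc_phi i.
    move=> w /pos s0.
    have [soo|] := boolP (sigma w < +oo)%E; last first.
      move=> soo; exists 0%N => //= lt; move/negP : soo; apply.
      by apply: lt_trans lt (ltry _).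
    have fs : sigma w \is a fin_num by rewrite ge0_fin_numE.
    move: s0; rewrite -(fineK fs) lte_fin => s0.
    have [k _ /(_ k (leqnn k)) /= kn] := near_infty_natSinv_lt (PosNum s0).
    exists k => //; rewrite /late /= -(fineK fs) lte_fin => lt.
    by have := lt_trans lt kn; rewrite ltxx.
  by rewrite R1 U0 lee_fin leNgt ltr01.
pose e : R := n.+1%:R^-1.
have e0 : 0 < e by rewrite invr_gt0.
pose B := late n `&` [set w | e < Y 0%N w].
have mY0 : measurable [set w | e < Y 0%N w].
  rewrite -[X in measurable X]setTI.
  exact: (measurable_fun_ltr (f := cst e)).
have mB : measurable B by exact: measurableI.
have PB : P i B = (P i (late n) * (tail nu e)%:E)%E.
  have := start_clock_law clock_Y i 1 (fun=> e) (w_late n).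
  rewrite big_ord1 => <-; congr (P i (_ `&` _)); apply/seteqP; split=> w /=.
    by move=> ? [].
  by move=> /(_ 0%N isT).
pose N := late n `\` B.
have mN : measurable N by exact: measurableD.
have tail1 : tail nu e < 1.
  by rewrite /tail max_l ?ltW// -expR0 ltr_expR mulNr oppr_lt0 mulr_gt0.
have fl : P i (late n) \is a fin_num by exact: fin_num_measure.
have PN : (0 < P i N)%E.
  have : P i (late n) = (P i N + P i B)%E.
    have -> : P i (late n) = (P i (late n `\` B) + P i (late n `&` B))%E by exact: measureDI.
    by congr (_ + P i _)%E; rewrite /B setIA setIid.
  rewrite PB; have fN : P i N \is a fin_num by exact: fin_num_measure.
  rewrite -(fineK fl) -(fineK fN) -EFinM -EFinD => -[E].
  rewrite lte_fin; move: late_n; rewrite -(fineK fl) lte_fin => l0.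
  have : fine (P i (late n)) * tail nu e < fine (P i (late n)) by rewrite gtr_pMr.
  lra.
have sub : mass C 0 `<=` ~` N.
  move=> w [j _]; case: ifP => // jC [soo pj /andP[_]].
  rewrite /clock big_ord1 => sY [/= late_w nB]; apply: nB; split => //=.
  apply: le_lt_trans sY; rewrite leNgt; apply/negP => se; apply: late_w.
  by rewrite /= -(fineK (_ : sigma w \is a fin_num)) ?lte_fin// ge0_fin_numE.
have : (P i (mass C 0) <= 1 - P i N)%E.
  rewrite -probability_setC//; apply: le_measure => //; rewrite inE//.
  exact: measurableC.
have fm : P i (mass C 0) \is a fin_num by exact: fin_num_measure.
have fN : P i N \is a fin_num by exact: fin_num_measure.
move: PN; rewrite -(fineK fm) -(fineK fN) lte_fin -EFinB lee_fin.
by rewrite !fineK//; lra.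
Qed.

End stopped_mass.

(** * Joint distribution of the maximum and the level *)

Theorem theorem5p8 (R : realType) (S : finType) (d : measure_display)
    (Omega : measurableType d) (P : S -> probability Omega R)
    (A : S -> S -> R) (phi : Omega -> R -> S) (c : S -> R)
    (nu : R) (L : nat) (Y : nat -> {mfun Omega >-> R})
    (Z : R -> Omega -> R -> R)
    (c_neq0 : forall i, c i != 0)
    (ctmc_phi : is_ctmc A P phi)
    (nu_gt0 : 0 < nu) (L_ge1 : (1 <= L)%N)
    (clock_Y : is_exponential_clock P phi Y nu)
    (fluid_Z : forall a, 0 <= a -> forall w, is_fluid_queue c (phi w) a (Z a w))
    (k : nat) (k_ge1 : (1 <= k)%N) (k_leL : (k <= L)%N)
    (a x y : R) (a_ge0 : 0 <= a) (x_ge0 : 0 <= x) (y_ge0 : 0 <= y) :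
  let Lam := Lambda P c phi Y L in
  let Ps := Psi P c phi Y L in
  let hLam := hLambda P c phi Y L in
  let hPs := hPsi P c phi Y L in
  let Ups := Upsilon P c phi Y L in
  let q b k' := q_prob P Y Z b y k' in
  let q_p b k' := vec (S_plus c) (q b k') in
  let q_m b k' := vec (S_minus c) (q b k') in
  let Q b k' := Q_prob P Y Z b x y k' in
  let Q_p b k' := vec (S_plus c) (Q b k') in
  let Q_m b k' := vec (S_minus c) (Q b k') in
  let calL n k' :=
    hPs a n *m Q_p a (k' - n)%N + hLam a n *m Q_m 0 (k' - n)%N in
  [/\ vec [set: S]%SET (joint_prob P Y Z a x y k) =
        vec [set: S]%SET (q a k) - vec [set: S]%SET (Q a k),
      a = 0 ->
        [/\ 1%:M - Ps x 0%N *m Ups 0%N \in unitmx,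
            Q_p 0 k =
              invmx (1%:M - Ps x 0%N *m Ups 0%N) *m
              (\sum_(n < k) Lam x n *m q_p x (k - n)%N +
               \sum_(m < k) \sum_(n < k | (1 <= m + n <= k - 1)%N)
                  Ps x n *m Ups m *m Q_p 0 (k - m - n)%N) &
            Q_m 0 k = \sum_(n < k) Ups n *m Q_p 0 (k - n)%N] &
      0 < a ->
        (a <= x ->
           [/\ 1%:M - Ps (x - a) 0%N *m hPs a 0%N \in unitmx,
               (* of the term m = n = 0, only the part in Q_p a k is absorbed
                  by the inverse *)
               Q_p a k =
                 invmx (1%:M - Ps (x - a) 0%N *m hPs a 0%N) *m
                 (\sum_(n < k) Lam (x - a) n *m q_p x (k - n)%N +
                  Ps (x - a) 0%N *m (hLam a 0%N *m Q_m 0 k) +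
                  \sum_(m < k) \sum_(n < k | (1 <= m + n <= k - 1)%N)
                     Ps (x - a) m *m calL n (k - m)%N) &
               Q_m a k = \sum_(n < k) calL n k]) /\
        (x < a -> Q_p a k = q_p a k /\ Q_m a k = q_m a k)].
Proof.
move=> Lam Ps hLam hPs Ups q q_p q_m Q Q_p Q_m calL.
have down_pos h i : i \in S_plus c -> forall w, regular phi Y L i w ->
    (0 < exit_down c (phi w) (0 + 0) (h + 0) 0)%E.
  move=> ip w rw; rewrite /exit_down; case: ifP => // _; rewrite addr0.
  apply: tau_down_gt0; first exact: ctmc_right_continuous ctmc_phi w.
  by case: rw => ->.
have Ps0 h : forall i j, 0 <= Ps h 0%N i j by move=> i j; rewrite mxE fine_ge0.
have Ps1 h i : \sum_j Ps h 0%N i j < 1.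
  rewrite mat_row_sum; under eq_bigr do
    rewrite (down_prob_stopped c ctmc_phi clock_Y 0 h 0)//.
  apply: (stopped_sum_lt1 nu_gt0 ctmc_phi clock_Y).
  - by move=> w; exact: exit_down_ge0.
  - by move=> t _; apply: exit_down_past; exact: ctmc_phi.
  - by apply: down_pos; exact: enum_valP.
have Ups0 : forall i j, 0 <= Ups 0%N i j by move=> i j; rewrite mxE fine_ge0.
have Ups1 i : \sum_j Ups 0%N i j <= 1.
  have b0 w : (0 <= beta c (phi w))%E by exact: beta_ge0.
  have bp t : 0 <= t -> past phi t [set w | (beta c (phi w) < t%:E)%E].
    by move=> _; apply: beta_past; exact: ctmc_phi.
  rewrite mat_row_sum; under eq_bigr do
    rewrite (alive_stopped ctmc_phi clock_Y b0 bp)//.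
  exact: (stopped_sum_le1 Y ctmc_phi b0 bp).
have hPs0 : forall i j, 0 <= hPs a 0%N i j by move=> i j; rewrite mxE fine_ge0.
have hPs1 i : \sum_j hPs a 0%N i j <= 1.
  rewrite mat_row_sum; under eq_bigr do
    rewrite (up_prob_stopped c ctmc_phi clock_Y a a 0)//.
  apply: (stopped_sum_le1 Y ctmc_phi).
  - by move=> w; exact: exit_up_ge0.
  - by move=> t _; apply: exit_up_past; exact: ctmc_phi.
(* exit of the band [b, x]: through x, where the maximum exceeds x at once, or
   down to b again *)
have plus b k' : 0 <= b -> b <= x -> (0 < k')%N -> (k' <= L)%N ->
    Q_p b k' = \sum_(n < k') Lam (x - b) n *m q_p x (k' - n)%N +
               \sum_(n < k') Ps (x - b) n *m Q_m b (k' - n)%N.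
  move=> b0 bx k'0 k'L; rewrite /Q_p /Lam /Lambda /Ps /Psi /q_p /Q_m.
  under eq_bigr do rewrite mulmx_mat_vec.
  under [X in _ + X]eq_bigr do rewrite mulmx_mat_vec.
  rewrite -!vec_sum -vecD; apply: eq_vec => i _.
  rewrite /Q (band_renewal c_neq0 ctmc_phi clock_Y fluid_Z b0 (lexx b) bx (lexx x) y_ge0 k'L).
  rewrite subrr; congr (_ + _); apply: eq_bigr => n _; apply: eq_bigr => j jp.
  congr (_ * _); apply: (Q_prob_above ctmc_phi clock_Y fluid_Z) => //.
  - by rewrite subn_gt0.
  - by right.
(* exit of the band [0, b]: up to b again, or down to the empty queue *)
have minus b k' : 0 <= b -> b <= x -> (k' <= L)%N ->
    Q_m b k' = \sum_(n < k') (hPs b n *m Q_p b (k' - n)%N +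
                               hLam b n *m Q_m 0 (k' - n)%N).
  move=> b0 bx k'L; rewrite big_split /= /hPs /hPsi /hLam /hLambda /Q_p /Q_m.
  under eq_bigr do rewrite mulmx_mat_vec.
  under [X in _ + X]eq_bigr do rewrite mulmx_mat_vec.
  rewrite -!vec_sum -vecD; apply: eq_vec => i _.
  rewrite /Q (band_renewal c_neq0 ctmc_phi clock_Y fluid_Z (lexx 0) b0 (lexx b) bx y_ge0 k'L).
  by rewrite !subr0.
have zero k' : (k' <= L)%N -> Q_m 0 k' = \sum_(n < k') Ups n *m Q_p 0 (k' - n)%N.
  move=> k'L; rewrite /Q_m /Q_p /Ups /Upsilon; under eq_bigr do rewrite mulmx_mat_vec.
  rewrite -vec_sum; apply: eq_vec => i im.
  exact: (beta_renewal c_neq0 ctmc_phi clock_Y fluid_Z).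
have solve n (M : 'M[R]_n) (u v w : 'cV[R]_n) : 1%:M - M \in unitmx ->
    u = v + (M *m u + w) -> u = invmx (1%:M - M) *m (v + w).
  move=> uM uE; have -> : v + w = (1%:M - M) *m u.
    by rewrite mulmxBl mul1mx {1}uE addrCA addrAC subrr add0r.
  by rewrite mulmxA mulVmx// mul1mx.
split.
- apply/colP => i; rewrite !mxE /joint_prob /q /Q /q_prob /Q_prob.
  set i' := enum_val i.
  have mq := level_event_measurable Y ctmc_phi fluid_Z k a_ge0 y_ge0.
  have mQ := max_level_event_measurable Y ctmc_phi fluid_Z k a_ge0 x_ge0 y_ge0.
  rewrite -/(level_event Y Z a y k) -/(max_level_event Y Z a x y k).
  rewrite (probability_split P i' mq mQ) (_ : _ `&` _ = max_level_event Y Z a x y k); last first.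
    by apply/seteqP; split=> w; [case|case=> *; split].
  rewrite addrC addKr; congr (fine (P i' _)); apply/seteqP; split=> w /=.
    by move=> [Mx Zy]; split => // -[]; rewrite ltNge Mx.
  by move=> [Zy nM]; split => //; rewrite leNgt; apply/negP => xM; apply: nM.
- move=> a0.
  have u : 1%:M - Ps x 0%N *m Ups 0%N \in unitmx by exact: sum_mulmx_lt1.
  split => //; last exact: zero.
  apply: solve => //; rewrite {1}plus// subr0; congr (_ + _).
  (* the outer index is the stage at the return to level 0, as in [plus]; the
   two sums of the statement are in the opposite order *)
pose W n m := Ps x n *m Ups m *m Q_p 0 (k - n - m)%N.
  transitivity (\sum_(n < k) \sum_(m < k - n) W n m).
    apply: eq_bigr => n _; rewrite zero ?(leq_trans (leq_subr n k))// mulmx_sumr.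
    by apply: eq_bigr => m _; rewrite mulmxA.
  rewrite (big_triangle W k_ge1); congr (_ + _); first by rewrite /W !subn0.
  rewrite (exchange_big_dep xpredT)//=; apply: eq_bigr => m _; apply: eq_big => n.
    by rewrite addnC.
  by move=> _; rewrite /W subnAC.
move=> a_gt0; split=> [ax|xa]; last first.
  split; apply: eq_vec => i _; apply: (Q_prob_above ctmc_phi clock_Y fluid_Z) => //;
    by left.
have u : 1%:M - Ps (x - a) 0%N *m hPs a 0%N \in unitmx by exact: sum_mulmx_lt1.
split => //; last exact: minus.
rewrite -addrA; apply: solve => //; rewrite {1}plus//; congr (_ + _).
pose W m n := Ps (x - a) m *m calL n (k - m)%N.
transitivity (\sum_(m < k) \sum_(n < k - m) W m n).
  by apply: eq_bigr => m _; rewrite minus ?(leq_trans (leq_subr m k))// mulmx_sumr.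
rewrite (big_triangle W k_ge1) addrA; congr (_ + _).
by rewrite /W /calL !subn0 mulmxDr mulmxA.
Qed.
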